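(* Let $\overline{M}$ be a smooth manifold of dimension $n+1$ with boundary $\partial M$ and interior $M$, and let $g$ be a projectively compact Ricci-flat pseudo-Riemannian metric on $M$. Let $\rho:U\to\mathbb{R}_{\ge0}$ be a local defining function for $\partial M$, and write $\rho_a$ for the one-form $d\rho$. Let $\partial M=\partial M_+\cup\partial M_0\cup\partial M_-$ be the curved orbit decomposition of the boundary determined by $g$. (i) The section $\rho^{-2}g^{ab}$ of $S^2TM$ (over $U\cap M$) extends smoothly to the boundary and the boundary value $\tau^{ab}$ satisfies $\tau^{ab}\rho_b=0$. Moreover, the curved orbits $\partial M_\pm$ consist of those points of $\partial M$ (in $U$) in which the bilinear form $\tau^{ab}$ has rank $n$, while in points of $\partial M_0$ it has rank $n-1$. (ii) The section $\rho^{-3}g^{ab}\rho_b$ of $TM$ extends smoothly to the boundary, and the boundary value $\lambda^a$ satisfies $\lambda^a\rho_a=0$. (iii) The function $\rho^{-4}g^{ab}\rho_a\rho_b$ on $U\cap M$ extends smoothly to the boundary.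
   Context: All affine connections are torsion free; smooth means $C^\infty$; abstract index notation is used and $g^{ab}$ is the inverse metric. For a one-form $\Upsilon$, write $\nabla+\Upsilon$ for the connection $(\xi,\eta)\mapsto\nabla_\xi\eta+\Upsilon(\xi)\eta+\Upsilon(\eta)\xi$; connections so related are projectively equivalent, and a projective structure is an equivalence class. A local defining function for $\partial M$ is a smooth $\rho:U\to\mathbb{R}_{\ge0}$, $U\subset\overline{M}$ open, with $\rho^{-1}(\{0\})=U\cap\partial M$ and $d\rho\neq0$ along $U\cap\partial M$. A pseudo-Riemannian metric $g$ on $M$ with Levi-Civita connection $\nabla$ is projectively compact of order $\alpha>0$ if near each boundary point there is a defining function $\rho$ such that $\nabla+\frac{d\rho}{\alpha\rho}$ extends smoothly to the boundary; it is projectively compact if this holds for some $\alpha>0$ (for Ricci-flat $g$ the order is then necessarily one). The projective class of $\nabla$ then extends uniquely to $\overline{M}$. Tractors: on $\overline{M}$ let $\mathcal{E}(w)=\mathrm{vol}(\overline M)^{-w/(n+2)}$ with $\mathrm{vol}$ the bundle of volume densities. The cotractor bundle is $\mathcal{T}^*=J^1(\mathcal{E}(1))$. A connection $\tilde\nabla$ in the class gives $\mathcal{T}^*\cong\mathcal{E}(1)\oplus T^*\overline M\otimes\mathcal{E}(1)$, elements $\binom{\sigma}{\mu_a}$, changing to $\binom{\sigma}{\mu_a+\Upsilon_a\sigma}$ when passing to $\tilde\nabla+\Upsilon$. The tractor connection is $\nabla^{\mathcal{T}^*}_a\binom{\sigma}{\mu_b}=\binom{\tilde\nabla_a\sigma-\mu_a}{\tilde\nabla_a\mu_b+\tilde{\mathsf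 P}_{ab}\sigma}$, with $\tilde{\mathsf P}_{ab}=\frac1n\widetilde{\mathrm{Ric}}_{ab}$ for $\tilde\nabla$ preserving a volume density. The dual $\mathcal{T}$ contains the natural line subbundle $\mathcal{E}(-1)$, the annihilator of $T^*\overline M\otimes\mathcal{E}(1)\subset\mathcal{T}^*$. Curved orbit decomposition: let $\sigma=\mathrm{vol}(g)^{-1/(n+2)}\in\Gamma(\mathcal{E}(1))$, which extends by zero to a section over $\overline{M}$ vanishing exactly on $\partial M$, and $L(\sigma)=\binom{\sigma}{\tilde\nabla_a\sigma}$, a nowhere vanishing parallel section of $\mathcal{T}^*$ over $\overline{M}$. Over $M$, in the splitting determined by $\nabla$, the bilinear form $\left(\binom{\sigma_1}{\mu_a},\binom{\sigma_2}{\mu'_a}\right)\mapsto\sigma^{-2}g^{ab}\mu_a\mu'_b$ on $\mathcal{T}^*$ is parallel; it extends to a parallel form $H$ on $\mathcal{T}^*$ over $\overline{M}$, of rank $n+1$ with null space spanned by $L(\sigma)$. Put $\tilde{\mathcal{T}}=\ker L(\sigma)\subset\mathcal{T}|_{\partial M}$, with dual $\mathcal{T}^*|_{\partial M}/\langle L(\sigma)\rangle$ (this is the standard tractor bundle of the projective structure induced on the totally geodesic boundary $\partial M$); it contains $\mathcal{E}(-1)|_{\partial M}$. $H$ induces a non-degenerate metric on $\tilde{\mathcal{T}}^*$, and its inverse is a non-degenerate metric $\tilde H$ on $\tilde{\mathcal{T}}$. Then $\partial M_0$ is the set of points of $\partial M$ where the line $\mathcal{E}(-1)$ is isotropic for $\tilde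 H$, and $\partial M_+$, $\partial M_-$ are the sets of points where $\tilde H$ is positive, respectively negative, on this line. *)

(* Defs.v *)
From mathcomp Require Import all_boot all_order all_algebra.
From mathcomp Require Import all_classical all_reals all_analysis.

Set Implicit Arguments.
Unset Strict Implicit.
Unset Printing Implicit Defensive.

Import Order.TTheory GRing.Theory Num.Theory.
Import numFieldNormedType.Exports.

Local Open Scope classical_set_scope.
Local Open Scope ring_scope.

(** ** Calculus up to the boundary on the closed half-space of R^(n+1) *)

Section HalfSpace.
Variables (R : realType) (n : nat).
Local Notation E := 'rV[R]_n.+1.

Definition halfspace : set E := [set v | 0 <= v ord0 ord0].

(* The increment is restricted to the half-space: this is the usual partial
   derivative where [x ord0 ord0 > 0]; where [x ord0 ord0 = 0] it is one-sided
   in the direction [ord0].  Values of [f] off the half-space are irrelevant. *)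
Definition pquot (i : 'I_n.+1) (f : E -> R) (x : E) (h : R) : R :=
  h^-1 * (f (x + h *: delta_mx 0 i) - f x).

Definition pincr (i : 'I_n.+1) (x : E) : set_system R :=
  within [set h | halfspace (x + h *: delta_mx 0 i)] 0^'.

Definition pderiv (i : 'I_n.+1) (f : E -> R) (x : E) : R :=
  lim (pquot i f x @ pincr i x).

(* [D] is always a relatively open subset of the half-space. *)
Fixpoint Ck (D : set E) (k : nat) (f : E -> R) : Prop :=
  {within D, continuous f} /\
  if k is k'.+1 then
    forall i, (forall x, D x -> cvg (pquot i f x @ pincr i x)) /\
              Ck D k' (pderiv i f)
  else True.

Definition smooth (D : set E) (f : E -> R) : Prop := forall k, Ck D k f.

End HalfSpace.

(** ** Smooth manifolds of dimension n+1 with boundary *)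

Record manifold (R : realType) (n : nat) := Manifold {
  carrier :> topologicalType;
  manifold_hausdorff : hausdorff_space carrier;
  manifold_countable : @second_countable carrier;
  chart : Type;
  dom : chart -> set carrier;
  coord : chart -> carrier -> 'rV[R]_n.+1;
  param : chart -> 'rV[R]_n.+1 -> carrier;
  dom_open : forall c, open (dom c);
  dom_cover : forall x, exists c, dom c x;
  coord_range : forall c, exists2 O : set 'rV[R]_n.+1,
    open O & coord c @` dom c = O `&` @halfspace R n;
  coordK : forall c x, dom c x -> param c (coord c x) = x;
  coord_continuous : forall c, {within dom c, continuous (coord c)};
  param_continuous : forall c,
    {within coord c @` dom c, continuous (param c)};
  transition_smooth : forall c c' b,
    smooth (coord c @` (dom c' `&` dom c))
           (fun v => coord c' (param c v) 0 b) }.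

Section Manifold.
Variables (R : realType) (n : nat) (M : manifold R n).
Local Notation chart := (chart M).
Local Notation index := 'I_n.+1.

Definition boundary : set M :=
  [set x | exists2 c : chart, dom c x & coord c x ord0 ord0 = 0].

Definition inner : set M := ~` boundary.

Definition smooth_in (c : chart) (U : set M) (f : M -> R) : Prop :=
  smooth (coord c @` (U `&` dom c)) (f \o param c).

Definition smooth_on (U : set M) (f : M -> R) : Prop :=
  forall c, smooth_in c U f.

Definition pd (c : chart) (i : index) (f : M -> R) (x : M) : R :=
  pderiv i (f \o param c) (coord c x).

Definition differential (c : chart) (f : M -> R) (x : M) : 'rV[R]_n.+1 :=
  \row_a pd c a f x.

(* Row [b], column [a]: derivative of the [b]-th coordinate of [c'] with
   respect to the [a]-th coordinate of [c]. *)
Definition jacobian (c c' : chart) (x : M) : 'M[R]_n.+1 :=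
  \matrix_(b, a) pd c a (fun y => coord c' y 0 b) x.

(* Tensor fields are given by their components in the charts; only the values
   at points of the domain of the chart are meaningful. *)
Definition vector_field (U : set M) (X : chart -> M -> 'cV[R]_n.+1) : Prop :=
  (forall c a, smooth_in c U (fun x => X c x a 0)) /\
  (forall c c' x, U x -> dom c x -> dom c' x ->
     X c' x = jacobian c c' x *m X c x).

Definition sym_bivector_field (U : set M) (t : chart -> M -> 'M[R]_n.+1) :
    Prop :=
  [/\ forall c a b, smooth_in c U (fun x => t c x a b),
      forall c x, U x -> dom c x -> (t c x)^T = t c x
    & forall c c' x, U x -> dom c x -> dom c' x ->
        t c' x = jacobian c c' x *m t c x *m (jacobian c c' x)^T].

Definition pseudo_riemannian (g : chart -> M -> 'M[R]_n.+1) : Prop :=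
  [/\ forall c a b, smooth_in c inner (fun x => g c x a b),
      forall c x, inner x -> dom c x -> (g c x)^T = g c x,
      forall c x, inner x -> dom c x -> g c x \in unitmx
    & forall c c' x, inner x -> dom c x -> dom c' x ->
        g c x = (jacobian c c' x)^T *m g c' x *m jacobian c c' x].

(** *** Connections *)

(* [Gam x a b k] is the coefficient Gamma^k_{ab} at [x] in a fixed chart. *)
Definition connection := M -> index -> index -> index -> R.

Definition levi_civita (g : chart -> M -> 'M[R]_n.+1) (c : chart) :
    connection := fun x a b k =>
  2^-1 * \sum_d invmx (g c x) k d *
    (pd c a (fun y => g c y b d) x + pd c b (fun y => g c y a d) x
     - pd c d (fun y => g c y a b) x).

Definition proj_change (Gam : connection) (Ups : M -> 'rV[R]_n.+1) :
    connection := fun x a b k =>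
  Gam x a b k + Ups x 0 a * (k == b)%:R + Ups x 0 b * (k == a)%:R.

Definition trace_coef (Gam : connection) (x : M) : 'rV[R]_n.+1 :=
  \row_a \sum_k Gam x a k k.

Definition ricci (c : chart) (Gam : connection) (x : M) (b d : index) : R :=
  \sum_a pd c a (fun y => Gam y b d a) x
  - \sum_a pd c b (fun y => Gam y a d a) x
  + \sum_a \sum_e Gam x a e a * Gam x b d e
  - \sum_a \sum_e Gam x b e a * Gam x a d e.

Definition ricci_flat (g : chart -> M -> 'M[R]_n.+1) : Prop :=
  forall c x b d, inner x -> dom c x -> ricci c (levi_civita g c) x b d = 0.

(** *** Projective compactness *)

Definition defining_function (U : set M) (rho : M -> R) : Prop :=
  [/\ open U, smooth_on U rho, forall x, U x -> 0 <= rho x,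
      forall x, U x -> (rho x = 0 <-> boundary x)
    & forall c x, U x -> boundary x -> dom c x -> differential c rho x != 0].

Definition extends_smoothly (c : chart) (U : set M) (f : M -> R) : Prop :=
  exists2 F, smooth_in c U F &
    forall x, U x -> inner x -> dom c x -> F x = f x.

Definition projectively_compact_of_order (alpha : R)
    (g : chart -> M -> 'M[R]_n.+1) : Prop :=
  forall x, boundary x -> exists U, exists rho,
    [/\ U x, defining_function U rho
      & forall c a b k, extends_smoothly c U (fun y =>
          proj_change (levi_civita g c)
            (fun z => (alpha * rho z)^-1 *: differential c rho z) y a b k)].

Definition projectively_compact (g : chart -> M -> 'M[R]_n.+1) : Prop :=
  exists2 alpha, 0 < alpha & projectively_compact_of_order alpha g.

(** *** Tractors *)

(* A chart trivializes vol by its coordinate density, hence E(1), as well as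
   J^1(E(1)).  A 1-jet at [x] has the components [row_mx s p] with [s] the value
   and [p] the partial derivatives of a trivialized section. *)
Local Notation cotractor := 'rV[R]_(1 + n.+1).
Local Notation tractor := 'cV[R]_(1 + n.+1).
Local Notation tractor_form := 'M[R]_(1 + n.+1).

(* Components of a section of E(1) in [c] are [density_transition c c'] times
   those in [c']: vol picks up |det J|, and E(1) is its power -1/(n+2). *)
Definition density_transition (c c' : chart) (x : M) : R :=
  `|\det (jacobian c c' x)| `^ (- (n.+2%:R)^-1).

(* Components of a cotractor in [c] are those in [c'] times this matrix. *)
Definition jet_transition (c c' : chart) (x : M) : 'M[R]_(1 + n.+1) :=
  block_mx (density_transition c c' x)%:M
           (differential c (density_transition c c') x)
           0 (density_transition c c' x *: jacobian c c' x).

(* The identification of J^1(E(1)) with E(1) (+) T^*M (x) E(1) given by a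
   connection: mu_a = p_a + Gamma^k_{ak} s / (n+2). *)
Definition splitting (Gam : connection) (x : M) : 'M[R]_(1 + n.+1) :=
  block_mx 1%:M ((n.+2%:R)^-1 *: trace_coef Gam x) 0 1%:M.

Definition schouten (c : chart) (Gam : connection) (x : M) (a b : index) : R :=
  n%:R^-1 * ricci c Gam x a b.

(* The tractor connection in the splitting of [Gam], direction [a]. *)
Definition split_cotractor_der (c : chart) (Gam : connection) (a : index)
    (t : M -> cotractor) (x : M) : cotractor :=
  let s y := lsubmx (t y) 0 0 in
  let mu b y := rsubmx (t y) 0 b in
  let w := (n.+2%:R)^-1 * trace_coef Gam x 0 a in
  row_mx (pd c a s x + w * s x - mu a x)%:M
         (\row_b (pd c a (mu b) x - \sum_k Gam x a b k * mu k x + w * mu b x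
                  + schouten c Gam x a b * s x)).

Definition cotractor_der (c : chart) (Gam : connection) (a : index)
    (t : M -> cotractor) (x : M) : cotractor :=
  split_cotractor_der c Gam a (fun y => t y *m splitting Gam y) x
    *m invmx (splitting Gam x).

(* A connection on [V] in the extended projective class of [g] that preserves
   a volume density. *)
Definition special_connection (g : chart -> M -> 'M[R]_n.+1) (c : chart)
    (V : set M) (Gam : connection) : Prop :=
  [/\ forall a b k, smooth_in c V (fun x => Gam x a b k),
      forall x a b k, V x -> Gam x a b k = Gam x b a k,
      exists2 Ups : M -> 'rV[R]_n.+1,
        forall a, smooth_in c (V `&` inner) (fun x => Ups x 0 a) &
        forall x a b k, V x -> inner x ->
          Gam x a b k = proj_change (levi_civita g c) Ups x a b k
    & exists nu : M -> R,
        [/\ smooth_in c V nu, forall x, V x -> 0 < nu x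
          & forall x, V x -> differential c nu x = nu x *: trace_coef Gam x]].

Definition form_eval (H : tractor_form) (t t' : cotractor) : R :=
  (t *m H *m t'^T) 0 0.

Definition parallel_on (c : chart) (V : set M) (Gam : connection)
    (H : M -> tractor_form) : Prop :=
  forall t t' : M -> cotractor,
    (forall i, smooth_in c V (fun x => t x 0 i)) ->
    (forall i, smooth_in c V (fun x => t' x 0 i)) ->
  forall a x, V x ->
    pd c a (fun y => form_eval (H y) (t y) (t' y)) x =
      form_eval (H x) (cotractor_der c Gam a t x) (t' x)
      + form_eval (H x) (t x) (cotractor_der c Gam a t' x).

(* vol(g) = |det g|^(1/2) in the trivialization; extended by zero. *)
Definition sigma (g : chart -> M -> 'M[R]_n.+1) (c : chart) (x : M) : R :=
  if x \in boundary then 0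
  else (Num.sqrt `|\det (g c x)|) `^ (- (n.+2%:R)^-1).

(* In the splitting of a connection the 1-jet of sigma is (sigma, nabla sigma). *)
Definition L_sigma (g : chart -> M -> 'M[R]_n.+1) (c : chart) (x : M) :
    cotractor :=
  row_mx (sigma g c x)%:M (differential c (sigma g c) x).

Definition split_inner_form (g : chart -> M -> 'M[R]_n.+1) (c : chart)
    (x : M) : tractor_form :=
  block_mx 0 0 0 ((sigma g c x) ^- 2 *: invmx (g c x)).

Definition tractor_metric (g : chart -> M -> 'M[R]_n.+1)
    (H : chart -> M -> tractor_form) : Prop :=
  [/\ [/\ forall c i j, smooth_in c setT (fun x => H c x i j),
          forall c x, dom c x -> (H c x)^T = H c x
        & forall c c' x, dom c x -> dom c' x ->
            H c' x =
              jet_transition c c' x *m H c x *m (jet_transition c c' x)^T],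
      forall c x t t', inner x -> dom c x ->
        form_eval (H c x) t t' =
          form_eval (split_inner_form g c x)
            (t *m splitting (levi_civita g c) x)
            (t' *m splitting (levi_civita g c) x),
      forall c x, dom c x -> exists V, exists Gam,
        [/\ open V, V x, V `<=` dom c, special_connection g c V Gam
          & parallel_on c V Gam (H c)]
    & forall c x, dom c x -> (kermx (H c x) == L_sigma g c x)%MS].

(** *** Curved orbits *)

(* Tractors are column vectors, paired with cotractors by [*m].  E(-1) is the
   annihilator of the cotractors with vanishing first slot. *)
Definition canonical_line : set tractor :=
  [set v | forall mu : 'rV[R]_n.+1, row_mx 0 mu *m v = 0].

(* The inverse of the metric induced by [H] on cotractors modulo ker H, as a
   form on the annihilator of ker H: see [tilde_metricE]. *)
Definition tilde_metric (H : tractor_form) (v w : tractor) : R :=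
  (v^T *m pinvmx H *m w) 0 0.

Lemma tilde_metricE (H : tractor_form) (L p : cotractor) (w : tractor) :
  H^T = H -> (kermx H == L)%MS -> L *m w = 0 ->
  tilde_metric H (H *m p^T) w = (p *m w) 0 0.
Proof.
move=> symH /eqmxP kerH Lw; rewrite /tilde_metric trmx_mul trmxK symH.
have /submxP[d dE] : (p *m H *m pinvmx H - p <= L)%MS.
  by rewrite -kerH; apply/sub_kermxP; rewrite mulmxBl mulmxKpV ?submxMl ?subrr.
by rewrite -(subrK p (p *m H *m pinvmx H)) dE mulmxDl -mulmxA Lw mulmx0 add0r.
Qed.

(* The sign conditions do not depend on the chart, as 1-jets in different
   charts are related by [jet_transition]; nor on [H], determined by its values
   over the dense subset [inner]. *)
Definition orbit (P : (tractor -> R) -> Prop)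
    (g : chart -> M -> 'M[R]_n.+1) : set M :=
  [set x | boundary x /\ exists H, tractor_metric g H /\
     exists2 c, dom c x & P (fun v => tilde_metric (H c x) v v)].

Definition orbit_zero :=
  orbit (fun q => forall v, canonical_line v -> q v = 0).

Definition orbit_plus :=
  orbit (fun q => forall v, canonical_line v -> v != 0 -> 0 < q v).

Definition orbit_minus :=
  orbit (fun q => forall v, canonical_line v -> v != 0 -> q v < 0).

End Manifold.

(* Main.v *)
(** Near the boundary the projectively changed connection is smooth, hence so is
    its Schouten tensor P; as g is Ricci-flat, [rho^2 P] has the boundary value
    [(1/alpha - 1/alpha^2) rho_a rho_b], which forces [alpha = 1].  Then
    [u = sigma / rho] solves a first-order linear system whose coefficients are
    smooth up to the boundary, and so does the parallel form
    [H = sigma^-2 g^ab] in the trivialization of the tractor bundle by a chart.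
    Solutions of such systems are bounded by Gronwall, hence Lipschitz, hence
    extend continuously, and the system itself then gives smoothness of the
    extension.  The identity [det (H + v^T v)^2 = (L v^T)^4], with
    [L = L(sigma)], passes to the boundary and shows that the kernel of H is
    spanned by L there as well.

    In block form, H = ((f, h^T), (h, B)) with [B = sigma^-2 g^-1] inside, so the
    boundary values of [rho^-2 g^ab], [rho^-3 g^ab rho_b] and
    [rho^-4 g^ab rho_a rho_b] are read off from B, h, f, the function u and its
    differential.  On the boundary L = (0, l) with l a nonzero multiple of
    [d rho], so H has rank n + 1 and [l B = 0], [l h = 0].  A preimage of the
    canonical tractor under H has first component the value of the metric of
    the boundary tractor bundle on it, and this scalar vanishes exactly when B
    drops from rank n to rank n - 1. *)

Require Import Defs.
From mathcomp Require Import all_boot all_order all_algebra.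
From mathcomp Require Import all_classical all_reals all_analysis.
From mathcomp Require Import ring lra zify.

Set Implicit Arguments.
Unset Strict Implicit.
Unset Printing Implicit Defensive.

Import Order.TTheory GRing.Theory Num.Theory.
Import numFieldNormedType.Exports.
Import Defs.

Local Open Scope classical_set_scope.
Local Open Scope ring_scope.

(** * Partial derivatives on the half-space *)

(** The Levi-Civita connection blows up at the boundary, but its tractor connection does not: in the
    jet trivialization of a chart, as opposed to a splitting, the connection matrix depends only on
    the projective class. It therefore coincides with that of the extended connection, whose
    coefficients are smooth, and this makes the linear system for [H] regular. Ricci-flatness is
    used for the order and again to make a form with only a lower block parallel.

    Functions are never extended across the face. Strict differentiability is an estimate in two
    moving points, hence survives limits: a derivative formula known inside, with ingredients
    continuous up to the face, holds on the face. Other identities pass to the boundary by density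
    of the interior.

    The determinant identity controls the rank because [v^T v] has rank at most one; its square
    absorbs the unknown sign of [det g].

    The defining function of the statement need not be the one provided by compactness, so
    [sigma / rho] is formed a second time, by dividing both functions by the boundary coordinate. *)

Lemma cvg_near_eq {T : Type} {V : topologicalType} (F : set_system T) {FF : Filter F}
  (f g : T -> V) (l : V) :
  (\forall x \near F, f x = g x) -> f @ F --> l -> g @ F --> l.
Proof.
move=> fg fl; apply: cvg_trans fl; apply: near_eq_cvg.
by apply: filterS fg => x ->.
Qed.

Lemma cvg_sumr {R : realType} {T : Type} (F : set_system T) {FF : Filter F}
  (I : Type) (r : seq I) (P : pred I) (f : I -> T -> R) (l : I -> R) :
  (forall i, P i -> f i @ F --> l i) ->
  (fun x => \sum_(i <- r | P i) f i x) @ F --> \sum_(i <- r | P i) l i.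
Proof.
move=> fl; elim: r => [|i r IH].
  by rewrite big_nil; under eq_fun do rewrite big_nil; exact: cvg_cst.
rewrite big_cons; under eq_fun do rewrite big_cons.
by case: ifP => Pi //; apply: cvgD => //; exact: fl.
Qed.

Section HalfSpaceCalculus.
Context {R : realType} {n : nat}.
Local Notation E := 'rV[R]_n.+1.
Local Notation half := (@halfspace R n).
Local Notation e_ i := (delta_mx 0 i : E).

(** Relative neighbourhoods: [K] is the closed half-space, or the open one for limits from the
    interior. *)
Definition hnear (K : set E) (x : E) : set_system E := within K (nbhs x).

#[global] Instance hnear_filter (K : set E) x : Filter (hnear K x).
Proof. exact: within_filter. Qed.

Lemma nbhs_boxP (x : E) (P : set E) :
  nbhs x P <-> exists2 e : R, 0 < e & forall y : E, (forall j, `|y 0 j - x 0 j| < e) -> P y.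
Proof.
split=> [/nbhs_ballP[e /= e0 xP]|[e e0 xP]].
  exists e => // y yx; apply: xP; split=> // i j.
  by rewrite (ord1 i) /ball /= distrC.
apply/nbhs_ballP; exists e => //= y [_ yx]; apply: xP => j.
by have := yx 0 j; rewrite /ball /= distrC.
Qed.

Lemma hnearP (K : set E) (x : E) (P : set E) :
  hnear K x P <-> exists2 e : R, 0 < e &
    forall y : E, K y -> (forall j, `|y 0 j - x 0 j| < e) -> P y.
Proof.
split; first by move=> /nbhs_boxP[e e0 xP]; exists e => // y Ky yx; exact: xP.
by move=> [e e0 xP]; apply/nbhs_boxP; exists e => // y yx Ky; exact: xP.
Qed.

Lemma hnear_self (K : set E) (x : E) (P : set E) : K x -> hnear K x P -> P x.
Proof. by move=> Kx /nbhs_singleton; exact. Qed.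

(** Relational form of [pderiv]: [lim] has a default value on divergent filters, so the rules below
    carry the limit [l] explicitly. *)
Definition is_pd (i : 'I_n.+1) (f : E -> R) (x : E) (l : R) : Prop :=
  pquot i f x @ pincr i x --> l.

Definition hcont (f : E -> R) (x : E) : Prop := f @ hnear half x --> f x.

#[global] Instance pincr_filter i (x : E) : Filter (pincr i x).
Proof. exact: within_filter. Qed.

Lemma moveE (x : E) (h : R) i j : (x + h *: e_ i) 0 j = x 0 j + h * (j == i)%:R.
Proof. by rewrite !mxE eqxx. Qed.

Lemma pincrP i (x : E) (P : set R) :
  pincr i x P <-> exists2 e : R, 0 < e &
    forall h, h != 0 -> `|h| < e -> half (x + h *: e_ i) -> P h.
Proof.
split=> [/nbhs_ballP[e /= e0 xP]|[e e0 xP]].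
  exists e => // h h0 he Hh; apply: xP => //=.
  by rewrite /ball /= sub0r normrN.
apply/nbhs_ballP; exists e => //= h; rewrite /ball /= sub0r normrN => he h0 Hh.
exact: xP.
Qed.

Lemma half_move_ge0 (x : E) i (h : R) : half x -> 0 <= h -> half (x + h *: e_ i).
Proof.
rewrite /halfspace /= moveE => x0 h0; apply: addr_ge0 => //.
by rewrite mulr_ge0.
Qed.

Lemma pincr_proper i (x : E) : half x -> ProperFilter (pincr i x).
Proof.
move=> hx; apply: Build_ProperFilter_ex => P /pincrP[e e0 xP].
exists (e / 2); apply: xP; rewrite ?gt_eqF ?divr_gt0//.
  by rewrite gtr0_norm ?divr_gt0// ltr_pdivrMr// ltr_pMr// ltr1n.
by apply: half_move_ge0 => //; rewrite ltW ?divr_gt0.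
Qed.

Lemma is_pd_pderiv i f (x : E) l : half x -> is_pd i f x l -> pderiv i f x = l.
Proof. by move=> hx xl; have ? := pincr_proper i hx; exact: cvg_lim. Qed.

Lemma is_pd_uniq i f (x : E) l l' :
  half x -> is_pd i f x l -> is_pd i f x l' -> l = l'.
Proof. by move=> hx /(is_pd_pderiv hx) <- /(is_pd_pderiv hx). Qed.

Lemma move_cvg i (x : E) : (fun h : R => x + h *: e_ i) @ pincr i x --> hnear half x.
Proof.
move=> P /hnearP[e e0 xP]; apply/pincrP; exists e => // h h0 he hh; apply: xP => // j.
rewrite moveE addrC addKr; apply: le_lt_trans he; rewrite normrM ler_piMr//.
by case: eqP => //; rewrite ?normr1 ?normr0.
Qed.

Lemma move_near i (x : E) (P : set E) : hnear half x P ->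
  \forall h \near pincr i x, P (x + h *: e_ i).
Proof. exact: move_cvg. Qed.

Lemma hnear_eq_is_pd i f g (x : E) l : half x ->
  (\forall y \near hnear half x, f y = g y) -> is_pd i f x l -> is_pd i g x l.
Proof.
move=> hx fg; apply: cvg_trans; apply: near_eq_cvg.
have fgx : f x = g x := hnear_self hx fg.
apply: filterS (move_near i fg) => h /= fgh.
by rewrite /pquot fgh fgx.
Qed.

(** No convergence is assumed: the two quotients have the same image filter, so even the default
    value of [lim] agrees. *)
Lemma hnear_eq_pderiv i f g (x : E) : half x ->
  (\forall y \near hnear half x, f y = g y) -> pderiv i f x = pderiv i g x.
Proof.
move=> hx fg; have fgx : f x = g x := hnear_self hx fg.
have fgn : \forall h \near pincr i x, pquot i f x h = pquot i g x h.
  by apply: filterS (move_near i fg) => h /= fgh; rewrite /pquot fgh fgx.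
rewrite /pderiv; congr (lim _); apply/seteqP; split; apply: near_eq_cvg => //.
by apply: filterS fgn => h ->.
Qed.

Lemma is_pd_cst i (a : R) (x : E) : is_pd i (fun=> a) x 0.
Proof.
rewrite /is_pd /pquot; under eq_fun do rewrite subrr mulr0.
exact: cvg_cst.
Qed.

Lemma is_pdD i f g (x : E) l m : is_pd i f x l -> is_pd i g x m ->
  is_pd i (fun y => f y + g y) x (l + m).
Proof.
move=> fl gm; apply: cvg_near_eq (cvgD fl gm).
apply: nearW => h; rewrite -[LHS]/(pquot i f x h + pquot i g x h) /pquot /=.
ring.
Qed.

Lemma is_pdZ i f (x : E) l a : is_pd i f x l -> is_pd i (fun y => a * f y) x (a * l).
Proof.
move=> fl; apply: cvg_near_eq (cvgM (cvg_cst a) fl).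
by apply: nearW => h; rewrite /pquot /=; ring.
Qed.

Lemma is_pdN i f (x : E) l : is_pd i f x l -> is_pd i (fun y => - f y) x (- l).
Proof.
by move/is_pdZ => /(_ (-1)); rewrite mulN1r; under eq_fun do rewrite mulN1r.
Qed.

Lemma is_pd_move i f (x : E) l : is_pd i f x l ->
  (fun h => f (x + h *: e_ i)) @ pincr i x --> f x.
Proof.
move=> fl; have h0 : id @ pincr i x --> (0 : R).
  apply: cvg_trans; last exact: cvg_id.
  move=> P /nbhs_ballP[e /= e0 xP]; apply/pincrP; exists e => // h _ he _.
  by apply: xP; rewrite /ball /= sub0r normrN.
have H : (fun h => pquot i f x h * h + f x) @ pincr i x --> f x.
  rewrite -[X in _ --> X]add0r -[X in _ --> X + _](mulr0 l).
  by apply: cvgD; [exact: cvgM|exact: cvg_cst].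
apply: cvg_near_eq H.
 apply/pincrP; exists 1 => // h hn _ _.
rewrite -[LHS]/(pquot i f x h * h + f x).
by rewrite /pquot mulrC mulrA divff// mul1r subrK.
Qed.

Lemma is_pdM i f g (x : E) l m : is_pd i f x l -> is_pd i g x m ->
  is_pd i (fun y => f y * g y) x (l * g x + f x * m).
Proof.
move=> fl gm.
apply: cvg_near_eq (cvgD (cvgM fl (is_pd_move gm)) (cvgM (cvg_cst (f x)) gm)).
 apply: nearW => h.
rewrite -[LHS]/(pquot i f x h * g (x + h *: e_ i) + f x * pquot i g x h) /pquot /=.
ring.
Qed.

Lemma is_pd_sum i (I : Type) (r : seq I) (P : pred I) (f : I -> E -> R) (x : E) (l : I -> R) :
  (forall k, P k -> is_pd i (f k) x (l k)) ->
  is_pd i (fun y => \sum_(k <- r | P k) f k y) x (\sum_(k <- r | P k) l k).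
Proof.
move=> fl; elim: r => [|k r IH].
  by rewrite big_nil; under eq_fun do rewrite big_nil; exact: is_pd_cst.
rewrite big_cons; under eq_fun do rewrite big_cons.
case: ifP => Pk //; apply: is_pdD => //; exact: fl.
Qed.

Lemma is_pd_comp i (phi : R -> R) (f : E -> R) (x : E) (l d : R) :
  is_derive (f x) 1 phi d -> is_pd i f x l -> is_pd i (fun y => phi (f y)) x (d * l).
Proof.
move=> [dphi vphi] fl.
(* The slope function of Carathéodory, continuous at [f x] with value [d], avoids dividing by an
   increment of [f] that may vanish. *)
have Q : (fun y => if y == f x then d else (phi y - phi (f x)) / (y - f x)) @ nbhs (f x) --> d.
  move: dphi vphi; rewrite /derivable /derive => /[swap] ->; set F := fun h => _.
  move=> Fd; apply/cvgrPdist_lt => e e0.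
  move/cvgrPdist_lt : Fd => /(_ e e0) /nbhs_ballP[r /= r0 xP].
  apply/nbhs_ballP; exists r => //= y; rewrite /ball /= => yr.
  case: eqVneq => [_|yx]; first by rewrite subrr normr0.
  have := xP (y - f x); rewrite /ball /= sub0r normrN distrC => /(_ yr).
  rewrite subr_eq0 => /(_ yx); rewrite /F /= /shift /=.
  by rewrite -[(y - f x) *: 1]/((y - f x) * 1) mulr1 subrK mulrC.
have fQ := cvg_comp _ _ (is_pd_move fl) Q.
apply: cvg_near_eq (cvgM fQ fl).
 apply/pincrP; exists 1 => // h hn _ _ /=.
rewrite /pquot; case: eqVneq => [->|fn]; first by rewrite !subrr !mulr0.
by rewrite mulrCA divfK// subr_eq0.
Qed.

Lemma half_segment (y : E) i (h t : R) : half y -> half (y + h *: e_ i) ->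
  0 <= t -> t <= 1 -> half (y + (t * h) *: e_ i).
Proof.
rewrite /halfspace /= !moveE; case: eqP => _; rewrite ?mulr1 ?mulr0 ?addr0//.
by move=> y0 yh t0 t1; nra.
Qed.

Lemma move_move (y : E) i (a b : R) : y + a *: e_ i + b *: e_ i = y + (a + b) *: e_ i.
Proof. by rewrite -addrA -scalerDl. Qed.

(** The segment is parametrized by [t] in [0, 1], so that both signs of [h] are treated at once; the
    derivative is required only at inner points of the segment. *)
Lemma mvt_coord (f d : E -> R) i (y : E) (h : R) :
  half y -> half (y + h *: e_ i) ->
  (forall t : R, 0 <= t <= 1 -> hcont f (y + (t * h) *: e_ i)) ->
  (forall t : R, 0 < t < 1 -> is_pd i f (y + (t * h) *: e_ i) (d (y + (t * h) *: e_ i))) ->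
  exists2 t : R, 0 < t < 1 & f (y + h *: e_ i) - f y = d (y + (t * h) *: e_ i) * h.
Proof.
move=> hy hyh cf df; have [->|hn0] := eqVneq h 0.
  exists (2^-1); first by lra.
  by rewrite scale0r addr0 subrr mulr0.
pose g (t : R) := f (y + (t * h) *: e_ i).
have gd (t : R) : t \in `]0, 1[%R -> is_derive t 1 g (d (y + (t * h) *: e_ i) * h).
  rewrite in_itv /= => /andP[t0 t1].
  set z := y + (t * h) *: e_ i.
  have tI : 0 < t < 1 by rewrite t0 t1.
  suff F : (fun s => s^-1 *: ((g \o shift t) (s *: 1) - g t)) @ 0^' --> d z * h.
    by split; [exact: (cvgP _ F)|exact: cvg_lim].
  have zl := df t tI; rewrite -/z in zl.
  have mh : (fun s => s * h) @ 0^' --> pincr i z.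
    move=> P /pincrP[e e0 zP]; apply/nbhs_ballP.
    (* The first two bounds keep [t + s] in [0, 1], hence the moved point in the half-space by
       convexity; the third makes [s * h] smaller than [e]. *)
    exists (Num.min (Num.min t (1 - t)) (e / `|h|)).
      by rewrite /= !lt_min t0 subr_gt0 t1 divr_gt0// normr_gt0.
    move=> s /=; rewrite /ball /= sub0r normrN !lt_min => /andP[/andP[st st1] se] s0.
    apply: zP; first by rewrite mulf_neq0.
      by rewrite normrM -ltr_pdivlMr// normr_gt0.
    rewrite move_move -mulrDl; apply: half_segment => //.
      by move: st; rewrite ltr_norml => /andP[? ?]; lra.
    by move: st1; rewrite ltr_norml => /andP[? ?]; lra.
  have mz := cvg_comp _ _ mh zl.
  apply: cvg_near_eq (cvgM mz (cvg_cst h)).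
  apply/nbhs_ballP; exists 1 => //= s _ s0.
  rewrite -[LHS]/(pquot i f z (s * h) * h) -[RHS]/(s^-1 * (g (s * 1 + t) - g t)).
  rewrite /pquot /g mulr1 /z move_move -mulrDl (addrC s).
  by field; rewrite hn0 s0.
have gc : {within `[0, 1], continuous g}.
  apply/subspace_continuousP => t; rewrite /= in_itv /= => tI.
  move=> P /(cf t tI) /hnearP[e e0 zP].
  apply/nbhs_ballP; exists (e / `|h|); first by rewrite /= divr_gt0// normr_gt0.
  move=> s /=; rewrite /ball /= => ts; rewrite in_itv /= => /andP[s0 s1].
  rewrite /g; apply: zP; first exact: half_segment.
  move=> j; rewrite !moveE opprD addrACA subrr add0r -mulrBl -mulrBl normrM.
  apply: (@le_lt_trans _ _ `|(s - t) * h|).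
    by rewrite ler_piMr//; case: eqP; rewrite ?normr1 ?normr0.
  by rewrite normrM -ltr_pdivlMr ?normr_gt0// distrC.
have [t tI] := MVT ltr01 gd gc; rewrite subr0 mulr1 /g mul1r mul0r scale0r addr0 => ->.
by exists t => //; move: tI; rewrite in_itv.
Qed.

(* [w] is a coordinatewise mixture of [y] and [z]; such sets contain every path
   from [y] to [z] that changes one coordinate at a time. *)
Definition mixclosed (Q : set E) : Prop := forall y z w : E, Q y -> Q z ->
  (forall j, exists2 t : R, 0 <= t <= 1 & w 0 j = y 0 j + t * (z 0 j - y 0 j)) -> Q w.

(** One coordinate is changed at a time and [mvt_coord] is applied to each leg, then the increments
    telescope. The points [xi k] need not lie on a common segment, which is why [Q] has to be closed
    under mixing coordinates. *)
Lemma mvt_path (Q : set E) (f : E -> R) (d : 'I_n.+1 -> E -> R) (y z : E) :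
  mixclosed Q -> Q `<=` half ->
  (forall w, Q w -> hcont f w) ->
  (forall k w, Q w -> is_pd k f w (d k w)) ->
  Q y -> Q z ->
  exists2 xi : 'I_n.+1 -> E, (forall k, Q (xi k)) &
    f z - f y = \sum_k d k (xi k) * (z 0 k - y 0 k).
Proof.
move=> mQ Qh cf df Qy Qz.
pose mix (k : nat) : E := \row_j if (j < k)%N then z 0 j else y 0 j.
have Qmix k (t : R) (i : 'I_n.+1) : 0 <= t <= 1 -> i = k :> nat ->
    Q (mix k + (t * (z 0 i - y 0 i)) *: e_ i).
  move=> tI ik; apply: (mQ y z) => // j; rewrite moveE mxE; case: eqP => [->|ji].
    by exists t => //; rewrite ik ltnn mulr1.
  rewrite mulr0 addr0; case: ltnP => _.
    by exists 1; [rewrite ler01 lexx|ring].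
  by exists 0; [rewrite ler01 lexx|ring].
have mixS (i : 'I_n.+1) : mix i.+1 = mix i + (z 0 i - y 0 i) *: e_ i.
  apply/rowP => j; rewrite moveE !mxE; case: eqP => [->|ji].
    by rewrite ltnSn ltnn mulr1 addrC subrK.
  rewrite mulr0 addr0 ltnS leq_eqVlt (_ : (j == i :> nat) = false)//.
  by apply/eqP => /val_inj.
have step (i : 'I_n.+1) : exists2 w, Q w &
    f (mix i.+1) - f (mix i) = d i w * (z 0 i - y 0 i).
  have Q1 : Q (mix i.+1).
    have := Qmix i 1 i; rewrite mul1r -mixS; apply => //.
    by rewrite ler01 lexx.
  have Q0 : Q (mix i).
    have := Qmix i 0 i; rewrite mul0r scale0r addr0; apply => //.
    by rewrite ler01 lexx.
  rewrite mixS; have [||t tI|t /andP[t0 t1]|t /andP[t0 t1] ->] := @mvt_coord f (d i) i (mix i) (z 0 i - y 0 i).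
  - exact: Qh.
  - by rewrite -mixS; exact: Qh.
  - by apply: cf; exact: Qmix.
  - by apply: df; apply: Qmix => //; rewrite !ltW.
  - by exists (mix i + (t * (z 0 i - y 0 i)) *: e_ i) => //; apply: Qmix => //; rewrite !ltW.
pose xi i := s2val (cid2 (step i)).
exists xi => [k|]; first by rewrite /xi; case: cid2.
transitivity (\sum_(i < n.+1) (f (mix i.+1) - f (mix i))).
  rewrite -(big_mkord xpredT (fun i => f (mix i.+1) - f (mix i))) telescope_sumr//.
  congr (f _ - f _); apply/rowP => j; rewrite mxE //.
  by rewrite ltn_ord.
by apply: eq_bigr => i _; rewrite /xi; case: cid2.
Qed.

End HalfSpaceCalculus.

(** * Strict differentiability up to the boundary *)

Section StrictDifferentiability.
Context {R : realType} {n : nat}.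
Local Notation E := 'rV[R]_n.+1.
Local Notation half := (@halfspace R n).
Local Notation e_ i := (delta_mx 0 i : E).

Definition open_half : set E := [set x | 0 < x ord0 ord0].

Lemma open_half_half : open_half `<=` half.
Proof. by move=> x; exact: ltW. Qed.

Lemma conv_lt (a b c t : R) : a < c -> b < c -> 0 <= t <= 1 -> a + t * (b - a) < c.
Proof.
move=> ac bc /andP[t0 t1]; have [->|tn] := eqVneq t 0; first by rewrite mul0r addr0.
have tp : 0 < t by rewrite lt_def tn.
rewrite (_ : a + _ = (1 - t) * a + t * b); last by ring.
rewrite (_ : c = (1 - t) * c + t * c); last by ring.
by apply: ler_ltD; rewrite ?ltr_pM2l// ler_wpM2l ?subr_ge0// ltW.
Qed.

Lemma conv_gt (a b c t : R) : c < a -> c < b -> 0 <= t <= 1 -> c < a + t * (b - a).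
Proof.
rewrite -(ltrN2 a c) -(ltrN2 b c) => ca cb tI; rewrite -ltrN2.
rewrite (_ : - (a + _) = - a + t * (- b - - a)); last by ring.
exact: conv_lt.
Qed.

Lemma mixclosed_half : mixclosed half.
Proof.
move=> y z w; rewrite /halfspace /= => y0 z0 /(_ ord0)[t /andP[t0 t1] ->].
nra.
Qed.

Lemma mixclosed_open_half : mixclosed open_half.
Proof.
move=> y z w; rewrite /open_half /= => y0 z0 /(_ ord0)[t /andP[t0 t1] ->].
by apply: conv_gt; rewrite ?t0.
Qed.

Lemma mixclosed_box (K : set E) (p : E) (r : R) : mixclosed K ->
  mixclosed [set y | K y /\ forall j, `|y 0 j - p 0 j| < r].
Proof.
move=> mK y z w [Ky yp] [Kz zp] wyz; split; first exact: (mK y z).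
move=> j; have [t /andP[t0 t1] ->] := wyz j.
move: (yp j) (zp j); rewrite !ltr_norml => /andP[a b] /andP[c d].
rewrite (_ : _ - _ = (y 0 j - p 0 j) + t * ((z 0 j - p 0 j) - (y 0 j - p 0 j))); last by ring.
by rewrite conv_lt ?conv_gt// t0.
Qed.

(** Strict differentiability: both [y] and [z] move near [p]. Unlike an estimate based at [p], this
    one is stable under limits of [y] and [z], so it carries over from the open half-space to the
    closed one. *)
Definition sdiff (K : set E) (f : E -> R) (p : E) (L : 'I_n.+1 -> R) : Prop :=
  forall e : R, 0 < e -> exists2 d : R, 0 < d & forall y z : E, K y -> K z ->
    (forall j, `|y 0 j - p 0 j| < d) -> (forall j, `|z 0 j - p 0 j| < d) ->
    `|f z - f y - \sum_k L k * (z 0 k - y 0 k)| <= e * \sum_k `|z 0 k - y 0 k|.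

(** Mean value along a coordinate path inside a box on which every [d k] is within [e] of [L k]. *)
Lemma sdiff_C1 (K : set E) (f : E -> R) (d : 'I_n.+1 -> E -> R) (p : E)
    (L : 'I_n.+1 -> R) :
  mixclosed K -> K `<=` half ->
  (\forall w \near hnear K p, hcont f w) ->
  (forall k, \forall w \near hnear K p, is_pd k f w (d k w)) ->
  (forall k, d k @ hnear K p --> L k) ->
  sdiff K f p L.
Proof.
move=> mK Kh cf df cd e e0.
have : \forall w \near hnear K p, hcont f w /\
    forall k, is_pd k f w (d k w) /\ `|L k - d k w| < e.
  apply: filterI => //.
  apply: (@filter_forall E _ (fun k w => is_pd k f w (d k w) /\ `|L k - d k w| < e) _ (hnear_filter K p)) => k.
  apply: filterI; first exact: df.
  by have /cvgrPdist_lt/(_ e e0) := cd k.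
move=> /hnearP[r r0 H]; exists r => // y z Ky Kz yp zp.
have [||w []|k w []|||xi xiP ->] := @mvt_path R n [set y | K y /\ forall j, `|y 0 j - p 0 j| < r] f d y z.
- exact: mixclosed_box.
- by move=> w [/Kh].
- by move=> Kw wp; have [] := H w Kw wp.
- by move=> Kw wp; have [_ /(_ k)[]] := H w Kw wp.
- by [].
- by [].
rewrite -sumrB mulr_sumr; apply: (le_trans (ler_norm_sum _ _ _)).
apply: ler_sum => k _; rewrite -mulrBl normrM ler_wpM2r//.
have [Kx xp] := xiP k; have [_ /(_ k)[_ ]] := H _ Kx xp.
by rewrite distrC => /ltW.
Qed.

(* The strict estimate holds inside and is closed under limits, so no
   derivative at the boundary has to be known in advance. *)
Lemma sdiff_boundary (f : E -> R) (d : 'I_n.+1 -> E -> R) (p : E) (L : 'I_n.+1 -> R) :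
  (\forall w \near hnear half p, hcont f w) ->
  (forall k, \forall w \near hnear open_half p, is_pd k f w (d k w)) ->
  (forall k, d k @ hnear open_half p --> L k) ->
  sdiff half f p L.
Proof.
move=> cf df cd e e0.
have [|r r0 H] := @sdiff_C1 open_half f d p L mixclosed_open_half open_half_half _ df cd e e0.
  by move/hnearP: cf => [r r0 H]; apply/hnearP; exists r => // y /open_half_half; exact: H.
move/hnearP : cf => [r' r'0 cf].
pose d0 := Num.min (r / 2) r'.
have d00 : 0 < d0 by rewrite lt_min divr_gt0.
exists d0 => // y z hy hz yp zp.
have cvgs (w : E) : half w -> (forall j, `|w 0 j - p 0 j| < d0) ->
    forall eta : R, 0 < eta -> exists2 s0 : R, 0 < s0 & forall s : R, 0 < s < s0 ->
      `|f (w + s *: e_ ord0) - f w| < eta.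
  move=> hw wp eta eta0; have : hcont f w.
    by apply: cf => // j; apply: lt_le_trans (wp j) _; rewrite ge_min lexx orbT.
  move=> /cvgrPdist_lt/(_ eta eta0)/hnearP[s0 s00 sP]; exists s0 => // s /andP[sp ss].
  rewrite distrC; apply: sP; first by apply: half_move_ge0 => //; exact: ltW.
  move=> j; rewrite moveE addrC addKr; apply: le_lt_trans ss.
  by rewrite normrM (gtr0_norm sp) ler_piMr ?(ltW sp)//; case: eqP; rewrite ?normr1 ?normr0.
set c := \sum_k _; set C := e * _.
apply/ler_addgt0Pr => eta eta0.
have eta2 : 0 < eta / 2 by rewrite divr_gt0.
have [s1 s10 sy] := cvgs y hy yp (eta / 2) eta2.
have [s2 s20 sz] := cvgs z hz zp (eta / 2) eta2.
(* Both points are pushed inwards by the same [s]: their difference is unchanged, and continuity of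
   [f] bounds the error by [eta]. *)
pose s := Num.min (Num.min s1 s2) (r / 2) / 2.
have m0 : 0 < Num.min (Num.min s1 s2) (r / 2) by rewrite !lt_min s10 s20 divr_gt0.
have s0 : 0 < s by rewrite divr_gt0.
have : s < Num.min (Num.min s1 s2) (r / 2) by rewrite ltr_pdivrMr// ltr_pMr// ltr1n.
rewrite !lt_min => /andP[/andP[ss1 ss2] sr].
have box (w : E) : half w -> (forall j, `|w 0 j - p 0 j| < d0) ->
    open_half (w + s *: e_ ord0) /\ forall j, `|(w + s *: e_ ord0) 0 j - p 0 j| < r.
  move=> hw wp; split; first by rewrite /open_half /= moveE eqxx mulr1 ltr_wpDl.
  move=> j; rewrite moveE addrAC (le_lt_trans (ler_normD _ _))// (splitr r) ltrD//.
    by rewrite (lt_le_trans (wp j))// ge_min lexx.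
  rewrite (le_lt_trans _ sr)// normrM (gtr0_norm s0) ler_piMr ?(ltW s0)//.
  by case: eqP; rewrite ?normr1 ?normr0.
have [oy by_] := box y hy yp; have [oz bz] := box z hz zp.
have := H _ _ oy oz by_ bz.
have E1 k : (z + s *: e_ ord0) 0 k - (y + s *: e_ ord0) 0 k = z 0 k - y 0 k.
  by rewrite !moveE; ring.
under eq_bigr do rewrite E1.
under [X in _ <= _ * X]eq_bigr do rewrite E1.
rewrite -/c -/C => HH.
have sy' := sy s; rewrite s0 ss1 in sy'; have {}sy' := sy' isT.
have sz' := sz s; rewrite s0 ss2 in sz'; have {}sz' := sz' isT.
rewrite (_ : f z - f y - c = (f (z + s *: e_ ord0) - f (y + s *: e_ ord0) - c)
  + ((f (y + s *: e_ ord0) - f y) - (f (z + s *: e_ ord0) - f z))); last by ring.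
apply: (le_trans (ler_normD _ _)); apply: lerD => //.
apply: (le_trans (ler_normB _ _)); rewrite (splitr eta).
by apply: lerD; exact: ltW.
Qed.

Lemma is_pd_sdiff (f : E -> R) (p : E) (L : 'I_n.+1 -> R) k :
  half p -> sdiff half f p L -> is_pd k f p (L k).
Proof.
move=> hp fL; apply/cvgrPdist_le => e e0; have [d d0 H] := fL e e0.
apply/pincrP; exists d => // h h0 hd hh.
have E1 j : (p + h *: e_ k) 0 j - p 0 j = h * (j == k)%:R.
  by rewrite moveE addrC addKr.
have := H p _ hp hh; under eq_bigr do rewrite E1.
under [X in _ <= _ * X]eq_bigr do rewrite E1.
rewrite (bigD1 k)//= eqxx mulr1 big1 ?addr0; last first.
  by move=> j /negbTE ->; rewrite !mulr0.
rewrite (bigD1 k)//= eqxx mulr1 big1 ?addr0; last first.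
  by move=> j /negbTE ->; rewrite mulr0 normr0.
move=> HH; rewrite /pquot -(ler_pM2r (x := `|h|)) ?normr_gt0// -normrM.
rewrite -normrN -mulNr opprB mulrBl mulrAC mulVf// mul1r; apply: HH.
  by move=> j; rewrite subrr normr0.
move=> j; rewrite moveE addrC addKr (le_lt_trans _ hd)// normrM ler_piMr//.
by case: eqP; rewrite ?normr1 ?normr0.
Qed.

(** Strictness of [f] at [phi x] allows [phi] to have only a derivative in the one direction [i],
    possibly one-sided. *)
Lemma is_pd_chain (f : E -> R) (phi : E -> E) i (x : E) (L dphi : 'I_n.+1 -> R) :
  half x -> (\forall y \near hnear half x, half (phi y)) -> sdiff half f (phi x) L ->
  (forall b, is_pd i (fun y => phi y 0 b) x (dphi b)) ->
  is_pd i (f \o phi) x (\sum_b L b * dphi b).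
Proof.
move=> hx hphi fL dp; have hpx : half (phi x) := hnear_self hx hphi.
pose v b h := pquot i (fun y => phi y 0 b) x h.
have vS : (fun h => \sum_b `|v b h|) @ pincr i x --> \sum_b `|dphi b|.
  apply: cvg_sumr => b _; apply: cvg_norm; exact: dp.
have lS : (fun h => \sum_b L b * v b h) @ pincr i x --> \sum_b L b * dphi b.
  by apply: cvg_sumr => b _; apply: cvgM; [exact: cvg_cst|exact: dp].
apply/cvgrPdist_lt => e e0.
set S := \sum_b `|dphi b| in vS.
have S0 : 0 <= S by apply: sumr_ge0.
(* [S + 1] eventually bounds the sum of the absolute difference quotients of the components of
   [phi]. *)
have eS : 0 < e / 2 / (S + 1) by rewrite !divr_gt0// ltr_wpDl.
have [d d0 H] := fL _ eS.
have N1 : \forall h \near pincr i x, `|S - \sum_b `|v b h| | < 1.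
  by move/cvgrPdist_lt : vS; exact.
have N2 : \forall h \near pincr i x, `|\sum_b L b * dphi b - \sum_b L b * v b h| < e / 2.
  by move/cvgrPdist_lt : lS => /(_ (e / 2)); apply; rewrite divr_gt0.
have N3 : \forall h \near pincr i x, forall b, `|phi x 0 b - phi (x + h *: e_ i) 0 b| < d.
  apply: (@filter_forall R _ (fun b h => `|phi x 0 b - phi (x + h *: e_ i) 0 b| < d) _ (pincr_filter i x)) => b.
  by have /cvgrPdist_lt := is_pd_move (dp b); exact.
have N4 := move_near i hphi.
have N5 : \forall h \near pincr i x, h != 0 by apply/pincrP; exists 1.
near=> h.
have h0 : h != 0 by near: h.
have hp : half (phi (x + h *: e_ i)) by near: h.
have Sh : `|S - \sum_b `|v b h| | < 1 by near: h.
have Lh : `|\sum_b L b * dphi b - \sum_b L b * v b h| < e / 2 by near: h.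
have bh : forall b, `|phi x 0 b - phi (x + h *: e_ i) 0 b| < d by near: h.
have := H (phi x) (phi (x + h *: e_ i)) hpx hp.
have vE b : phi (x + h *: e_ i) 0 b - phi x 0 b = h * v b h.
  by rewrite /v /pquot mulrA divff// mul1r.
under eq_bigr do rewrite vE mulrCA.
under [X in _ <= _ * X]eq_bigr do rewrite vE normrM.
rewrite -!mulr_sumr => HH.
have {}HH : `|pquot i (f \o phi) x h - \sum_b L b * v b h| <= e / 2 / (S + 1) * \sum_b `|v b h|.
  rewrite -(ler_pM2l (x := `|h|)) ?normr_gt0// -normrM mulrBr /pquot mulrA divff// mul1r.
  rewrite mulrCA; apply: HH; first by move=> j; rewrite subrr normr0.
  by move=> j; rewrite distrC.
rewrite -(subrK (\sum_b L b * v b h) (\sum_b L b * dphi b)) -addrA.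
apply: (le_lt_trans (ler_normD _ _)); rewrite (splitr e); apply: ltr_leD => //.
rewrite distrC; apply: (le_trans HH).
rewrite -[X in _ <= X](@divfK _ (S + 1)) ?gt_eqF ?ltr_wpDl// ler_wpM2l ?(ltW eS)//.
by move: Sh; rewrite ltr_norml => /andP[? ?]; lra.
Unshelve. all: by end_near. Qed.

(** Off the face both signs of the increment are admissible, so the derivative at a minimum is both
    nonnegative and nonpositive. *)
Lemma is_pd_min i (f : E -> R) (x : E) (l : R) : open_half x ->
  (\forall y \near hnear half x, f x <= f y) -> is_pd i f x l -> l = 0.
Proof.
move=> ox fx fl; have [r0 r00 hr0] : exists2 r : R, 0 < r &
    forall h, `|h| < r -> half (x + h *: e_ i).
  exists (x ord0 ord0) => // h hx; rewrite /halfspace /= moveE.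
  by move: hx; rewrite ltr_norml => /andP[? ?]; case: eqP => _; rewrite ?mulr1 ?mulr0; lra.
have fm := move_near i fx.
have key (a : R) : `|a| = 1 -> 0 <= a * l.
  move=> a1; rewrite leNgt; apply/negP => al.
  have : \forall h \near pincr i x, a * pquot i f x h < 0.
    have : (fun h => a * pquot i f x h) @ pincr i x --> a * l.
      by apply: cvgM => //; exact: cvg_cst.
    by move/(cvgr_lt _); exact.
  move=> /(filterI fm)/pincrP[r rp H].
  pose h := Num.min r0 r / 2.
  have m0 : 0 < Num.min r0 r by rewrite lt_min r00.
  have hp : 0 < h by rewrite divr_gt0.
  have : h < Num.min r0 r by rewrite ltr_pdivrMr// ltr_pMr// ltr1n.
  rewrite lt_min => /andP[h1 h2].
  have nh : `|a * h| = h by rewrite normrM a1 mul1r gtr0_norm.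
  have an : a != 0 by rewrite -normr_gt0 a1.
  have ahn : a * h != 0 by rewrite mulf_neq0// gt_eqF.
  have ahr : `|a * h| < r by rewrite nh.
  have ahh : half (x + (a * h) *: e_ i) by apply: hr0; rewrite nh.
  have [f1 f2] := H _ ahn ahr ahh.
  move: f2; rewrite /= /pquot invfM mulrA mulrA divff// mul1r pmulr_rlt0 ?invr_gt0//.
  by rewrite subr_lt0 => f2; have := le_lt_trans f1 f2; rewrite ltxx.
have := key 1 (normr1 _); rewrite mul1r => l0.
have := key (-1); rewrite normrN normr1 mulN1r oppr_ge0 => /(_ erefl) l1.
by apply/eqP; rewrite eq_le l0 l1.
Qed.

Lemma is_pd_tangential (i : 'I_n.+1) (f : E -> R) (x : E) (l : R) : half x -> x ord0 ord0 = 0 ->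
  i != ord0 -> (\forall y \near hnear half x, (y : E) ord0 ord0 = 0 -> f y = 0) ->
  is_pd i f x l -> l = 0.
Proof.
move=> hx x0 i0 fx fl; apply: (is_pd_uniq hx fl).
have fm := move_near i fx; have fx0 : f x = 0 := hnear_self hx fx x0.
apply: (@cvg_near_eq _ _ (pincr i x) _ (fun=> 0)); last exact: cvg_cst.
apply: filterS fm => h H; rewrite /pquot H ?fx0 ?subrr ?mulr0//.
by rewrite moveE x0 eq_sym (negbTE i0) mulr0 addr0.
Qed.

Lemma is_pd_translate i j (f : E -> R) (x : E) (s l : R) : half x -> 0 <= s ->
  is_pd i f (x + s *: e_ j) l -> is_pd i (fun y => f (y + s *: e_ j)) x l.
Proof.
move=> hx s0 fl; have : pincr i x --> pincr i (x + s *: e_ j).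
  move=> P /pincrP[e e0 H]; apply/pincrP; exists e => // h h0 he hh; apply: H => //.
  by rewrite addrAC; apply: half_move_ge0.
move=> ii; have H : pquot i f (x + s *: e_ j) @ pincr i x --> l.
  by move=> P /fl; exact: ii.
by apply: cvg_near_eq H; apply: nearW => h; rewrite /pquot addrAC.
Qed.

Lemma hcont_translate j (f : E -> R) (x : E) (s : R) : half x -> 0 <= s ->
  hcont f (x + s *: e_ j) -> hcont (fun y => f (y + s *: e_ j)) x.
Proof.
move=> hx s0 fl; have : (fun y => y + s *: e_ j) @ hnear half x --> hnear half (x + s *: e_ j).
  move=> P /hnearP[e e0 H]; apply/hnearP; exists e => // y hy yx; apply: H.
    exact: half_move_ge0.
  by move=> k; rewrite !moveE opprD addrACA subrr addr0.
by move=> ii; apply: (cvg_comp _ _ ii fl).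
Qed.

(** The second difference over a square of side [h] equals [h ^ 2] times either mixed derivative at
    some point of the square, by two mean value arguments in either order. Only positive increments
    are taken, so the square stays in the half-space even when [x] is on the face. *)
Lemma schwarz i j (f di dj dij dji : E -> R) (x : E) : half x ->
  (\forall w \near hnear half x, hcont f w /\ hcont di w /\ hcont dj w) ->
  (\forall w \near hnear half x, is_pd i f w (di w) /\ is_pd j f w (dj w)) ->
  (\forall w \near hnear half x, is_pd j di w (dij w) /\ is_pd i dj w (dji w)) ->
  hcont dij x -> hcont dji x -> dij x = dji x.
Proof.
move=> hx N1 N2 N3 cij cji.
have /hnearP[r r0 H] : \forall w \near hnear half x,
    (hcont f w /\ hcont di w /\ hcont dj w) /\
    (is_pd i f w (di w) /\ is_pd j f w (dj w)) /\
    (is_pd j di w (dij w) /\ is_pd i dj w (dji w)).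
  by apply: filterI => //; exact: filterI.
have key i' j' (di' dj' dij' : E -> R) (h : R) :
    (forall w, half w -> (forall k, `|w 0 k - x 0 k| < r) ->
      [/\ hcont f w, hcont di' w, is_pd i' f w (di' w) & is_pd j' di' w (dij' w)]) ->
    0 < h -> h < r / 2 -> exists w, [/\ half w, forall k, `|w 0 k - x 0 k| <= h + h &
      f (x + h *: e_ i' + h *: e_ j') - f (x + h *: e_ i') - (f (x + h *: e_ j') - f x)
      = dij' w * h * h].
  move=> HH h0 hr; pose F (y : E) := f (y + h *: e_ j') - f y.
  have hh : 0 <= h := ltW h0.
  have box (s t : R) : 0 <= s <= 1 -> 0 <= t <= 1 -> forall k,
     `|(x + (s * h) *: e_ i' + (t * h) *: e_ j') 0 k - x 0 k| <= h + h.
    move=> /andP[s0 s1] /andP[t0 t1] k; rewrite !moveE.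
    rewrite (_ : _ - x 0 k = s * h * (k == i')%:R + t * h * (k == j')%:R); last by ring.
    apply: (le_trans (ler_normD _ _)); rewrite !normrM.
    rewrite (ger0_norm s0) (ger0_norm t0) (ger0_norm hh); apply: lerD.
      by rewrite -[leRHS]mulr1 ler_pM ?mulr_ge0 ?ler_piMl//; case: eqP; rewrite ?normr1 ?normr0.
    by rewrite -[leRHS]mulr1 ler_pM ?mulr_ge0 ?ler_piMl//; case: eqP; rewrite ?normr1 ?normr0.
  have hr' : h + h < r by lra.
  have hs (s t : R) : 0 <= s <= 1 -> 0 <= t <= 1 -> half (x + (s * h) *: e_ i' + (t * h) *: e_ j').
    move=> /andP[s0 s1] /andP[t0 t1].
    by apply: half_move_ge0; [apply: half_move_ge0|]; rewrite ?mulr_ge0.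
  have HH' (s t : R) : 0 <= s <= 1 -> 0 <= t <= 1 -> 
      let w := x + (s * h) *: e_ i' + (t * h) *: e_ j' in
      [/\ hcont f w, hcont di' w, is_pd i' f w (di' w) & is_pd j' di' w (dij' w)].
    move=> sI tI w; apply: HH; first exact: hs.
    by move=> k; apply: le_lt_trans hr'; exact: box.
  have I0 : 0 <= (0 : R) <= 1 by rewrite lexx ler01.
  have I1 : 0 <= (1 : R) <= 1 by rewrite lexx ler01.
  have hs0 (s : R) : 0 <= s <= 1 -> half (x + (s * h) *: e_ i').
    by move=> sI; have := hs s 0 sI I0; rewrite mul0r scale0r addr0.
  have [||t tI|t /andP[t0 t1]|t /andP[t0 t1]] := @mvt_coord R n F (fun y => di' (y + h *: e_ j') - di' y) i' x h.
  - by [].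
  - exact: half_move_ge0.
  - have [c1 _ _ _] := HH' t 1 tI I1; have [c2 _ _ _] := HH' t 0 tI I0.
    rewrite mul1r in c1; rewrite mul0r scale0r addr0 in c2.
    apply: cvgB => //; apply: hcont_translate => //; exact: hs0.
  - have tI : 0 <= t <= 1 by rewrite !ltW.
    have [_ _ c1 _] := HH' t 1 tI I1; have [_ _ c2 _] := HH' t 0 tI I0.
    rewrite mul1r in c1; rewrite mul0r scale0r addr0 in c2.
    apply: is_pdD; last exact: is_pdN.
    by apply: is_pd_translate => //; exact: hs0.
  have tI : 0 <= t <= 1 by rewrite !ltW.
  have [||s sI|s /andP[s0 s1]|s /andP[s0 s1]] := @mvt_coord R n di' dij' j' (x + (t * h) *: e_ i') h.
  - exact: hs0.
  - by have := hs t 1 tI I1; rewrite mul1r.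
  - by have [_ + _ _] := HH' t s tI sI.
  - by have [|_ _ _ +] := HH' t s tI; first by rewrite !ltW.
  move=> E1 E2; exists (x + (t * h) *: e_ i' + (s * h) *: e_ j'); split.
  - by apply: hs => //; rewrite !ltW.
  - by apply: box => //; rewrite !ltW.
  - by rewrite -E1 -E2 /F.
apply/eqP; rewrite -subr_eq0 -normr_le0; apply/ler_addgt0Pr => e e0; rewrite add0r.
have e2 : 0 < e / 2 by rewrite divr_gt0.
have /cvgrPdist_lt/(_ _ e2)/hnearP[r1 r10 H1] := cij.
have /cvgrPdist_lt/(_ _ e2)/hnearP[r2 r20 H2] := cji.
pose m := Num.min r (Num.min r1 r2); pose h := m / 2 / 2.
have m0 : 0 < m by rewrite !lt_min r0 r10.
have h0 : 0 < h by rewrite !divr_gt0.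
have mr : m <= r by rewrite ge_min lexx.
have mr1 : m <= r1 by rewrite !ge_min lexx orbT.
have mr2 : m <= r2 by rewrite !ge_min lexx !orbT.
have hm : h + h < m by rewrite /h; lra.
have hr2 : h < r / 2 by rewrite /h; lra.
have [|//|//|w [hw bw Ew]] := key i j di dj dij h.
  by move=> w hw bw; have [[? [? ?]] [[? ?] [? ?]]] := H w hw bw.
have [|//|//|w' [hw' bw' Ew']] := key j i dj di dji h.
  by move=> z hz bz; have [[? [? ?]] [[? ?] [? ?]]] := H z hz bz.
have EE : dij w = dji w'.
  have hn : h != 0 by rewrite gt_eqF.
  apply: (mulIf hn); apply: (mulIf hn); rewrite -Ew -Ew'.
  by rewrite [x + _ + _]addrAC; ring.
have D1 : `|dij x - dij w| < e / 2.
  by apply: H1 => // k; rewrite (le_lt_trans (bw k))// (lt_le_trans hm).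
have D2 : `|dji x - dji w'| < e / 2.
  by apply: H2 => // k; rewrite (le_lt_trans (bw' k))// (lt_le_trans hm).
rewrite (_ : _ - _ = (dij x - dij w) - (dji x - dji w')); last by rewrite EE; ring.
by apply: (le_trans (ler_normB _ _)); rewrite (splitr e) lerD// ltW.
Qed.

End StrictDifferentiability.

(** * Smooth functions on the half-space *)

Section SmoothFunctions.
Context {R : realType} {n : nat}.
Local Notation E := 'rV[R]_n.+1.
Local Notation half := (@halfspace R n).
Local Notation e_ i := (delta_mx 0 i : E).

Lemma hnear_sub (K K' : set E) x (P : set E) : K' `<=` K -> hnear K x P -> hnear K' x P.
Proof. by move=> KK /hnearP[e e0 H]; apply/hnearP; exists e => // y /KK; exact: H. Qed.

Definition hopen (D : set E) : Prop :=
  D `<=` half /\ forall x, D x -> hnear half x D.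

(** At a point of a relatively open [D], the neighbourhoods within [D] and within the half-space
    form the same filter. *)
Lemma within_hcont (D : set E) (f : E -> R) : hopen D ->
  {within D, continuous f} <-> forall x, D x -> hcont f x.
Proof.
move=> [Dh Dn]; have eqf x : D x -> within D (nbhs x) = hnear half x.
  move=> Dx; apply/seteqP; split=> P.
    rewrite /within /= => DP; apply: filterS2 DP (Dn x Dx) => y H1 H2 hy.
    by apply: H1; exact: H2.
  by rewrite /hnear /within /= => HP; apply: filterS HP => y H Dy; apply: H; exact: Dh.
split=> [/subspace_continuousP H x Dx|H].
  by have := H x Dx; rewrite /hcont -(eqf x Dx).
by apply/subspace_continuousP => x Dx; rewrite (eqf x Dx); exact: H.
Qed.

Lemma hnear_eq_hcont (f g : E -> R) (x : E) : half x ->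
  (\forall y \near hnear half x, f y = g y) -> hcont f x -> hcont g x.
Proof.
move=> hx fg fx; rewrite /hcont -(hnear_self hx fg).
exact: cvg_near_eq fx.
Qed.

Lemma hopen_eq_near (D : set E) (f g : E -> R) x : hopen D ->
  (forall y, D y -> f y = g y) -> D x -> \forall y \near hnear half x, f y = g y.
Proof. by move=> [_ Dn] fg /Dn; apply: filterS => y /fg. Qed.

Lemma hopenI_open_half (D : set E) : hopen D -> hopen (D `&` open_half).
Proof.
move=> [Dh Dn]; split=> [x [/Dh]//|x [Dx x0]].
apply: filterI; first exact: Dn.
apply/hnearP; exists (x ord0 ord0) => // y _ /(_ ord0).
rewrite ltr_norml => /andP[+ _].
by rewrite ltrBrDl subrr.
Qed.

Lemma hopen_near (D : set E) (x : E) (P : set E) : hopen D -> D x ->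
  (forall y, D y -> P y) -> \forall y \near hnear half x, P y.
Proof. by move=> [_ Dn] /Dn Dx DP; apply: filterS Dx => y /DP. Qed.

Lemma Ck_hcont (D : set E) k (f : E -> R) x : hopen D -> Ck D k f -> D x -> hcont f x.
Proof. by move=> oD; case: k => [|k] /= [/within_hcont H _]; apply: H. Qed.

Lemma Ck_is_pd (D : set E) k (f : E -> R) i x :
  Ck D k.+1 f -> D x -> is_pd i f x (pderiv i f x).
Proof. by move=> /= [_ /(_ i)[H _]]; exact: H. Qed.

Lemma Ck_pderiv (D : set E) k (f : E -> R) i : Ck D k.+1 f -> Ck D k (pderiv i f).
Proof. by move=> /= [_ /(_ i)[_]]. Qed.

(** As [D] is relatively open, equality on [D] determines the partial derivatives on [D], and the
    induction continues with these. *)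
Lemma Ck_eq (D : set E) k (f g : E -> R) : hopen D ->
  (forall x, D x -> f x = g x) -> Ck D k f -> Ck D k g.
Proof.
move=> oD; elim: k f g => [|k IH] f g fg Cf; have Cg : {within D, continuous g}.
- apply/within_hcont => // x Dx; apply: hnear_eq_hcont (Ck_hcont oD Cf Dx).
    by case: oD => + _; apply.
  exact: hopen_eq_near Dx.
- by split.
- apply/within_hcont => // x Dx; apply: hnear_eq_hcont (Ck_hcont oD Cf Dx).
    by case: oD => + _; apply.
  exact: hopen_eq_near Dx.
split=> // i; split.
  move=> x Dx; apply: (cvgP (pderiv i f x)).
  apply: (hnear_eq_is_pd (f := f)); last exact: Ck_is_pd Cf Dx.
    by case: oD => + _; apply.
  exact: hopen_eq_near Dx.
apply: IH (Ck_pderiv i Cf) => x Dx; apply: hnear_eq_pderiv.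
  by case: oD => + _; apply.
exact: hopen_eq_near Dx.
Qed.

Lemma Ck0 (D : set E) (f : E -> R) : hopen D ->
  (forall x, D x -> hcont f x) -> Ck D 0 f.
Proof. by move=> oD cf; split=> //; exact/within_hcont. Qed.

Lemma CkS (D : set E) k (f : E -> R) (g : 'I_n.+1 -> E -> R) : hopen D ->
  (forall x, D x -> hcont f x) ->
  (forall i x, D x -> is_pd i f x (g i x)) ->
  (forall i, Ck D k (g i)) -> Ck D k.+1 f.
Proof.
move=> oD cf fg Cg; split; first exact/within_hcont.
move=> i; split; first by move=> x Dx; exact: cvgP (fg i x Dx).
apply: Ck_eq (Cg i) => // x Dx; rewrite (is_pd_pderiv _ (fg i x Dx))//.
by case: oD => + _; apply.
Qed.

Lemma CkW (D : set E) k (f : E -> R) : hopen D -> Ck D k.+1 f -> Ck D k f.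
Proof.
move=> oD; elim: k f => [|k IH] f Cf.
  by apply: Ck0 => // x; exact: Ck_hcont Cf.
apply: (CkS (g := fun i => pderiv i f)) => // [x|i x|i].
- exact: Ck_hcont Cf.
- exact: Ck_is_pd Cf.
- by apply: IH; exact: Ck_pderiv.
Qed.

Lemma Ck_local (D : set E) k (f : E -> R) : hopen D ->
  (forall x, D x -> exists D', [/\ hopen D', D' x & Ck D' k f]) -> Ck D k f.
Proof.
move=> oD; elim: k f => [|k IH] f H; have cf x : D x -> hcont f x.
- by move=> /H[D' [oD' D'x /Ck_hcont]]; apply.
- exact: Ck0.
- by move=> /H[D' [oD' D'x /Ck_hcont]]; apply.
apply: (CkS (g := fun i => pderiv i f)) => // [i x|i].
  by move=> /H[D' [oD' D'x /Ck_is_pd]]; apply.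
apply: IH => x /H[D' [oD' D'x Cf]]; exists D'; split=> //.
exact: Ck_pderiv.
Qed.

Lemma Ck_sub (D D' : set E) k (f : E -> R) : hopen D -> hopen D' -> D' `<=` D ->
  Ck D k f -> Ck D' k f.
Proof. by move=> oD oD' DD Cf; apply: Ck_local => // x /DD Dx; exists D. Qed.

Lemma smooth_hcont (D : set E) (f : E -> R) x : hopen D -> smooth D f -> D x -> hcont f x.
Proof. by move=> oD /(_ 0%N) Cf; exact: Ck_hcont Cf. Qed.

Lemma smooth_is_pd (D : set E) (f : E -> R) i x :
  smooth D f -> D x -> is_pd i f x (pderiv i f x).
Proof. by move=> /(_ 1%N) Cf; exact: Ck_is_pd Cf. Qed.

Lemma smooth_pderiv (D : set E) (f : E -> R) i : smooth D f -> smooth D (pderiv i f).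
Proof. by move=> Cf k; exact: Ck_pderiv (Cf k.+1). Qed.

Lemma smooth_eq (D : set E) (f g : E -> R) : hopen D ->
  (forall x, D x -> f x = g x) -> smooth D f -> smooth D g.
Proof. by move=> oD fg Cf k; exact: Ck_eq (Cf k). Qed.

Lemma smooth_sub (D D' : set E) (f : E -> R) : hopen D -> hopen D' -> D' `<=` D ->
  smooth D f -> smooth D' f.
Proof. by move=> oD oD' DD Cf k; exact: Ck_sub (Cf k). Qed.

Lemma smooth_local (D : set E) (f : E -> R) : hopen D ->
  (forall x, D x -> exists D', [/\ hopen D', D' x & smooth D' f]) -> smooth D f.
Proof.
move=> oD H k; apply: Ck_local => // x /H[D' [oD' D'x Cf]].
by exists D'; split.
Qed.

(** Coinduction principle for smoothness: a class of continuous functions that contains the partial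
    derivatives of its members consists of smooth functions. *)
Lemma smooth_family (D : set E) (C : (E -> R) -> Prop) : hopen D ->
  (forall f x, C f -> D x -> hcont f x) ->
  (forall f i, C f -> exists2 g, C g & forall x, D x -> is_pd i f x (g x)) ->
  forall f, C f -> smooth D f.
Proof.
move=> oD cC dC f + k; elim: k f => [|k IH] f Cf.
  by apply: Ck0 => // x; exact: cC.
have dCf i := cid2 (dC f i Cf).
apply: (CkS (g := fun i => s2val (dCf i))) => // [x|i x Dx|i].
- exact: cC.
- by case: (dCf i) => g /= _; apply.
- by apply: IH; case: (dCf i).
Qed.

Lemma smooth_cst (D : set E) (a : R) : hopen D -> smooth D (fun=> a).
Proof.
move=> oD; apply: (@smooth_family D [set f | exists a, f = fun=> a]) => //.
- by move=> f x [b ->] _; exact: cvg_cst.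
- move=> f i [b ->]; exists (fun=> 0); first by exists 0.
  by move=> x _; exact: is_pd_cst.
- by exists a.
Qed.

Lemma hcont_coord j (x : E) : hcont (fun y => y 0 j) x.
Proof.
apply/cvgrPdist_lt => e e0; apply/hnearP; exists e => // y _ /(_ j).
by rewrite distrC.
Qed.

Lemma is_pd_coord i j (x : E) : is_pd i (fun y => y 0 j) x (j == i)%:R.
Proof.
have E1 : \forall h \near pincr i x, (j == i)%:R = pquot i (fun y => y 0 j) x h.
  apply/pincrP; exists 1 => // h h0 _ _.
  by rewrite /pquot moveE [x 0 j + _]addrC addrK mulKf.
exact: cvg_near_eq E1 (cvg_cst _).
Qed.

Lemma smooth_coord (D : set E) j : hopen D -> smooth D (fun x => x 0 j).
Proof.
move=> oD [|k]; first by apply: Ck0 => // x _; exact: hcont_coord.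
apply: (CkS (g := fun i _ => (j == i)%:R)) => // [x _|i x _|i].
- exact: hcont_coord.
- exact: is_pd_coord.
- exact: smooth_cst.
Qed.

Lemma hcontD (f g : E -> R) x : hcont f x -> hcont g x -> hcont (fun y => f y + g y) x.
Proof. by move=> cf cg; apply: cvgD. Qed.

Lemma hcontM (f g : E -> R) x : hcont f x -> hcont g x -> hcont (fun y => f y * g y) x.
Proof. by move=> cf cg; apply: cvgM. Qed.

Lemma hcont_sum (I : Type) (r : seq I) (P : pred I) (f : I -> E -> R) x :
  (forall i, P i -> hcont (f i) x) -> hcont (fun y => \sum_(i <- r | P i) f i y) x.
Proof. by move=> cf; apply: cvg_sumr. Qed.

Lemma Ck_D (D : set E) k (f g : E -> R) : hopen D ->
  Ck D k f -> Ck D k g -> Ck D k (fun x => f x + g x).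
Proof.
move=> oD; elim: k f g => [|k IH] f g Cf Cg.
  by apply: Ck0 => // x Dx; apply: hcontD; [exact: Ck_hcont Cf _|exact: Ck_hcont Cg _].
apply: (CkS (g := fun i x => pderiv i f x + pderiv i g x)) => // [x Dx|i x Dx|i].
- by apply: hcontD; [exact: Ck_hcont Cf _|exact: Ck_hcont Cg _].
- by apply: is_pdD; [exact: Ck_is_pd Cf _|exact: Ck_is_pd Cg _].
- by apply: IH; exact: Ck_pderiv.
Qed.

Lemma Ck_M (D : set E) k (f g : E -> R) : hopen D ->
  Ck D k f -> Ck D k g -> Ck D k (fun x => f x * g x).
Proof.
move=> oD; elim: k f g => [|k IH] f g Cf Cg.
  by apply: Ck0 => // x Dx; apply: hcontM; [exact: Ck_hcont Cf _|exact: Ck_hcont Cg _].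
apply: (CkS (g := fun i x => pderiv i f x * g x + f x * pderiv i g x)) => // [x Dx|i x Dx|i].
- by apply: hcontM; [exact: Ck_hcont Cf _|exact: Ck_hcont Cg _].
- by apply: is_pdM; [exact: Ck_is_pd Cf _|exact: Ck_is_pd Cg _].
- by apply: Ck_D => //; apply: IH => //; first [exact: Ck_pderiv|exact: CkW].
Qed.

Lemma Ck_sum (D : set E) k (I : Type) (r : seq I) (P : pred I) (f : I -> E -> R) : hopen D ->
  (forall i, P i -> Ck D k (f i)) -> Ck D k (fun x => \sum_(i <- r | P i) f i x).
Proof.
move=> oD Cf; elim: r => [|i r IH].
  apply: (@Ck_eq _ _ (fun=> 0)) => // [x _|]; first by rewrite big_nil.
  exact: smooth_cst.
apply: (@Ck_eq _ _ (if P i then fun x => f i x + \sum_(j <- r | P j) f j x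
  else fun x => \sum_(j <- r | P j) f j x)) => // [x _|].
  by rewrite big_cons; case: ifP.
by case: ifP => // Pi; apply: Ck_D => //; exact: Cf.
Qed.

Lemma smoothD (D : set E) (f g : E -> R) : hopen D ->
  smooth D f -> smooth D g -> smooth D (fun x => f x + g x).
Proof. by move=> oD Cf Cg k; exact: Ck_D. Qed.

Lemma smoothM (D : set E) (f g : E -> R) : hopen D ->
  smooth D f -> smooth D g -> smooth D (fun x => f x * g x).
Proof. by move=> oD Cf Cg k; exact: Ck_M. Qed.

Lemma is_pdV i (f : E -> R) x l : f x != 0 -> is_pd i f x l ->
  is_pd i (fun y => (f y)^-1) x (- (f x) ^- 2 * l).
Proof.
move=> fx0 fl; have fm := is_pd_move fl.
have E1 : \forall h \near pincr i x, f (x + h *: e_ i) != 0.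
  exact: cvgr_neq0 fm fx0.
have H : (fun h => - ((f (x + h *: e_ i))^-1 * (f x)^-1) * pquot i f x h) @ pincr i x
    --> - ((f x)^-1 * (f x)^-1) * l.
  apply: cvgM => //; apply: cvgN; apply: cvgM; last exact: cvg_cst.
  exact: cvgV.
rewrite expr2 invfM; apply: cvg_near_eq H.
apply: filterS E1 => h fh; rewrite /pquot.
have -> : (f (x + h *: e_ i))^-1 - (f x)^-1 =
   - ((f (x + h *: e_ i))^-1 * (f x)^-1) * (f (x + h *: e_ i) - f x).
  by field; rewrite fx0.
by rewrite mulrCA.
Qed.

Lemma smoothV (D : set E) (f : E -> R) : hopen D ->
  (forall x, D x -> f x != 0) -> smooth D f -> smooth D (fun x => (f x)^-1).
Proof.
move=> oD f0 Cf; have cV x : D x -> hcont (fun x => (f x)^-1) x.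
  by move=> Dx; apply: cvgV; [exact: f0|exact: smooth_hcont Cf _].
elim=> [|k IH]; first exact: Ck0.
apply: (CkS (g := fun i x => - 1 * ((f x)^-1 * (f x)^-1) * pderiv i f x)) => // [i x Dx|i].
  have := is_pdV (f0 x Dx) (smooth_is_pd (i := i) Cf Dx).
  by rewrite expr2 invfM mulN1r.
apply: Ck_M => //; last exact: smooth_pderiv.
by apply: Ck_M => //; [exact: smooth_cst|exact: Ck_M].
Qed.

Lemma is_pd_powR i (f : E -> R) x l a : 0 < f x -> is_pd i f x l ->
  is_pd i (fun y => f y `^ a) x (a * f x `^ (a - 1) * l).
Proof.
move=> fx0 fl; apply: (@is_pd_comp R n i (fun t => t `^ a)) => //.
exact: is_derive1_powR.
Qed.

Lemma smooth_powR (D : set E) (f : E -> R) (a : R) : hopen D ->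
  (forall x, D x -> 0 < f x) -> smooth D f -> smooth D (fun x => f x `^ a).
Proof.
move=> oD f0 Cf; have cV b x : D x -> hcont (fun x => f x `^ b) x.
  move=> Dx; apply: (cvg_comp f (fun t => t `^ b) (smooth_hcont oD Cf Dx)).
  have /derivable1_diffP/differentiable_continuous H : derivable (fun t : R => t `^ b) (f x) 1.
    by have [] := is_derive1_powR b (f0 x Dx).
  exact: H.
move=> k; elim: k a => [|k IH] a; first by apply: Ck0 => // x; exact: cV.
apply: (CkS (g := fun i x => a * f x `^ (a - 1) * pderiv i f x)) => // [x|i x Dx|i].
  exact: cV.
  exact: (is_pd_powR (a := a) (f0 x Dx) (smooth_is_pd (i := i) Cf Dx)).
apply: Ck_M => //; last exact: smooth_pderiv.
by apply: Ck_M => //; exact: smooth_cst.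
Qed.

(** Carries a derivative formula from the interior to the face, by [sdiff_boundary]. Both the
    division by the boundary coordinate and the extension of solutions of linear systems rest on
    it. *)
Lemma is_pd_boundary (D : set E) (f : E -> R) (g : 'I_n.+1 -> E -> R) : hopen D ->
  (forall x, D x -> hcont f x) -> (forall k x, D x -> hcont (g k) x) ->
  (forall k x, D x -> open_half x -> is_pd k f x (g k x)) ->
  forall k x, D x -> is_pd k f x (g k x).
Proof.
move=> [Dh Dn] cf cg fg k x Dx.
suff S : sdiff half f x (fun k => g k x) by exact: (is_pd_sdiff (Dh x Dx) S).
have Dx' : hnear open_half x D := hnear_sub open_half_half (Dn x Dx).
apply: (sdiff_boundary (d := g)).
- by apply: filterS (Dn x Dx) => y; exact: cf.
- move=> j; move/hnearP: Dx' => [e e0 H]; apply/hnearP; exists e => // y oy yx.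
  by apply: fg => //; exact: H.
- by move=> j P /(cg j x Dx); exact: hnear_sub open_half_half.
Qed.

Lemma smooth_sdiff (D : set E) (f : E -> R) x : hopen D -> smooth D f -> D x ->
  sdiff half f x (fun k => pderiv k f x).
Proof.
move=> oD Cf Dx; apply: (sdiff_C1 (d := fun k => pderiv k f)).
- exact: mixclosed_half.
- by [].
- by apply: (hopen_near oD Dx) => y Dy; exact: (smooth_hcont oD Cf Dy).
- by move=> k; apply: (hopen_near oD Dx) => y Dy; exact: (smooth_is_pd (i := k) Cf Dy).
- by move=> k; exact: (smooth_hcont oD (smooth_pderiv k Cf) Dx).
Qed.

Lemma smooth_schwarz (D : set E) (f : E -> R) i j x : hopen D -> smooth D f -> D x ->
  pderiv j (pderiv i f) x = pderiv i (pderiv j f) x.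
Proof.
move=> oD Cf Dx; have Cfi : smooth D (pderiv i f) by exact: smooth_pderiv.
have Cfj : smooth D (pderiv j f) by exact: smooth_pderiv.
apply: (@schwarz R n i j f (pderiv i f) (pderiv j f)).
- by case: oD => + _; apply.
- apply: (hopen_near oD Dx) => y Dy.
  by split; [|split]; [exact: (smooth_hcont oD Cf Dy)|exact: (smooth_hcont oD Cfi Dy)
    |exact: (smooth_hcont oD Cfj Dy)].
- apply: (hopen_near oD Dx) => y Dy.
  by split; [exact: (smooth_is_pd (i := i) Cf Dy)|exact: (smooth_is_pd (i := j) Cf Dy)].
- apply: (hopen_near oD Dx) => y Dy.
  by split; [exact: (smooth_is_pd (i := j) Cfi Dy)|exact: (smooth_is_pd (i := i) Cfj Dy)].
- exact: (smooth_hcont oD (smooth_pderiv j Cfi) Dx).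
- exact: (smooth_hcont oD (smooth_pderiv i Cfj) Dx).
Qed.

End SmoothFunctions.

(** * Division by the boundary coordinate *)

Section Hadamard.
Context {R : realType} {n : nat}.
Local Notation E := 'rV[R]_n.+1.
Local Notation half := (@halfspace R n).
Local Notation e_ i := (delta_mx 0 i : E).
Local Notation d0 := (@pderiv R n ord0).

Variable D : set E.
Hypothesis oD : hopen D.

Let Dhalf x : D x -> half x. Proof. by case: oD => + _; apply. Qed.

Lemma is_pd_eqv i (f : E -> R) x l l' : is_pd i f x l -> l = l' -> is_pd i f x l'.
Proof. by move=> fl <-. Qed.

Lemma is_pd_coord0 i (x : E) : is_pd i (fun y => y ord0 ord0) x (ord0 == i)%:R.
Proof. exact: is_pd_coord. Qed.

Definition flat (m : nat) (f : E -> R) : Prop :=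
  smooth D f /\ forall j x, (j < m)%N -> D x -> x ord0 ord0 = 0 -> iter j d0 f x = 0.

(** [f / x0 ^ m], completed on the face by the Taylor coefficient of order [m] in the normal
    direction. *)
Definition quot0 (m : nat) (f : E -> R) (x : E) : R :=
  if x ord0 ord0 == 0 then iter m d0 f x / m`!%:R else f x / x ord0 ord0 ^+ m.

Lemma smooth_iter j f : smooth D f -> smooth D (iter j d0 f).
Proof. by move=> sf; elim: j => //= j IH; exact: smooth_pderiv. Qed.

Lemma flatS m f : flat m.+1 f -> flat m (d0 f).
Proof.
move=> [sf f0]; split=> [|j x jm Dx x0]; first exact: smooth_pderiv.
by rewrite -iterSr f0.
Qed.

(** By Schwarz a tangential derivative commutes with the normal ones, and the tangential derivative
    of a function vanishing on the face vanishes there. *)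
Lemma flat_tangential m f i : i != ord0 -> flat m f -> flat m (pderiv i f).
Proof.
move=> i0 [sf f0]; split=> [|j x jm Dx x0]; first exact: smooth_pderiv.
have comm k y : D y -> iter k d0 (pderiv i f) y = pderiv i (iter k d0 f) y.
  elim: k y => //= k IH y Dy.
  rewrite (@hnear_eq_pderiv _ _ ord0 _ (pderiv i (iter k d0 f))).
  - by rewrite (smooth_schwarz ord0 i oD)//; exact: smooth_iter.
  - exact: Dhalf.
  - exact: hopen_near oD Dy IH.
rewrite comm//; apply: (is_pd_tangential (f := iter j d0 f) (Dhalf Dx) x0 i0).
  apply: (hopen_near oD Dx) => y Dy y0; exact: f0.
by apply: smooth_is_pd Dx; exact: smooth_iter.
Qed.

(** The [j]-th normal derivative of [x0 * d0 f - m * f] is [x0 * d0^(j+1) f + (j - m) * d0^j f]. On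
    the face the first term vanishes; the second vanishes by flatness for [j < m] and by its
    coefficient for [j = m], which is the gained order. *)
Lemma flat_normal m f : flat m f ->
  flat m.+1 (fun x => x ord0 ord0 * d0 f x - m%:R * f x).
Proof.
move=> [sf f0]; have sx : smooth D (fun x => x ord0 ord0) by exact: smooth_coord.
have s1 : smooth D (fun x => x ord0 ord0 * d0 f x - m%:R * f x).
  have := smoothD oD (smoothM oD sx (smooth_pderiv ord0 sf))
    (smoothM oD (smooth_cst (- m%:R) oD) sf).
  by apply: smooth_eq => // x _; rewrite mulNr.
split=> // j x jm Dx x0.
have comm k y : D y -> iter k d0 (fun x => x ord0 ord0 * d0 f x - m%:R * f x) y =
   y ord0 ord0 * iter k.+1 d0 f y + (k%:R - m%:R) * iter k d0 f y.
  elim: k y => [|k IH] y Dy; first by rewrite /=; ring.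
  rewrite iterS (@hnear_eq_pderiv _ _ ord0 _ (fun y =>
     y ord0 ord0 * iter k.+1 d0 f y + (k%:R - m%:R) * iter k d0 f y)).
  - apply: (is_pd_pderiv (Dhalf Dy)).
    have p1 := is_pdM (is_pd_coord0 (i := ord0) y)
      (smooth_is_pd (i := ord0) (smooth_iter k.+1 sf) Dy).
    have p2 := is_pdZ (a := k%:R - m%:R) (smooth_is_pd (i := ord0) (smooth_iter k sf) Dy).
    apply: (is_pd_eqv (is_pdD p1 p2)); rewrite eqxx mul1r -!iterS -[k.+1%:R]natr1.
    ring.
  - exact: Dhalf.
  - exact: hopen_near oD Dy IH.
rewrite comm// x0 mul0r add0r.
move: jm; rewrite ltnS leq_eqVlt => /predU1P[->|jm]; first by rewrite subrr mul0r.
by rewrite f0// mulr0.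
Qed.

Lemma is_pd_coordX i k (z : E) :
  is_pd i (fun z : E => z ord0 ord0 ^+ k) z (k%:R * z ord0 ord0 ^+ k.-1 * (ord0 == i)%:R).
Proof.
elim: k => [|k IHk].
  by rewrite !mul0r; exact: is_pd_cst.
have H := is_pdM (is_pd_coord0 (i := i) z) IHk.
under eq_fun do rewrite exprS.
apply: (is_pd_eqv H); case: k {IHk H} => [|k].
  by rewrite !mul0r mulr0 addr0 !expr0 !mulr1 mul1r.
by rewrite -[k.+2%:R]natr1 /= exprS; ring.
Qed.

Lemma hcontX (f : E -> R) k x : hcont f x -> hcont (fun y => f y ^+ k) x.
Proof.
move=> cf; elim: k => [|k IH]; first exact: cvg_cst.
have -> : (fun y => f y ^+ k.+1) = (fun y => f y * f y ^+ k).
  by apply/funext => y; rewrite exprS.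
exact: hcontM.
Qed.

(** Near a face point, a value of the quotient of order [m + 1] of [f] is [1 / (m + 1)] times a
    value of the quotient of order [m] of [d0 f] at a point of the same box, so induction on [m]
    gives continuity. *)
Lemma hcont_quot0 m f p : flat m f -> D p -> hcont (quot0 m f) p.
Proof.
elim: m f p => [|m IH] f p ff Dp.
  have [sf _] := ff; apply: (hnear_eq_hcont (f := f)); first exact: Dhalf.
    by apply: nearW => y; rewrite /quot0 /= fact0 expr0 invr1 mulr1 if_same.
  exact: smooth_hcont Dp.
have [sf f0] := ff; have sx : smooth D (fun x => x ord0 ord0) by exact: smooth_coord.
have [p0|p0] := eqVneq (p ord0 ord0) 0; last first.
  have pp : 0 < p ord0 ord0 by rewrite lt_def p0 /=; exact: Dhalf.
  have oD' := hopenI_open_half oD.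
  apply: (hnear_eq_hcont (f := fun y => f y * (y ord0 ord0 ^+ m.+1)^-1)).
  - exact: Dhalf.
  - apply: (hopen_near oD') => [|y [_ y0]]; first by split.
    by rewrite /quot0 gt_eqF.
  - apply: hcontM; first exact: smooth_hcont Dp.
    apply: cvgV; first by rewrite expf_neq0.
    exact: (hcontX (smooth_hcont oD sx Dp)).
have fdS := flatS ff; have := IH _ _ fdS Dp => cq.
have m0 : m.+1%:R != 0 :> R by rewrite pnatr_eq0.
have [r r0 Hr] : exists2 r : R, 0 < r & forall y : E, half y ->
    (forall j, `|y 0 j - p 0 j| < r) -> D y.
  by case: oD => _ /(_ p Dp)/hnearP.
have bdry (y : E) : y ord0 ord0 = 0 -> quot0 m.+1 f y = quot0 m (d0 f) y / m.+1%:R.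
  by move=> y0; rewrite /quot0 y0 eqxx -iterSr factS natrM invfM [_^-1 / _]mulrC mulrA mulrAC.
have key (e : R) (y : E) : 0 < e -> e <= r -> half y -> (forall j, `|y 0 j - p 0 j| < e) ->
    exists xi : E, [/\ half xi, forall j, `|xi 0 j - p 0 j| < e &
      quot0 m.+1 f y = quot0 m (d0 f) xi / m.+1%:R].
  move=> e0 er hy yp; have [y0|yn] := eqVneq (y ord0 ord0) 0.
    by exists y; split=> //; exact: bdry.
  have yp0 : 0 < y ord0 ord0 by rewrite lt_def yn.
  pose c := f y / y ord0 ord0 ^+ m.+1.
  pose y' : E := y + (- y ord0 ord0) *: e_ ord0.
  have y'0 : y' ord0 ord0 = 0 by rewrite moveE eqxx mulr1 subrr.
  have yE : y' + y ord0 ord0 *: e_ ord0 = y by rewrite /y' move_move addNr scale0r addr0.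
  have seg (t : R) : 0 <= t <= 1 -> half (y' + (t * y ord0 ord0) *: e_ ord0) /\
      forall j, `|(y' + (t * y ord0 ord0) *: e_ ord0) 0 j - p 0 j| < e.
    move=> /andP[t0 t1]; split.
      by rewrite /halfspace /= moveE eqxx mulr1 y'0 add0r mulr_ge0// ltW.
    move=> j; rewrite /y' move_move moveE; have := yp j.
    case: eqP => [->|_]; last by rewrite mulr0 addr0.
    have p0' : p 0 ord0 = 0 := p0.
    rewrite mulr1 p0' !subr0.
    move=> ye; apply: le_lt_trans ye.
    rewrite addrA (_ : y 0 ord0 - _ = 0) ?add0r; last exact: subrr.
    by rewrite normrM (ger0_norm t0) ler_piMl.
  have segD t : 0 <= t <= 1 -> D (y' + (t * y ord0 ord0) *: e_ ord0).
    move=> /seg[h1 h2]; apply: Hr => // j; exact: lt_le_trans er.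
  (* [phi] vanishes at both ends of the normal segment from the foot [y'] to [y], so its normal
     derivative vanishes at some [xi] in between: Cauchy's mean value theorem against
     [x0 ^ (m + 1)]. *)
  pose phi (z : E) := f z - c * z ord0 ord0 ^+ m.+1.
  pose dphi (z : E) := d0 f z - c * (m.+1%:R * z ord0 ord0 ^+ m).
  have cX (z : E) : hcont (fun z : E => z ord0 ord0 ^+ m.+1) z.
    by apply: hcontX; exact: hcont_coord.
  have [||t tI|t tI|t tI] := @mvt_coord R n phi dphi ord0 y' (y ord0 ord0).
  - by rewrite /halfspace /= y'0.
  - by rewrite yE.
  - apply: cvgB; first exact: (smooth_hcont oD sf (segD t tI)).
    by apply: cvgM; [exact: cvg_cst|exact: cX].
  - have tI' : 0 <= t <= 1 by case/andP: tI => ? ?; rewrite !ltW.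
    have HX := is_pd_coordX (i := ord0) (k := m.+1) (z := y' + (t * y ord0 ord0) *: e_ ord0).
    rewrite eqxx mulr1 in HX.
    exact: (is_pdD (smooth_is_pd (i := ord0) sf (segD t tI')) (is_pdN (is_pdZ (a := c) HX))).
  have tI' : 0 <= t <= 1 by case/andP: tI => ? ?; rewrite !ltW.
  have Dy' : D y' by have := segD 0; rewrite mul0r scale0r addr0; apply; rewrite lexx ler01.
  rewrite yE {1}/phi /c divfK ?expf_neq0// subrr sub0r /phi y'0 expr0n /= mulr0 subr0.
  have -> : f y' = 0 by exact: (f0 0%N y').
  rewrite oppr0 => /esym/eqP; rewrite mulf_eq0 (negbTE yn) orbF.
  set xi := y' + _ => /eqP dz; exists xi.
  have [h1 h2] := seg t tI'; split=> //.
  have xi0 : xi ord0 ord0 != 0.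
    rewrite /xi moveE eqxx mulr1 y'0 add0r mulf_neq0//.
    by case/andP: tI => t0 _; rewrite gt_eqF.
  rewrite /quot0 (negbTE yn) (negbTE xi0) -/c.
  move/eqP: dz; rewrite /dphi subr_eq0 => /eqP ->.
  by rewrite mulrA mulfK ?expf_neq0// mulfK.
have -> : hcont (quot0 m.+1 f) p = (quot0 m.+1 f @ hnear half p --> quot0 m.+1 f p) by [].
apply/cvgrPdist_lt => e e0; rewrite bdry//.
have me0 : 0 < e * m.+1%:R by rewrite mulr_gt0// ltr0n.
move/cvgrPdist_lt : cq => /(_ _ me0)/hnearP[s s0 Hs].
apply/hnearP; exists (Num.min s r); first by rewrite lt_min s0.
move=> y hy yp; have [||xi [hxi xip ->]] := key (Num.min s r) y _ _ hy yp.
- by rewrite lt_min s0.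
- by rewrite ge_min lexx orbT.
rewrite -mulrBl normrM normfV [X in _ / X]ger0_norm// ltr_pdivrMr ?ltr0n//.
apply: Hs => // j; apply: lt_le_trans (xip j) _.
by rewrite ge_min lexx.
Qed.

(* Hadamard's lemma without integrals: the quotients [h / x0 ^ k] of functions
   flat of order [k] form a class closed under partial derivatives, since
   [d0 (h / x0 ^ k) = (x0 * d0 h - k * h) / x0 ^ k.+1] and this numerator is flat
   of order [k.+1]. *)
Lemma smooth_quot0 m f : flat m f -> smooth D (quot0 m f).
Proof.
move=> ff; have oD' := hopenI_open_half oD.
apply: (@smooth_family _ _ _ [set g | exists k h, flat k h /\ g = quot0 k h] oD);
  last by exists m, f.
  by move=> _ x [k [h [fh ->]]]; exact: hcont_quot0.
move=> _ i [k [h [fh ->]]]; have [sh h0] := fh.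
pose k' (j : 'I_n.+1) := if j == ord0 then k.+1 else k.
pose h' (j : 'I_n.+1) : E -> R :=
  if j == ord0 then fun x : E => x ord0 ord0 * d0 h x - k%:R * h x else pderiv j h.
have fh' j : flat (k' j) (h' j).
  rewrite /k' /h'; case: eqP => [_|/eqP j0]; first exact: flat_normal.
  exact: flat_tangential.
exists (quot0 (k' i) (h' i)); first by exists (k' i), (h' i).
move=> x Dx; pose G (j : 'I_n.+1) := quot0 (k' j) (h' j).
suff H : forall j y, D y -> open_half y -> is_pd j (quot0 k h) y (G j y).
  apply: (is_pd_boundary (g := G) oD _ _ H) Dx => [y Dy|j y Dy].
    exact: hcont_quot0.
  exact: hcont_quot0.
move=> j y Dy oy; have y0 : y ord0 ord0 != 0 by rewrite gt_eqF.
have yk : y ord0 ord0 ^+ k != 0 by rewrite expf_neq0.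
have p1 := is_pdM (smooth_is_pd (i := j) sh Dy) (is_pdV yk (is_pd_coordX (i := j) (k := k) (z := y))).
have -> : G j y = pderiv j h y * (y ord0 ord0 ^+ k)^-1 + h y *
  (- (y ord0 ord0 ^+ k) ^- 2 * (k%:R * y ord0 ord0 ^+ k.-1 * (ord0 == j)%:R)).
  rewrite /G /quot0 (negbTE y0) /k' /h' [ord0 == j]eq_sym.
  case: eqP => [->|_]; last by rewrite !mulr0 addr0.
  rewrite mulr1; case: k yk {p1 fh k' h' fh' G h0} => [_|k yk].
    by rewrite !mul0r !mulr0 subr0 addr0 expr1 expr0 invr1 mulr1 mulrAC mulfV// mul1r.
  rewrite /= !exprS; field; rewrite y0 expf_neq0//.
apply: (hnear_eq_is_pd _ _ p1); first exact: Dhalf.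
apply: (hopen_near oD') => [|z [_ z0]]; first by split.
by rewrite /quot0 gt_eqF.
Qed.

Lemma hadamard f : smooth D f -> (forall x, D x -> x ord0 ord0 = 0 -> f x = 0) ->
  exists2 g, smooth D g & (forall x, D x -> f x = x ord0 ord0 * g x) /\
    (forall x, D x -> x ord0 ord0 = 0 -> g x = pderiv ord0 f x).
Proof.
move=> sf f0; have ff : flat 1 f by split=> // -[|j] x // _; exact: f0.
exists (quot0 1 f); first exact: smooth_quot0.
split=> x Dx; last by move=> x0; rewrite /quot0 x0 eqxx /= divr1.
rewrite /quot0; case: eqVneq => [x0|x0]; first by rewrite x0 mul0r f0.
by rewrite expr1 mulrCA divff// mulr1.
Qed.

End Hadamard.

(** * Extension of solutions of linear systems *)

Section LinearExtension.
Context {R : realType} {n : nat}.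
Local Notation E := 'rV[R]_n.+1.
Local Notation half := (@halfspace R n).
Local Notation oh := (@open_half R n).
Local Notation e_ i := (delta_mx 0 i : E).

Lemma ler_norm_mulb (s : R) (b : bool) : `|s * b%:R| <= `|s|.
Proof. by case: b; rewrite ?mulr1 ?mulr0 ?normr0. Qed.

Lemma hnear_proper (p : E) : half p -> ProperFilter (hnear oh p).
Proof.
move=> hp; apply: Build_ProperFilter_ex => P /hnearP[e e0 H].
exists (p + (e / 2) *: e_ ord0); apply: H.
  by rewrite /open_half /= moveE eqxx mulr1 ltr_wpDl// divr_gt0.
move=> j; rewrite moveE addrC addKr; apply: (@le_lt_trans _ _ (e / 2)).
  by apply: (le_trans (ler_norm_mulb _ _)); rewrite gtr0_norm ?divr_gt0.
by rewrite ltr_pdivrMr// ltr_pMr// ltr1n.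
Qed.

(** At a face point [y] near [x] the value [F y] is itself a limit, so it is compared with [F x]
    through an interior point [z] close to [y]. *)
Lemma hcont_by_limits (D : set E) (f F : E -> R) : hopen D ->
  (forall x, D x -> oh x -> hcont f x) ->
  (forall x, D x -> oh x -> F x = f x) ->
  (forall x, D x -> ~ oh x -> f @ hnear oh x --> F x) ->
  forall x, D x -> hcont F x.
Proof.
move=> oD cf Ff lF x Dx; have hx : half x by case: oD => + _; apply.
have [ox|nx] := pselect (oh x).
  apply: (hnear_eq_hcont (f := f)) => //; last exact: cf.
  apply: (hopen_near (hopenI_open_half oD)) => [|y [Dy oy]]; first by split.
  by rewrite Ff.
apply/cvgrPdist_lt => e e0; have e2 : 0 < e / 2 by rewrite divr_gt0.
have /cvgrPdist_lt/(_ _ e2)/hnearP[r r0 H] := lF x Dx nx.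
have [s s0 HD] : exists2 s : R, 0 < s & forall y : E, half y ->
    (forall j, `|y 0 j - x 0 j| < s) -> D y.
  by case: oD => _ /(_ x Dx)/hnearP.
apply/hnearP; exists (Num.min r s); first by rewrite lt_min r0.
move=> y hy yx; have yr j : `|y 0 j - x 0 j| < r.
  by apply: (lt_le_trans (yx j)); rewrite ge_min lexx.
have Dy : D y.
  by apply: HD => // j; apply: (lt_le_trans (yx j)); rewrite ge_min lexx orbT.
have e2e : e / 2 < e by rewrite ltr_pdivrMr// ltr_pMr// ltr1n.
have [oy|ny] := pselect (oh y).
  by rewrite (Ff y)//; apply: lt_trans e2e; exact: H.
apply: le_lt_trans e2e; apply/ler_addgt0Pr => eta eta0.
have /cvgrPdist_lt/(_ _ eta0)/hnearP[t t0 Ht] := lF y Dy ny.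
(* The minimum over the coordinates keeps every [z] within [rr] of [y] inside the box of radius [r]
   around [x]. *)
pose rr := Num.min t (\big[Num.min/t]_j (r - `|y 0 j - x 0 j|)).
have rr0 : 0 < rr.
  rewrite lt_min t0 /=; apply/bigmin_gtP; split=> // j _.
  by rewrite subr_gt0.
have N : hnear oh y (fun z => oh z /\ forall j, `|z 0 j - y 0 j| < rr).
  by apply/hnearP; exists rr.
have [z [oz zy]] := @filter_ex _ _ (hnear_proper hy) _ N.
rewrite -(subrK (f z) (F x)) -addrA; apply: (le_trans (ler_normD _ _)).
apply: lerD.
  apply/ltW/H => // j; rewrite -(subrK (y 0 j) (z 0 j)) -addrA.
  apply: (le_lt_trans (ler_normD _ _)); rewrite -ltrBrDr.
  by apply: (lt_le_trans (zy j)); rewrite ge_min; apply/orP; right; exact: bigmin_le.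
rewrite distrC; apply/ltW/Ht => // j; apply: (lt_le_trans (zy j)).
by rewrite ge_min lexx.
Qed.

Lemma hcont_bound (f : E -> R) p : half p -> hcont f p ->
  exists2 r : R, 0 < r & forall y, half y -> (forall j, `|y 0 j - p 0 j| < r) ->
    `|f y| <= `|f p| + 1.
Proof.
move=> hp /cvgrPdist_lt/(_ 1 ltr01)/hnearP[r r0 H]; exists r => // y hy yp.
rewrite -(subrK (f p) (f y)) addrC; apply: (le_trans (ler_normD _ _)).
by rewrite lerD2l distrC ltW//; exact: H.
Qed.

Lemma hcont_bound_fin (I : finType) (f : I -> E -> R) p : half p ->
  (forall i, hcont (f i) p) ->
  exists C r : R, [/\ 0 <= C, 0 < r & forall i y, half y ->
    (forall j, `|y 0 j - p 0 j| < r) -> `|f i y| <= C].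
Proof.
move=> hp cf; pose C := \sum_i (`|f i p| + 1).
have C0 : 0 <= C by apply: sumr_ge0 => i _; rewrite addr_ge0.
have /hnearP[r r0 H] : hnear half p (fun y => forall i, `|f i y| <= `|f i p| + 1).
  apply: (@filter_forall E I (fun i y => `|f i y| <= `|f i p| + 1) _ (hnear_filter _ _)) => i.
  by have [r r0 H] := hcont_bound hp (cf i); apply/hnearP; exists r.
exists C, r; split=> // i y hy yp; apply: (le_trans (H y hy yp i)).
by rewrite /C (bigD1 i)//= lerDl; apply: sumr_ge0 => k _; rewrite addr_ge0.
Qed.

Variables (I : finType) (D : set E).
Variables (A : 'I_n.+1 -> I -> I -> E -> R) (h : I -> E -> R).
Hypothesis oD : hopen D.
Hypothesis sA : forall i j k, smooth D (A i j k).
Hypothesis ch : forall j x, D x -> oh x -> hcont (h j) x.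
Hypothesis dh : forall i j x, D x -> oh x ->
  is_pd i (h j) x (\sum_k A i j k x * h k x).

Let Dhalf x : D x -> half x. Proof. by case: oD => + _; apply. Qed.

Lemma sum_quad_bound (K : R) (a : I -> I -> R) (v : I -> R) : 0 <= K ->
  (forall j k, `|a j k| <= K) ->
  `|\sum_j \sum_k v j * a j k * v k| <= K * #|I|%:R * \sum_j v j ^+ 2.
Proof.
move=> K0 aK; apply: (le_trans (ler_norm_sum _ _ _)).
have step j k : `|v j * a j k * v k| <= K / 2 * (v j ^+ 2 + v k ^+ 2).
  rewrite !normrM mulrAC mulrC.
  apply: (@le_trans _ _ (K * (`|v j| * `|v k|))).
    by rewrite ler_wpM2r// mulr_ge0.
  rewrite -(real_normK (num_real (v j))) -(real_normK (num_real (v k))).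
  have := sqr_ge0 (`|v j| - `|v k|); rewrite sqrrB => sq.
  by rewrite -mulrA ler_wpM2l//; lra.
apply: (@le_trans _ _ (\sum_j \sum_k K / 2 * (v j ^+ 2 + v k ^+ 2))).
  apply: ler_sum => j _; apply: (le_trans (ler_norm_sum _ _ _)).
  by apply: ler_sum.
under eq_bigr do rewrite -mulr_sumr big_split /= sumr_const.
rewrite -mulr_sumr big_split /= sumr_const sumrMnl.
set S := \sum_j v j ^+ 2; rewrite -[S *+ _]mulr_natr.
by rewrite le_eqVlt; apply/orP; left; apply/eqP; field.
Qed.

(* Gronwall: [|d0 |h|^2| <= N * |h|^2], so [|h|^2 * expR (N * x0)] is
   nondecreasing in [x0]. *)
Lemma linear_bound p : D p -> p ord0 ord0 = 0 ->
  exists C r : R, [/\ 0 <= C, 0 < r & forall j y, oh y ->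
    (forall j, `|y 0 j - p 0 j| < r) -> D y /\ `|h j y| <= C].
Proof.
move=> Dp p0; have hp := Dhalf Dp.
have [K [r1 [K0 r10 AK]]] := @hcont_bound_fin _ (fun jk : I * I => A ord0 jk.1 jk.2) p hp
  (fun jk => smooth_hcont oD (sA ord0 jk.1 jk.2) Dp).
have [r2 r20 HD] : exists2 s : R, 0 < s & forall y : E, half y ->
    (forall j, `|y 0 j - p 0 j| < s) -> D y.
  by case: oD => _ /(_ p Dp)/hnearP.
pose r := Num.min r1 r2; have r0 : 0 < r by rewrite lt_min r10.
(* [q] lies at height [r / 2] above [p]. Being interior, it has a neighbourhood where [h] is bounded
   by some [C], and normal segments join points near [p] to that neighbourhood. *)
pose q : E := p + (r / 2) *: e_ ord0.
have r2r : r / 2 < r by rewrite ltr_pdivrMr// ltr_pMr// ltr1n.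
have r2p : 0 < r / 2 by rewrite divr_gt0.
have q0 : q ord0 ord0 = r / 2 by rewrite moveE eqxx mulr1 p0 add0r.
have oq : oh q by rewrite /open_half /= q0.
have box (y : E) : half y -> (forall j, `|y 0 j - p 0 j| < r) ->
    D y /\ forall j k, `|A ord0 j k y| <= K.
  move=> hy yp; split.
    by apply: HD => // j; apply: (lt_le_trans (yp j)); rewrite ge_min lexx orbT.
  move=> j k; apply: (AK (j, k)) => // l; apply: (lt_le_trans (yp l)).
  by rewrite ge_min lexx.
have qp j : `|q 0 j - p 0 j| < r.
  rewrite moveE addrC addKr; apply: (le_lt_trans (ler_norm_mulb _ _)).
  by rewrite gtr0_norm.
have [Dq _] := box q (ltW oq) qp.
have [C [r3 [C0 r30 hC]]] := @hcont_bound_fin _ h q (ltW oq) (fun j => ch (j := j) Dq oq).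
(* The factor 2 comes from differentiating squares. [B] bounds [psi] at the upper end of the
   segment; [1 + B] then bounds [|h j|] because [2 |h j| <= 1 + (h j) ^ 2], with no square root. *)
pose N := 2 * (K * #|I|%:R).
pose B := expR (N * (r / 2)) * (\sum_(j : I) C ^+ 2).
have B0 : 0 <= B by rewrite mulr_ge0 ?expR_ge0// sumr_ge0// => j _; exact: sqr_ge0.
exists (1 + B), (Num.min (r / 2) r3); split; first by rewrite addr_ge0.
  by rewrite lt_min r2p.
move=> j y oy yp; have yr k : `|y 0 k - p 0 k| < r / 2.
  by apply: (lt_le_trans (yp k)); rewrite ge_min lexx.
have yr' k : `|y 0 k - p 0 k| < r := lt_trans (yr k) r2r.
have [Dy _] := box y (ltW oy) yr'; split=> //.
have y0r : y ord0 ord0 < r / 2.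
  have := yr ord0; rewrite (_ : p 0 ord0 = 0) ?subr0; last exact: p0.
  by apply: le_lt_trans; exact: ler_norm.
pose phi (z : E) := \sum_j h j z * h j z.
pose psi (z : E) := phi z * expR (N * z ord0 ord0).
pose dphi (z : E) := \sum_j ((\sum_k A ord0 j k z * h k z) * h j z + h j z * (\sum_k A ord0 j k z * h k z)).
pose dpsi (z : E) := dphi z * expR (N * z ord0 ord0) + phi z * (expR (N * z ord0 ord0) * (N * 1)).
have psi_pd z : D z -> oh z -> is_pd ord0 psi z (dpsi z).
  move=> Dz oz; have e1 : is_pd ord0 (fun z : E => expR (N * z ord0 ord0)) z
      (expR (N * z ord0 ord0) * (N * 1)).
    have H1 : is_pd ord0 (fun z : E => N * z ord0 ord0) z (N * 1).
      by have := is_pdZ (a := N) (is_pd_coord0 (i := ord0) z); rewrite eqxx.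
    exact: (is_pd_comp (is_derive_expR (N * z ord0 ord0)) H1).
  have e2 : is_pd ord0 phi z (dphi z).
    apply: is_pd_sum => k _; have H := dh (i := ord0) (j := k) Dz oz; exact: (is_pdM H H).
  exact: (is_pdM e2 e1).
have psi_c z : D z -> oh z -> hcont psi z.
  move=> Dz oz; apply: hcontM; first by apply: hcont_sum => k _; apply: hcontM; exact: ch.
  have cN : hcont (fun z : E => N * z ord0 ord0) z.
    by apply: hcontM; [exact: cvg_cst|exact: hcont_coord].
  exact: (cvg_comp _ _ cN (@continuous_expR R (N * z ord0 ord0))).
pose s := r / 2 - y ord0 ord0; have s0 : 0 < s by rewrite subr_gt0.
have yt (t : R) : 0 <= t <= 1 -> oh (y + (t * s) *: e_ ord0) /\
    forall j, `|(y + (t * s) *: e_ ord0) 0 j - p 0 j| < r.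
  move=> /andP[t0 t1]; split.
    by rewrite /open_half /= moveE eqxx mulr1 ltr_wpDr// mulr_ge0// ltW.
  move=> k; rewrite moveE addrAC; case: eqP => [->|_]; last by rewrite mulr0 addr0.
  rewrite mulr1 (_ : p 0 ord0 = 0) ?subr0; last exact: p0.
  have y0' : 0 < y 0 ord0 := oy.
  have ss : s = r / 2 - y 0 ord0 by [].
  have ts : t * s <= s by rewrite ler_piMl // ltW.
  rewrite ger0_norm; last by rewrite addr_ge0 // ?mulr_ge0 // ltW.
  apply: le_lt_trans r2r; rewrite -lerBrDl -ss; exact: ts.
have ytD t (tI : 0 <= t <= 1) : D (y + (t * s) *: e_ ord0).
  by have [h1 h2] := yt t tI; have [] := box _ (ltW h1) h2.
have [||t tI|t tI|t tI E1] := @mvt_coord R n psi dpsi ord0 y s.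
- exact: ltW.
- by have [|+ _] := yt 1; rewrite ?mul1r ?ler01 ?lexx// => /ltW.
- by have [h1 _] := yt t tI; apply: psi_c => //; exact: ytD.
- have tI' : 0 <= t <= 1 by case/andP: tI => ? ?; rewrite !ltW.
  by have [h1 _] := yt t tI'; apply: psi_pd => //; exact: ytD.
have tI' : 0 <= t <= 1 by case/andP: tI => ? ?; rewrite !ltW.
move: E1; set xi := y + (t * s) *: _ => E1.
have [oxi xip] := yt t tI'; have [Dxi AKxi] := box _ (ltW oxi) xip.
have dpsi0 : 0 <= dpsi xi.
  rewrite /dpsi (_ : _ + _ = (dphi xi + N * phi xi) * expR (N * xi ord0 ord0)); last by ring.
  rewrite mulr_ge0 ?expR_ge0//.
  have := @sum_quad_bound K (fun j k => A ord0 j k xi) (h ^~ xi) K0 AKxi.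
  have -> : dphi xi = 2 * \sum_j \sum_k h j xi * A ord0 j k xi * h k xi.
    rewrite mulr_sumr; apply: eq_bigr => k _.
    under [X in _ = 2 * X]eq_bigr do rewrite -mulrA.
    by rewrite -mulr_sumr; ring.
  rewrite /phi; under [in X in _ <= X]eq_bigr do rewrite expr2.
  set S := \sum_j \sum_k _; set Q := \sum_j _; rewrite ler_norml => /andP[+ _].
  rewrite /N; nra.
have psi_le : psi y <= psi (y + s *: e_ ord0).
  by rewrite -subr_ge0 E1 mulr_ge0// ltW.
have phi_le : phi y <= psi y.
  rewrite /psi ler_peMr//; first by apply: sumr_ge0 => k _; rewrite -expr2 sqr_ge0.
  rewrite -expR0 ler_expR; apply: mulr_ge0; last exact: ltW.
  by rewrite !mulr_ge0.
have psi_B : psi (y + s *: e_ ord0) <= B.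
  rewrite /psi /B mulrC moveE eqxx mulr1 (addrC _ s) subrK ler_wpM2l ?expR_ge0//.
  apply: ler_sum => k _; rewrite -expr2 -real_normK ?num_real// ler_sqr ?nnegrE//.
  have [|h1 _] := yt 1; first by rewrite ler01 lexx.
  rewrite mul1r in h1; apply: hC; first exact: ltW.
  move=> l; rewrite !moveE; case: eqP => [->|_]; last first.
    by rewrite !mulr0 !addr0; apply: (lt_le_trans (yp l)); rewrite ge_min lexx orbT.
  rewrite !mulr1 (_ : p 0 ord0 = 0) ?add0r; last exact: p0.
  by rewrite (addrC _ s) subrK subrr normr0.
have hj : h j y ^+ 2 <= B.
  apply: le_trans psi_B; apply: le_trans psi_le; apply: le_trans phi_le.
  rewrite /phi (bigD1 j)//= -expr2 lerDl; apply: sumr_ge0 => k _.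
  by rewrite -expr2 sqr_ge0.
have := sqr_ge0 (`|h j y| - 1); rewrite -(real_normK (num_real (h j y))) in hj.
have := normr_ge0 (h j y); nra.
Qed.

Lemma linear_limit p : D p -> p ord0 ord0 = 0 -> forall j, cvg (h j @ hnear oh p).
Proof.
move=> Dp p0 j; have hp := Dhalf Dp.
have [C [r1 [C0 r10 H1]]] := linear_bound Dp p0.
have [K [r2 [K0 r20 AK]]] := @hcont_bound_fin _
  (fun ijk : 'I_n.+1 * I * I => A ijk.1.1 ijk.1.2 ijk.2) p hp
  (fun ijk => smooth_hcont oD (sA ijk.1.1 ijk.1.2 ijk.2) Dp).
pose r := Num.min r1 r2; have r0 : 0 < r by rewrite lt_min r10.
pose L := \sum_(k : I) K * C; have L0 : 0 <= L by apply: sumr_ge0 => k _; rewrite mulr_ge0.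
pose Q := [set y : E | oh y /\ forall j, `|y 0 j - p 0 j| < r].
have Qr y : Q y -> [/\ oh y, forall j, `|y 0 j - p 0 j| < r1 & forall j, `|y 0 j - p 0 j| < r2].
  by move=> [oy yp]; split=> // k; apply: (lt_le_trans (yp k)); rewrite ge_min lexx ?orbT.
have QD y : Q y -> D y by move=> /Qr[oy yp _]; have [] := H1 j y oy yp.
have lip (y z : E) : Q y -> Q z -> `|h j z - h j y| <= L * \sum_k `|z 0 k - y 0 k|.
  move=> Qy Qz.
  have [|w [/ltW]//|w Qw|k w Qw|||xi xiQ ->] := @mvt_path R n Q (h j)
      (fun i x => \sum_k A i j k x * h k x) y z.
  - by apply: mixclosed_box; exact: mixclosed_open_half.
  - by apply: ch; [exact: QD|case: Qw].
  - by apply: dh; [exact: QD|case: Qw].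
  - by [].
  - by [].
  apply: (le_trans (ler_norm_sum _ _ _)); rewrite mulr_sumr; apply: ler_sum => i _.
  rewrite normrM ler_wpM2r//; apply: (le_trans (ler_norm_sum _ _ _)).
  apply: ler_sum => k _; have [oxi b1 b2] := Qr _ (xiQ i).
  rewrite normrM ler_pM//; last by have [] := H1 k _ oxi b1.
  by apply: (AK (i, j, k)) => //; exact: ltW.
have pf := hnear_proper hp.
apply/cauchy_cvgP; apply: cauchy_exP => e e0.
(* Two points of the box of radius [d] are at distance at most [2 * d * (n + 1)] in the sum norm,
   which the Lipschitz constant [L] turns into less than [e]. *)
pose d := Num.min r (e / 2 / ((L + 1) * n.+1%:R)) / 2.
have LN : 0 < (L + 1) * n.+1%:R by rewrite mulr_gt0 ?ltr0n// ltr_wpDl.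
have m0 : 0 < Num.min r (e / 2 / ((L + 1) * n.+1%:R)) by rewrite lt_min r0 !divr_gt0.
have d0 : 0 < d by rewrite divr_gt0.
have dm : d < Num.min r (e / 2 / ((L + 1) * n.+1%:R)) by rewrite ltr_pdivrMr// ltr_pMr// ltr1n.
move: dm; rewrite lt_min => /andP[dr de].
pose N := [set y : E | oh y /\ forall j, `|y 0 j - p 0 j| < d].
have NN : hnear oh p N by apply/hnearP; exists d.
have [y0 [oy0 y0p]] := @filter_ex _ _ pf _ NN.
exists (h j y0); apply: filterS NN => y [oy yp]; rewrite /ball /= distrC.
have QQ w : oh w -> (forall j, `|w 0 j - p 0 j| < d) -> Q w.
  by move=> ow wp; split=> // k; exact: lt_trans dr.
apply: (le_lt_trans (lip _ _ (QQ _ oy0 y0p) (QQ _ oy yp))).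
have S1 : \sum_k `|y 0 k - y0 0 k| <= \sum_(k < n.+1) (d + d).
  apply: ler_sum => k _; rewrite -(subrK (p 0 k) (y 0 k)) -addrA.
  apply: (le_trans (ler_normD _ _)); apply: lerD; first exact: ltW.
  by rewrite distrC; exact: ltW.
have S2 : \sum_(k < n.+1) (d + d) = (d + d) * n.+1%:R.
  by rewrite sumr_const card_ord mulr_natr.
rewrite S2 in S1; apply: (@le_lt_trans _ _ (L * ((d + d) * n.+1%:R))).
  by rewrite ler_wpM2l.
move: de; rewrite ltr_pdivlMr// => de.
have : L * ((d + d) * n.+1%:R) <= 2 * (d * ((L + 1) * n.+1%:R)).
  have : 0 <= d * n.+1%:R by rewrite mulr_ge0// ltW.
  move=> ?; nra.
by move=> /le_lt_trans; apply; lra.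
Qed.

Lemma linear_extension : exists F : I -> E -> R,
  [/\ forall j, smooth D (F j), forall j x, D x -> oh x -> F j x = h j x
    & forall i j x, D x -> is_pd i (F j) x (\sum_k A i j k x * F k x)].
Proof.
pose F j (x : E) := if x ord0 ord0 == 0 then lim (h j @ hnear oh x) else h j x.
have Fh j x : D x -> oh x -> F j x = h j x by move=> _ ox; rewrite /F gt_eqF.
have cF j x : D x -> hcont (F j) x.
  apply: (hcont_by_limits oD (f := h j)) => [y Dy oy|y Dy oy|y Dy ny].
  - exact: ch.
  - exact: Fh.
  - have y0 : y ord0 ord0 = 0.
      apply/eqP; case: eqP => // /eqP yn; exfalso; apply: ny.
      by rewrite /open_half /= lt_def yn; exact: Dhalf.
    by rewrite /F y0 eqxx; exact: linear_limit.
have dF i j x : D x -> is_pd i (F j) x (\sum_k A i j k x * F k x).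
  move=> Dx.
  apply: (is_pd_boundary (g := fun i x => \sum_k A i j k x * F k x) oD (cF j)) Dx.
    move=> k y Dy; apply: hcont_sum => l _; apply: hcontM; last exact: cF.
    exact: (smooth_hcont oD (sA k j l) Dy).
  move=> k y Dy oy.
  have := dh (i := k) (j := j) Dy oy; rewrite (eq_bigr (fun l => A k j l y * F l y)); last first.
    by move=> l _; rewrite Fh.
  apply: hnear_eq_is_pd; first exact: Dhalf.
  apply: (hopen_near (hopenI_open_half oD)) => [|z [Dz oz]]; first by split.
  by rewrite Fh.
exists F; split=> // j k; elim: k j => [|k IH] j; first by apply: Ck0 => // x; exact: cF.
apply: (CkS (g := fun i x => \sum_k A i j k x * F k x)) => // [x|i x|i].
- exact: cF.
- exact: dF.
- by apply: Ck_sum => // l _; apply: Ck_M => //; exact: sA.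
Qed.

End LinearExtension.

(** * Calculus in charts *)

Section ChartCalculus.
Context {R : realType} {n : nat} {M : manifold R n}.
Local Notation E := 'rV[R]_n.+1.
Local Notation half := (@halfspace R n).
Local Notation oh := (@open_half R n).
Local Notation e_ i := (delta_mx 0 i : E).
Implicit Types (c : chart M) (V : set M) (f g : M -> R).

Definition chart_image c V : set E := coord c @` (V `&` dom c).

Lemma coord_half c (x : M) : dom c x -> half (coord c x).
Proof.
move=> cx; have [W _ cO] := coord_range c.
have : (coord c @` dom c) (coord c x) by exists x.
by rewrite cO => -[].
Qed.

Lemma hopen_chart c V : open V -> hopen (chart_image c V).
Proof.
move=> oV; split=> [_ [x [_ cx] <-]|_ [x [Vx cx] <-]]; first exact: coord_half.
have [W oO cO] := coord_range c.
have cdx : (coord c @` dom c) (coord c x) by exists x.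
have Ox : W (coord c x) by move: cdx; rewrite cO => -[].
have /subspace_continuousP/(_ _ cdx) := @param_continuous R n M c.
move=> pc; have pV : nbhs (param c (coord c x)) V.
  by rewrite coordK//; exact: open_nbhs_nbhs.
have N1 : nbhs (coord c x) [set y | (coord c @` dom c) y -> V (param c y)] := pc _ pV.
have N2 : nbhs (coord c x) W by exact: open_nbhs_nbhs.
apply: filterS2 N1 N2 => y H Oy hy.
have [z cz zy] : (coord c @` dom c) y by rewrite cO.
exists z => //; split=> //.
have := H _; rewrite -{2}zy coordK//; apply; rewrite -zy; by exists z.
Qed.

Lemma chart_imageP c V (x : M) : V x -> dom c x -> chart_image c V (coord c x).
Proof. by move=> Vx cx; exists x. Qed.

Lemma param_chart_image c V v : chart_image c V v ->
  [/\ V (param c v), dom c (param c v) & coord c (param c v) = v].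
Proof. by move=> [x [Vx cx] <-]; rewrite coordK. Qed.

Lemma coord_cvg c (x : M) : dom c x -> coord c @ nbhs x --> hnear half (coord c x).
Proof.
move=> cx; have dn : nbhs x (dom c) by apply: open_nbhs_nbhs; split=> //; exact: dom_open.
have /subspace_continuousP/(_ _ cx) := @coord_continuous R n M c.
move=> H P PP.
have HP : nbhs x [set y | dom c y -> half (coord c y) -> P (coord c y)] := H _ PP.
suff : nbhs x [set y | P (coord c y)] by [].
apply: filterS2 HP dn => y H1 cy; apply: H1 => //; exact: coord_half.
Qed.

Lemma smooth_in_cont c V f (x : M) : open V -> smooth_in c V f -> V x -> dom c x ->
  f @ nbhs x --> f x.
Proof.
move=> oV sf Vx cx.
have := smooth_hcont (hopen_chart c oV) sf (chart_imageP Vx cx) => Hf.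
have := cvg_comp _ _ (coord_cvg cx) Hf; rewrite /= coordK//.
apply: cvg_near_eq.
have dn : nbhs x (dom c) by apply: open_nbhs_nbhs; split=> //; exact: dom_open.
by apply: filterS dn => y cy; rewrite /= coordK.
Qed.

Section Fixed.
Variables (c : chart M) (V : set M).
Hypothesis oV : open V.
Let oD := hopen_chart c oV.

Lemma smooth_in_is_pd i f x : smooth_in c V f -> V x -> dom c x ->
  is_pd i (f \o param c) (coord c x) (pd c i f x).
Proof. by move=> sf Vx cx; exact: (smooth_is_pd (i := i) sf (chart_imageP Vx cx)). Qed.

Lemma pd_is_pd i f x l : dom c x -> is_pd i (f \o param c) (coord c x) l -> pd c i f x = l.
Proof. by move=> cx fl; exact: (is_pd_pderiv (coord_half cx) fl). Qed.

Lemma smooth_in_eq f g : (forall x, V x -> dom c x -> f x = g x) ->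
  smooth_in c V f -> smooth_in c V g.
Proof.
move=> fg; apply: (smooth_eq oD) => v /param_chart_image[Vv cv _] /=.
exact: fg.
Qed.

Lemma pd_eq i f g x : (forall y, V y -> dom c y -> f y = g y) -> V x -> dom c x ->
  pd c i f x = pd c i g x.
Proof.
move=> fg Vx cx; apply: hnear_eq_pderiv; first exact: coord_half.
apply: (hopen_near oD (chart_imageP Vx cx)) => v /param_chart_image[Vv cv _] /=.
exact: fg.
Qed.

Lemma smooth_in_pd i f : smooth_in c V f -> smooth_in c V (pd c i f).
Proof.
move=> sf; apply: smooth_eq (smooth_pderiv i sf) => // v /param_chart_image[_ _ cv].
by rewrite /= /pd cv.
Qed.

Lemma smooth_in_cst (a : R) : smooth_in c V (fun=> a).
Proof. exact: (smooth_cst a oD). Qed.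

Lemma pd_cst i (a : R) x : dom c x -> pd c i (fun=> a) x = 0.
Proof. by move=> cx; apply: pd_is_pd => //; exact: is_pd_cst. Qed.

Lemma smooth_inD f g : smooth_in c V f -> smooth_in c V g ->
  smooth_in c V (fun x => f x + g x).
Proof. exact: (smoothD oD). Qed.

Lemma smooth_inM f g : smooth_in c V f -> smooth_in c V g ->
  smooth_in c V (fun x => f x * g x).
Proof. exact: (smoothM oD). Qed.

Lemma smooth_inZ a f : smooth_in c V f -> smooth_in c V (fun x => a * f x).
Proof. by move=> sf; apply: smooth_inM => //; exact: smooth_in_cst. Qed.

Lemma smooth_inN f : smooth_in c V f -> smooth_in c V (fun x => - f x).
Proof. by move=> /(smooth_inZ (-1)); apply: smooth_in_eq => x _ _; rewrite mulN1r. Qed.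

Lemma smooth_inB f g : smooth_in c V f -> smooth_in c V g ->
  smooth_in c V (fun x => f x - g x).
Proof. by move=> sf sg; apply: smooth_inD => //; exact: smooth_inN. Qed.

Lemma smooth_inV f : (forall x, V x -> dom c x -> f x != 0) -> smooth_in c V f ->
  smooth_in c V (fun x => (f x)^-1).
Proof.
move=> f0; apply: (smoothV oD) => v /param_chart_image[Vv cv _] /=; exact: f0.
Qed.

Lemma smooth_in_powR (a : R) f : (forall x, V x -> dom c x -> 0 < f x) ->
  smooth_in c V f -> smooth_in c V (fun x => f x `^ a).
Proof.
move=> f0; apply: (@smooth_powR R n _ (f \o param c) a oD) => v /param_chart_image[Vv cv _] /=; exact: f0.
Qed.

Lemma smooth_in_sum (I : Type) (r : seq I) (P : pred I) (F : I -> M -> R) :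
  (forall i, P i -> smooth_in c V (F i)) ->
  smooth_in c V (fun x => \sum_(i <- r | P i) F i x).
Proof. move=> sF k.
apply: (@Ck_sum R n _ k I r P (fun i => F i \o param c) oD) => i Pi; exact: sF. Qed.

Lemma smooth_in_prod (I : Type) (r : seq I) (P : pred I) (F : I -> M -> R) :
  (forall i, P i -> smooth_in c V (F i)) ->
  smooth_in c V (fun x => \prod_(i <- r | P i) F i x).
Proof.
move=> sF; elim: r => [|i r IH].
  by apply: (@smooth_in_eq (fun=> 1)) (smooth_in_cst 1) => x _ _; rewrite big_nil.
apply: (@smooth_in_eq (if P i then fun x => F i x * \prod_(j <- r | P j) F j x
  else fun x => \prod_(j <- r | P j) F j x)).
  by move=> x _ _; rewrite big_cons; case: ifP.
by case: ifP => // Pi; apply: smooth_inM => //; exact: sF.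
Qed.

Lemma smooth_inX k f : smooth_in c V f -> smooth_in c V (fun x => f x ^+ k).
Proof.
move=> sf; have := @smooth_in_prod _ (index_enum 'I_k) xpredT (fun=> f) (fun _ _ => sf).
by apply: smooth_in_eq => x _ _; rewrite prodr_const card_ord.
Qed.

Section Derivatives.
Variables (i : 'I_n.+1) (x : M).
Hypotheses (Vx : V x) (cx : dom c x).

Lemma pdD f g : smooth_in c V f -> smooth_in c V g ->
  pd c i (fun y => f y + g y) x = pd c i f x + pd c i g x.
Proof.
move=> sf sg; apply: pd_is_pd => //.
exact: (is_pdD (smooth_in_is_pd (i := i) sf Vx cx) (smooth_in_is_pd (i := i) sg Vx cx)).
Qed.

Lemma pdM f g : smooth_in c V f -> smooth_in c V g ->
  pd c i (fun y => f y * g y) x = pd c i f x * g x + f x * pd c i g x.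
Proof.
move=> sf sg; apply: pd_is_pd => //.
have := is_pdM (smooth_in_is_pd (i := i) sf Vx cx) (smooth_in_is_pd (i := i) sg Vx cx).
by rewrite /= coordK.
Qed.

Lemma pdZ a f : smooth_in c V f -> pd c i (fun y => a * f y) x = a * pd c i f x.
Proof.
move=> sf; apply: pd_is_pd => //.
exact: (is_pdZ (a := a) (smooth_in_is_pd (i := i) sf Vx cx)).
Qed.

Lemma pdV f : smooth_in c V f -> f x != 0 ->
  pd c i (fun y => (f y)^-1) x = - (f x) ^- 2 * pd c i f x.
Proof.
move=> sf f0; apply: pd_is_pd => //.
have := @is_pdV R n i (f \o param c) (coord c x) (pd c i f x).
rewrite /= coordK//; apply => //; exact: (smooth_in_is_pd (i := i) sf Vx cx).
Qed.

Lemma pd_powR a f : smooth_in c V f -> 0 < f x ->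
  pd c i (fun y => f y `^ a) x = a * f x `^ (a - 1) * pd c i f x.
Proof.
move=> sf f0; apply: pd_is_pd => //.
have := @is_pd_powR R n i (f \o param c) (coord c x) (pd c i f x) a.
rewrite /= coordK//; apply => //; exact: (smooth_in_is_pd (i := i) sf Vx cx).
Qed.

Lemma pd_sum (I : Type) (r : seq I) (P : pred I) (F : I -> M -> R) :
  (forall k, P k -> smooth_in c V (F k)) ->
  pd c i (fun y => \sum_(k <- r | P k) F k y) x = \sum_(k <- r | P k) pd c i (F k) x.
Proof.
move=> sF; apply: pd_is_pd => //.
apply: (@is_pd_sum R n i I r P (fun k => F k \o param c)) => k Pk.
exact: (smooth_in_is_pd (i := i) (sF k Pk) Vx cx).
Qed.

Lemma pd_schwarz j f : smooth_in c V f -> pd c i (pd c j f) x = pd c j (pd c i f) x.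
Proof.
move=> sf; have cvx := chart_imageP Vx cx.
have := smooth_schwarz j i oD sf cvx.
rewrite (@hnear_eq_pderiv _ _ i _ (pd c j f \o param c)); last first.
- apply: (hopen_near oD cvx) => v /param_chart_image[_ _ cv].
  by rewrite /= /pd cv.
- exact: coord_half.
rewrite (@hnear_eq_pderiv _ _ j _ (pd c i f \o param c))//.
  exact: coord_half.
apply: (hopen_near oD cvx) => v /param_chart_image[_ _ cv].
by rewrite /= /pd cv.
Qed.

End Derivatives.
End Fixed.

Lemma smooth_in_sub c V V' f : open V -> open V' -> V' `&` dom c `<=` V ->
  smooth_in c V f -> smooth_in c V' f.
Proof.
move=> oV oV' VV; apply: smooth_sub; [exact: hopen_chart|exact: hopen_chart|].
by move=> _ [x [V'x cx] <-]; exists x => //; split=> //; exact: VV.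
Qed.

Lemma smooth_in_local c V f : open V ->
  (forall x, V x -> dom c x -> exists V', [/\ open V', V' x & smooth_in c V' f]) ->
  smooth_in c V f.
Proof.
move=> oV H; apply: smooth_local; first exact: hopen_chart.
move=> _ [x [Vx cx] <-]; have [V' [oV' V'x sf]] := H x Vx cx.
by exists (chart_image c V'); split=> //; [exact: hopen_chart|exact: chart_imageP].
Qed.

(** The chain rule through [sdiff] holds at boundary points too, where the transition map may have
    only one-sided derivatives. *)
Lemma pd_chain c c' V f a x : open V -> smooth_in c' V f -> V x -> dom c x -> dom c' x ->
  pd c a f x = \sum_b pd c' b f x * jacobian c c' x b a.
Proof.
move=> oV sf Vx cx c'x; apply: pd_is_pd => //.
pose phi v := coord c' (param c v).
have oD := hopen_chart c (dom_open c').
have xD := chart_imageP c'x cx.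
have px : phi (coord c x) = coord c' x by rewrite /phi coordK.
have sd := smooth_sdiff (hopen_chart c' oV) sf (chart_imageP Vx c'x).
rewrite -px in sd.
have hphi : \forall v \near hnear half (coord c x), half (phi v).
  apply: (hopen_near oD xD) => v /param_chart_image[c'v _ _]; exact: coord_half.
have dphi b : is_pd a (fun v => phi v 0 b) (coord c x) (jacobian c c' x b a).
  have := smooth_is_pd (i := a) (transition_smooth c c' b) xD.
  by rewrite mxE.
have := is_pd_chain (coord_half cx) hphi sd dphi; rewrite px.
apply: hnear_eq_is_pd; first exact: coord_half.
apply: (hopen_near oD xD) => v /param_chart_image[c'v _ _] /=.
by rewrite /phi coordK.
Qed.

Lemma differential_chain c c' V f x : open V -> smooth_in c' V f -> V x -> dom c x -> dom c' x ->
  differential c f x = differential c' f x *m jacobian c c' x.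
Proof.
move=> oV sf Vx cx c'x; apply/rowP => a; rewrite !mxE (pd_chain a oV sf Vx cx c'x).
apply: eq_bigr => b _.
by rewrite [in RHS]mxE.
Qed.

Lemma smooth_in_coord c c' b : smooth_in c (dom c') (fun y => coord c' y 0 b).
Proof. exact: transition_smooth. Qed.

Lemma smooth_in_jacobian c c' a b : smooth_in c (dom c') (fun x => jacobian c c' x b a).
Proof.
have oc := @dom_open R n M c'.
apply: (smooth_in_eq oc) (smooth_in_pd oc a (@smooth_in_coord c c' b)) => x _ _.
by rewrite mxE.
Qed.

(** The chain rule for the coordinate functions of [c], which read as the identity in [c] itself. *)
Lemma jacobian_mul c c' x : dom c x -> dom c' x ->
  jacobian c' c x *m jacobian c c' x = 1%:M.
Proof.
move=> cx c'x; apply/matrixP => b a; rewrite !mxE.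
have := pd_chain a (dom_open c) (@smooth_in_coord c' c b) cx cx c'x.
rewrite (_ : pd c a _ x = (b == a)%:R).
  by move=> ->; apply: eq_bigr => k _; rewrite !mxE.
apply: pd_is_pd => //; apply: (hnear_eq_is_pd _ _ (is_pd_coord (i := a) (j := b) (coord c x))).
  exact: coord_half.
apply: (hopen_near (hopen_chart c (dom_open c)) (chart_imageP cx cx)) => v.
by move=> /param_chart_image[_ _ /= ->].
Qed.

Lemma jacobian_unit c c' x : dom c x -> dom c' x -> jacobian c c' x \in unitmx.
Proof. by move=> cx c'x; have /mulmx1_unit[] := jacobian_mul cx c'x. Qed.

Section Boundary.
(** [boundary] refers to a single chart. That the other charts agree is assumed in this part and
    later deduced from the existence of defining functions. *)
Hypothesis boundary_coord : forall c (x : M), boundary x -> dom c x -> coord c x ord0 ord0 = 0.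

Lemma inner_coord c x : inner x -> dom c x -> oh (coord c x).
Proof.
move=> ix cx; rewrite /open_half /= lt_def; apply/andP; split; last exact: coord_half.
by apply/eqP => x0; apply: ix; exists c.
Qed.

Lemma oh_inner c x : dom c x -> oh (coord c x) -> inner x.
Proof.
by move=> cx; rewrite /open_half /= => + bx; rewrite (boundary_coord bx cx) ltxx.
Qed.

Lemma open_inner : open (@inner R n M).
Proof.
rewrite openE => x ix; have [c cx] := dom_cover x.
have dn : nbhs x (dom c) by apply: open_nbhs_nbhs; split=> //; exact: dom_open.
have N : hnear half (coord c x) oh.
  apply/hnearP; exists (coord c x ord0 ord0); first exact: inner_coord.
  move=> y _ /(_ ord0); rewrite ltr_norml => /andP[+ _].
  by rewrite ltrBrDl subrr.
have N' : nbhs x [set y | oh (coord c y)] := coord_cvg cx N.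
apply: filterS2 dn N' => y cy oy; exact: (oh_inner cy oy).
Qed.

Lemma open_innerI V : open V -> open (V `&` @inner R n M).
Proof. by move=> oV; apply: openI => //; exact: open_inner. Qed.

(** Density of the interior, in the form needed for uniqueness of limits. *)
Lemma inner_proper (x : M) : ProperFilter (within (@inner R n M) (nbhs x)).
Proof.
apply: Build_ProperFilter_ex => P PP; have [c cx] := dom_cover x.
have : nbhs x [set y | inner y -> P y] := PP.
rewrite nbhsE => -[W [oW Wx] WP].
have [_ Wn] := hopen_chart c oW.
have := Wn _ (chart_imageP Wx cx) => NW.
have [v [ov /param_chart_image[Wv cv vE]]] : exists v, oh v /\ chart_image c W v.
  apply: (@filter_ex _ _ (hnear_proper (coord_half cx))).
  move/hnearP : NW => [e e0 H]; apply/hnearP; exists e => // y oy yx; split=> //.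
  by apply: H => //; exact: ltW.
exists (param c v); apply: WP => //; apply: (oh_inner cv).
by rewrite vE.
Qed.

(** The density principle by which symmetry, transition laws and parallelism are carried from the
    interior to the boundary. *)
Lemma inner_lim f g (x : M) : f @ nbhs x --> f x -> g @ nbhs x --> g x ->
  (\forall y \near x, inner y -> f y = g y) -> f x = g x.
Proof.
move=> cf cg fg; have PF := inner_proper x.
have cf' : f @ within (@inner R n M) (nbhs x) --> f x by exact: cvg_within_filter.
have cg' : g @ within (@inner R n M) (nbhs x) --> g x by exact: cvg_within_filter.
apply: (@cvg_unique _ (@Rhausdorff R) _ _ _ _ cf').
apply: cvg_near_eq cg'.
by apply: filterS fg => y H iy; rewrite H.
Qed.

Lemma smooth_in_lim c V f g x : open V -> smooth_in c V f -> smooth_in c V g ->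
  (forall y, V y -> inner y -> dom c y -> f y = g y) -> V x -> dom c x -> f x = g x.
Proof.
move=> oV sf sg fg Vx cx; apply: inner_lim;
  [exact: (smooth_in_cont oV sf Vx cx)|exact: (smooth_in_cont oV sg Vx cx)|].
have N1 : nbhs x V by exact: open_nbhs_nbhs.
have N2 : nbhs x (dom c) by apply: open_nbhs_nbhs; split=> //; exact: dom_open.
by apply: filterS2 N1 N2 => y Vy cy iy; exact: fg.
Qed.

(** The glued function is defined on the boundary as a limit from inside. Every local extension has
    these same limits, so no compatibility between them has to be checked. *)
Lemma smooth_in_glue c V f : open V ->
  (forall x, V x -> boundary x -> dom c x -> exists V' F,
    [/\ open V', V' x, smooth_in c V' F &
        forall y, V' y -> V y -> inner y -> dom c y -> F y = f y]) ->
  smooth_in c (V `&` @inner R n M) f ->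
  exists2 F, smooth_in c V F & forall y, V y -> inner y -> dom c y -> F y = f y.
Proof.
move=> oV H sf.
pose F (x : M) := if x \in @inner R n M then f x else lim (f @ within (@inner R n M) (nbhs x)).
have Ff y : inner y -> F y = f y by move=> iy; rewrite /F mem_set.
exists F; last by move=> y _ iy _; exact: Ff.
apply: smooth_in_local => // x Vx cx.
have [ix|/contrapT bx] := pselect (inner x).
  exists (V `&` @inner R n M); split=> //; first exact: open_innerI.
  by apply: smooth_in_eq sf; [exact: open_innerI|move=> y [_ iy] _; rewrite Ff].
have [V' [F' [oV' V'x sF' F'f]]] := H x Vx bx cx.
have oVV : open (V `&` V') by exact: openI.
exists (V `&` V'); split=> //.
have sF : smooth_in c (V `&` V') F' by apply: smooth_in_sub sF' => // y [[]].
apply: (smooth_in_eq oVV _ sF) => y [Vy V'y] cy.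
have [iy|niy] := pselect (inner y); first by rewrite Ff ?F'f.
have PF := inner_proper y.
rewrite /F memNset//; apply/esym; apply: cvg_lim => //.
have cF' : F' @ within (@inner R n M) (nbhs y) --> F' y.
  by apply: cvg_within_filter; exact: (smooth_in_cont oVV sF (conj Vy V'y) cy).
apply: cvg_near_eq cF'.
have N1 : nbhs y (V `&` V') by exact: open_nbhs_nbhs.
have N2 : nbhs y (dom c) by apply: open_nbhs_nbhs; split=> //; exact: dom_open.
by apply: filterS2 N1 N2 => z [Vz V'z] cz iz; exact: F'f.
Qed.

Lemma chart_image_inner c V :
  chart_image c (V `&` @inner R n M) = chart_image c V `&` oh.
Proof.
apply/seteqP; split=> [_ [x [[Vx ix] cx] <-]|_ [[x [Vx cx] <-] ox]].
  by split; [exact: chart_imageP|exact: inner_coord].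
by exists x => //; split=> //; split=> //; exact: oh_inner ox.
Qed.

Lemma smooth_in_linear_extension (I : finType) c V (A : 'I_n.+1 -> I -> I -> M -> R)
    (h : I -> M -> R) : open V ->
  (forall i j k, smooth_in c V (A i j k)) ->
  (forall j, smooth_in c (V `&` @inner R n M) (h j)) ->
  (forall i j x, V x -> inner x -> dom c x -> pd c i (h j) x = \sum_k A i j k x * h k x) ->
  exists F : I -> M -> R,
  [/\ forall j, smooth_in c V (F j), forall j x, V x -> inner x -> dom c x -> F j x = h j x
    & forall i j x, V x -> dom c x -> pd c i (F j) x = \sum_k A i j k x * F k x].
Proof.
move=> oV sA sh dh; have oD := hopen_chart c oV; have oVi := open_innerI oV.
have [|j v Dv ov|i j v Dv ov|F [sF Fh dF]] := @linear_extension R n I (chart_image c V)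
   (fun i j k => A i j k \o param c) (fun j => h j \o param c) oD.
- exact: sA.
- have := smooth_hcont (hopen_chart c oVi) (sh j); apply.
  by rewrite -/(chart_image _ _) chart_image_inner.
- have [Vv cv vE] := param_chart_image Dv.
  have iv : inner (param c v) by apply: (oh_inner cv); rewrite vE.
  have := smooth_in_is_pd (i := i) (sh j) (conj Vv iv) cv.
  by rewrite dh// vE.
exists (fun j => F j \o coord c); split=> [j|j x Vx ix cx|i j x Vx cx].
- apply: smooth_eq (sF j) => // v /param_chart_image[_ _ /= ->] //.
- rewrite /= Fh ?coordK//; [by rewrite /= coordK|exact: chart_imageP|exact: inner_coord].
- have Dx := chart_imageP Vx cx; apply: pd_is_pd => //.
  have := dF i j _ Dx; rewrite /= coordK//.
  apply: hnear_eq_is_pd; first exact: coord_half.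
  by apply: (hopen_near oD Dx) => v /param_chart_image[_ _ /= ->].
Qed.

(** Both functions are divisible by the boundary coordinate. The cofactor [b] of [rho] has no zero:
    off the face because [rho] has none, on the face because it equals the normal derivative of
    [rho], the only component of the differential that can be nonzero there. *)
Lemma smooth_in_quotient c V f rho : open V -> smooth_in c V f -> smooth_in c V rho ->
  (forall x, V x -> boundary x -> dom c x -> f x = 0) ->
  (forall x, V x -> boundary x -> dom c x -> rho x = 0) ->
  (forall x, V x -> inner x -> dom c x -> rho x != 0) ->
  (forall x, V x -> boundary x -> dom c x -> differential c rho x != 0) ->
  exists2 u, smooth_in c V u & forall x, V x -> dom c x -> f x = u x * rho x.
Proof.
move=> oV sf sr f0 r0 rn dr; have oD := hopen_chart c oV.
have bd v : chart_image c V v -> v ord0 ord0 = 0 -> boundary (param c v).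
  by move=> /param_chart_image[_ cv vE] v0; exists c => //; rewrite vE.
have ind v : chart_image c V v -> v ord0 ord0 != 0 -> inner (param c v).
  move=> /param_chart_image[_ cv vE] v0 bv; move/eqP : v0; apply.
  by rewrite -vE; exact: boundary_coord.
have [|a sa [fa _]] := @hadamard R n _ oD _ sf.
  by move=> v Dv v0 /=; have [Vv cv _] := param_chart_image Dv; apply: f0 => //; exact: bd.
have [|b sb [rb rb0]] := @hadamard R n _ oD _ sr.
  by move=> v Dv v0 /=; have [Vv cv _] := param_chart_image Dv; apply: r0 => //; exact: bd.
have b0 v : chart_image c V v -> b v != 0.
  move=> Dv; have [Vv cv vE] := param_chart_image Dv.
  have [v0|v0] := eqVneq (v ord0 ord0) 0; last first.
    have := rn _ Vv (ind v Dv v0) cv; apply: contra => /eqP bv.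
    by have := rb v Dv; rewrite /= => ->; rewrite bv mulr0.
  rewrite rb0//; have bv := bd v Dv v0.
  have := dr _ Vv bv cv; apply: contra => /eqP p0; apply/eqP/rowP => i; rewrite !mxE.
  have [->|i0] := eqVneq i ord0; first by rewrite /pd vE.
  apply: (is_pd_tangential (f := rho \o param c) (i := i) (coord_half cv) _ i0).
  - by rewrite vE.
  - rewrite vE; apply: (hopen_near oD Dv) => w Dw w0 /=.
    by have [Vw cw _] := param_chart_image Dw; apply: r0 => //; exact: bd.
  - exact: (smooth_in_is_pd (i := i) sr Vv cv).
exists (fun x => a (coord c x) * (b (coord c x))^-1).
  have := smoothM oD sa (smoothV oD b0 sb); apply: smooth_eq => // v.
  by move=> /param_chart_image[_ _ /= ->].
move=> x Vx cx; have Dx := chart_imageP Vx cx.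
have := fa _ Dx; have := rb _ Dx; rewrite /= coordK// => -> ->.
have := b0 _ Dx; move: (b _) => bb bb0.
by field.
Qed.

End Boundary.
End ChartCalculus.

(** * Matrix-valued functions and projective changes *)

Lemma sum_delta {R : pzRingType} {I : finType} (F : I -> R) (d : I) :
  \sum_a F a * (a == d)%:R = F d.
Proof.
rewrite (bigD1 d)//= eqxx mulr1 big1 ?addr0// => a /negbTE ->.
by rewrite mulr0.
Qed.

Lemma sum_delta_sym {R : pzRingType} {I : finType} (F : I -> R) (d : I) :
  \sum_a F a * (d == a)%:R = F d.
Proof. by under eq_bigr do rewrite eq_sym; exact: sum_delta. Qed.

Section MatrixCalculus.
Context {R : realType} {n : nat} {M : manifold R n}.
Variables (c : chart M) (V : set M).
Hypothesis oV : open V.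

Definition smooth_mx p q (F : M -> 'M[R]_(p, q)) : Prop :=
  forall i j, smooth_in c V (fun x => F x i j).

Definition pd_mx p q (a : 'I_n.+1) (F : M -> 'M[R]_(p, q)) (x : M) : 'M[R]_(p, q) :=
  \matrix_(i, j) pd c a (fun y => F y i j) x.

Lemma smooth_mx_eq p q (F G : M -> 'M[R]_(p, q)) :
  (forall x, V x -> dom c x -> F x = G x) -> smooth_mx F -> smooth_mx G.
Proof. by move=> FG sF i j; apply: smooth_in_eq (sF i j) => // x Vx cx; rewrite FG. Qed.

Lemma pd_mx_eq p q a (F G : M -> 'M[R]_(p, q)) x :
  (forall x, V x -> dom c x -> F x = G x) -> V x -> dom c x -> pd_mx a F x = pd_mx a G x.
Proof.
move=> FG Vx cx; apply/matrixP => i j; rewrite !mxE.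
by apply: (pd_eq oV) => // y Vy cy; rewrite FG.
Qed.

Lemma smooth_mx_const p q (A : 'M[R]_(p, q)) : smooth_mx (fun=> A).
Proof. by move=> i j; exact: smooth_in_cst. Qed.

Lemma pd_mx_const p q a (A : 'M[R]_(p, q)) x : dom c x -> pd_mx a (fun=> A) x = 0.
Proof. by move=> cx; apply/matrixP => i j; rewrite !mxE pd_cst. Qed.

Lemma smooth_mx_pd p q a (F : M -> 'M[R]_(p, q)) : smooth_mx F -> smooth_mx (pd_mx a F).
Proof.
move=> sF i j; apply: smooth_in_eq (smooth_in_pd oV a (sF i j)) => // x _ _.
by rewrite mxE.
Qed.

Lemma smooth_mxD p q (F G : M -> 'M[R]_(p, q)) : smooth_mx F -> smooth_mx G ->
  smooth_mx (fun x => F x + G x).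
Proof.
move=> sF sG i j; apply: smooth_in_eq (smooth_inD oV (sF i j) (sG i j)) => // x _ _.
by rewrite mxE.
Qed.

Lemma smooth_mxN p q (F : M -> 'M[R]_(p, q)) : smooth_mx F -> smooth_mx (fun x => - F x).
Proof.
move=> sF i j; apply: smooth_in_eq (smooth_inN oV (sF i j)) => // x _ _.
by rewrite mxE.
Qed.

Lemma smooth_mxZ p q (f : M -> R) (F : M -> 'M[R]_(p, q)) : smooth_in c V f ->
  smooth_mx F -> smooth_mx (fun x => f x *: F x).
Proof.
move=> sf sF i j; apply: smooth_in_eq (smooth_inM oV sf (sF i j)) => // x _ _.
by rewrite mxE.
Qed.

Lemma smooth_mxM p q r (F : M -> 'M[R]_(p, q)) (G : M -> 'M[R]_(q, r)) :
  smooth_mx F -> smooth_mx G -> smooth_mx (fun x => F x *m G x).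
Proof.
move=> sF sG i j.
have := @smooth_in_sum _ _ _ c V oV _ (index_enum 'I_q) xpredT (fun k x => F x i k * G x k j).
move=> /(_ (fun k _ => smooth_inM oV (sF i k) (sG k j))).
by apply: smooth_in_eq => // x _ _; rewrite mxE.
Qed.

Lemma smooth_mxT p q (F : M -> 'M[R]_(p, q)) : smooth_mx F -> smooth_mx (fun x => (F x)^T).
Proof. by move=> sF i j; apply: smooth_in_eq (sF j i) => // x _ _; rewrite mxE. Qed.

Lemma smooth_mx_scalar p (f : M -> R) : smooth_in c V f -> smooth_mx (fun x => (f x)%:M : 'M[R]_p).
Proof.
move=> sf i j.
apply: smooth_in_eq (smooth_inM oV sf (smooth_in_cst c oV (i == j)%:R)) => // x _ _.
by rewrite mxE mulr_natr.
Qed.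

Lemma smooth_mx_block p1 p2 q1 q2 (A : M -> 'M[R]_(p1, q1)) (B : M -> 'M[R]_(p1, q2))
    (C : M -> 'M[R]_(p2, q1)) (D : M -> 'M[R]_(p2, q2)) :
  smooth_mx A -> smooth_mx B -> smooth_mx C -> smooth_mx D ->
  smooth_mx (fun x => block_mx (A x) (B x) (C x) (D x)).
Proof.
move=> sA sB sC sD i j.
case: (split_ordP i) => i' ->; case: (split_ordP j) => j' ->.
- by apply: smooth_in_eq (sA i' j') => // x _ _; rewrite block_mxEul.
- by apply: smooth_in_eq (sB i' j') => // x _ _; rewrite block_mxEur.
- by apply: smooth_in_eq (sC i' j') => // x _ _; rewrite block_mxEdl.
- by apply: smooth_in_eq (sD i' j') => // x _ _; rewrite block_mxEdr.
Qed.

Lemma smooth_in_det p (F : M -> 'M[R]_p) : smooth_mx F -> smooth_in c V (fun x => \det (F x)).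
Proof.
move=> sF; apply: smooth_in_sum => // s _.
apply: smooth_inZ => //; apply: smooth_in_prod => // i _; exact: sF.
Qed.

Lemma smooth_mx_inv p (F : M -> 'M[R]_p) : smooth_mx F ->
  (forall x, V x -> dom c x -> F x \in unitmx) -> smooth_mx (fun x => invmx (F x)).
Proof.
move=> sF uF i j.
have sd : smooth_in c V (fun x => (\det (F x))^-1).
  apply: smooth_inV => //; last exact: smooth_in_det.
  by move=> x Vx cx; have := uF x Vx cx; rewrite unitmxE unitfE.
have sc : smooth_in c V (fun x => cofactor (F x) j i).
  apply: smooth_inZ => //; apply: smooth_in_det => k l.
  by apply: smooth_in_eq (sF (lift j k) (lift i l)) => // x _ _; rewrite !mxE.
apply: smooth_in_eq (smooth_inM oV sd sc) => // x Vx cx.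
by rewrite /invmx uF// !mxE.
Qed.

Section Derivatives.
Variables (a : 'I_n.+1) (x : M).
Hypotheses (Vx : V x) (cx : dom c x).

Lemma pd_mxM p q r (F : M -> 'M[R]_(p, q)) (G : M -> 'M[R]_(q, r)) :
  smooth_mx F -> smooth_mx G ->
  pd_mx a (fun y => F y *m G y) x = pd_mx a F x *m G x + F x *m pd_mx a G x.
Proof.
move=> sF sG; apply/matrixP => i j; rewrite !mxE.
rewrite (@pd_eq _ _ _ c V oV a _ (fun y => \sum_k F y i k * G y k j))//; last first.
  by move=> y _ _; rewrite mxE.
rewrite (pd_sum _ Vx cx); last by move=> k _; exact: smooth_inM.
rewrite -big_split /=; apply: eq_bigr => k _.
by rewrite (pdM _ Vx cx)// !mxE.
Qed.

Lemma pd_mxZ p q (f : M -> R) (F : M -> 'M[R]_(p, q)) : smooth_in c V f -> smooth_mx F ->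
  pd_mx a (fun y => f y *: F y) x = pd c a f x *: F x + f x *: pd_mx a F x.
Proof.
move=> sf sF; apply/matrixP => i j; rewrite !mxE.
rewrite (@pd_eq _ _ _ c V oV a _ (fun y => f y * F y i j))//; last first.
  by move=> y _ _; rewrite mxE.
by rewrite (pdM _ Vx cx).
Qed.

Lemma pd_mxT p q (F : M -> 'M[R]_(p, q)) : pd_mx a (fun y => (F y)^T) x = (pd_mx a F x)^T.
Proof.
apply/matrixP => i j; rewrite !mxE; apply: (pd_eq oV) => // y _ _.
by rewrite mxE.
Qed.

Lemma pd_mx_block p1 p2 q1 q2 (A : M -> 'M[R]_(p1, q1)) (B : M -> 'M[R]_(p1, q2))
    (C : M -> 'M[R]_(p2, q1)) (D : M -> 'M[R]_(p2, q2)) :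
  pd_mx a (fun x => block_mx (A x) (B x) (C x) (D x)) x =
  block_mx (pd_mx a A x) (pd_mx a B x) (pd_mx a C x) (pd_mx a D x).
Proof.
apply/matrixP => i j; rewrite [LHS]mxE.
case: (split_ordP i) => i' ->; case: (split_ordP j) => j' ->.
- by rewrite block_mxEul mxE; apply: (pd_eq oV) => // y _ _; rewrite block_mxEul.
- by rewrite block_mxEur mxE; apply: (pd_eq oV) => // y _ _; rewrite block_mxEur.
- by rewrite block_mxEdl mxE; apply: (pd_eq oV) => // y _ _; rewrite block_mxEdl.
- by rewrite block_mxEdr mxE; apply: (pd_eq oV) => // y _ _; rewrite block_mxEdr.
Qed.

Lemma pd_mx_inv p (F : M -> 'M[R]_p) : smooth_mx F ->
  (forall x, V x -> dom c x -> F x \in unitmx) ->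
  pd_mx a (fun y => invmx (F y)) x = - (invmx (F x) *m pd_mx a F x *m invmx (F x)).
Proof.
move=> sF uF; have sI := smooth_mx_inv sF uF.
have := pd_mxM sF sI.
rewrite (@pd_mx_eq _ _ _ _ (fun=> 1%:M)) ?pd_mx_const//; last first.
  by move=> y Vy cy; rewrite mulmxV// uF.
move/esym/eqP; rewrite addrC addr_eq0 => /eqP H.
by rewrite -[LHS](mulKmx (uF x Vx cx)) H mulmxN mulmxA.
Qed.

Lemma pd_prod (I : eqType) (r : seq I) (F : I -> M -> R) : uniq r ->
  (forall k, smooth_in c V (F k)) ->
  pd c a (fun y => \prod_(k <- r) F k y) x =
  \sum_(k <- r) pd c a (F k) x * \prod_(l <- r | l != k) F l x.
Proof.
move=> + sF; elim: r => [_|k r IH /= /andP[kr ur]].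
  rewrite big_nil (@pd_eq _ _ _ c V oV a _ (fun=> 1))// ?pd_cst//.
  by move=> y _ _; rewrite big_nil.
rewrite (@pd_eq _ _ _ c V oV a _ (fun y => F k y * \prod_(l <- r) F l y))//; last first.
  by move=> y _ _; rewrite big_cons.
rewrite (pdM _ Vx cx)//; last by apply: smooth_in_prod.
rewrite IH// !big_cons eqxx /=; congr (_ * _ + _).
  rewrite big_seq [RHS]big_seq_cond; apply: eq_bigl => l.
  by case: eqVneq => [->|_]; rewrite ?(negbTE kr)// andbT.
rewrite mulr_sumr; apply: eq_big_seq => l lr.
rewrite big_cons; case: eqVneq => [kl|_] /=; last by rewrite mulrCA.
by move: kr; rewrite kl lr.
Qed.

(** Jacobi's formula: [G k] is the matrix with its [k]-th row differentiated, and its determinant is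
    expanded along that row. *)
Lemma pd_det p (F : M -> 'M[R]_p) : smooth_mx F ->
  pd c a (fun y => \det (F y)) x = \sum_i \sum_j pd_mx a F x i j * cofactor (F x) i j.
Proof.
move=> sF; pose G k : 'M[R]_p := \matrix_(i, j) if i == k then pd_mx a F x k j else F x i j.
transitivity (\sum_k \det (G k)).
  rewrite /determinant exchange_big /= (pd_sum _ Vx cx); last first.
    by move=> s _; apply: smooth_inZ => //; apply: smooth_in_prod => // i _; exact: sF.
  apply: eq_bigr => s _; rewrite (pdZ _ Vx cx); last first.
    by apply: smooth_in_prod => // i _; exact: sF.
  rewrite pd_prod ?index_enum_uniq// mulr_sumr; apply: eq_bigr => k _.
  congr (_ * _); rewrite [RHS](bigD1 k)//= mxE eqxx mxE; congr (_ * _).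
  by apply: eq_bigr => l lk; rewrite mxE (negbTE lk).
apply: eq_bigr => k _; rewrite (expand_det_row _ k); apply: eq_bigr => j _.
rewrite [G k k j]mxE eqxx; congr (_ * _); rewrite /cofactor; congr (_ * \det _).
by apply/matrixP => i l; rewrite !mxE eq_sym (negbTE (neq_lift k i)).
Qed.

Lemma pd_det_unit p (F : M -> 'M[R]_p) : smooth_mx F -> F x \in unitmx ->
  pd c a (fun y => \det (F y)) x = \det (F x) * \tr (invmx (F x) *m pd_mx a F x).
Proof.
move=> sF uF; rewrite pd_det// /mxtrace exchange_big /= mulr_sumr.
apply: eq_bigr => j _; rewrite mxE mulr_sumr; apply: eq_bigr => i _.
rewrite /invmx uF !mxE; have := uF; rewrite unitmxE unitfE => d0.
by field.
Qed.

End Derivatives.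

Lemma smooth_differential f : smooth_in c V f -> smooth_mx (differential c f).
Proof.
move=> sf i j; apply: smooth_in_eq (smooth_in_pd oV j sf) => // x _ _.
by rewrite mxE.
Qed.

End MatrixCalculus.

(** * Algebra of a projective change of connection coefficients *)

Section ProjectiveChange.
Context {R : realType} {n : nat}.
Local Notation I := 'I_n.+1.
Variables (G : I -> I -> I -> R) (u : I -> R).
Hypothesis symG : forall a b k, G a b k = G b a k.
Let H a b k := G a b k + u a * (k == b)%:R + u b * (k == a)%:R.

(** The two correction terms contribute [u e] and [(n + 1) * u e]. *)
Lemma trace_change e : \sum_a H a e a = \sum_a G a e a + n.+2%:R * u e.
Proof.
rewrite /H !big_split /= sum_delta; under [X in _ + X]eq_bigr do rewrite eqxx mulr1.
rewrite sumr_const card_ord -mulr_natl -addrA; congr (_ + _).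
by rewrite -[n.+2%:R]natr1; ring.
Qed.

(** The part of the Ricci tensor without derivatives. Together with the derivative terms it produces
    the classical change by [- n] times [nabla u - u u]. *)
Lemma quadratic_change b d :
  \sum_a \sum_e H a e a * H b d e - \sum_a \sum_e H b e a * H a d e =
  \sum_a \sum_e G a e a * G b d e - \sum_a \sum_e G b e a * G a d e
  + n%:R * \sum_k u k * G b d k + n%:R * u b * u d.
Proof.
pose T e := \sum_a G a e a.
pose S := \sum_k u k * G b d k.
have E1 : \sum_a \sum_e H a e a * H b d e = \sum_a \sum_e G a e a * G b d e
   + T d * u b + T b * u d + n.+2%:R * S + 2 * n.+2%:R * u b * u d.
  rewrite exchange_big /= [X in _ = X + _ + _ + _ + _]exchange_big /=.
  under eq_bigr do rewrite -mulr_suml trace_change -/(T _).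
  under [X in _ = X + _ + _ + _ + _]eq_bigr do rewrite -mulr_suml -/(T _).
  rewrite (eq_bigr (fun e => T e * G b d e + (T e * u b) * (e == d)%:R + (T e * u d) * (e == b)%:R
     + n.+2%:R * (u e * G b d e) + (n.+2%:R * u e * u b) * (e == d)%:R
     + (n.+2%:R * u e * u d) * (e == b)%:R)); last by move=> e _; rewrite /H; ring.
  rewrite !big_split /= !sum_delta -mulr_sumr -/S; ring.
have E2 : \sum_a \sum_e H b e a * H a d e = \sum_a \sum_e G b e a * G a d e
   + 2 * S + T b * u d + T d * u b + n.+4%:R * u b * u d.
  rewrite (eq_bigr (fun a => \sum_e G b e a * G a d e + G b d a * u a
     + u d * G b a a + u b * G a d a + u b * u d + (u a * u b) * (a == d)%:R
     + (\sum_e u e * G a d e) * (a == b)%:R + (u a * u d) * (a == b)%:R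
     + (u d * u a) * (a == b)%:R)); last first.
    move=> a _.
    rewrite (eq_bigr (fun e => G b e a * G a d e + (G b e a * u a) * (e == d)%:R
      + (G b e a * u d) * (e == a)%:R + (u b * G a d e) * (a == e)%:R
      + (u b * u a * (e == d)%:R) * (a == e)%:R + (u b * u d * (e == a)%:R) * (a == e)%:R
      + (u e * G a d e) * (a == b)%:R + (u e * u a * (a == b)%:R) * (e == d)%:R
      + (u e * u d * (a == b)%:R) * (e == a)%:R)); last by move=> e _; rewrite /H; ring.
    rewrite !big_split /= !sum_delta !sum_delta_sym eqxx -mulr_suml [_ * true%:R]mulr1.
    by ring.
  rewrite !big_split /= !sum_delta.
  rewrite (_ : \sum_i G b d i * u i = S); last by apply: eq_bigr => k _; rewrite mulrC.
  rewrite -mulr_sumr -mulr_sumr (_ : \sum_i G b i i = T b); last by apply: eq_bigr => k _.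
  rewrite -/(T d) sumr_const card_ord -mulr_natl.
  rewrite (_ : \sum_e u e * G b d e = S)//.
  by rewrite -[n.+4%:R]natr1 -[n.+3%:R]natr1 -[n.+2%:R]natr1; ring.
rewrite E1 E2 -/S -[n.+4%:R]natr1 -[n.+3%:R]natr1 -[n.+2%:R]natr1 -[n.+1%:R]natr1.
ring.
Qed.

End ProjectiveChange.

(** * The metric, its volume density and the tractor connection *)

Section Interior.
Context {R : realType} {n : nat} {M : manifold R n}.
Local Notation inner := (@inner R n M).
Hypothesis boundary_coord : forall c (x : M), boundary x -> dom c x -> coord c x ord0 ord0 = 0.
Variable g : chart M -> M -> 'M[R]_n.+1.
Hypothesis g_metric : pseudo_riemannian g.
Variable c : chart M.

Let oi : open inner := open_inner boundary_coord.

Definition conn_mx (Gam : connection M) (a : 'I_n.+1) (x : M) : 'M[R]_n.+1 :=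
  \matrix_(k, b) Gam x a b k.

Local Notation LC := (levi_civita g c).

Lemma metric_smooth : smooth_mx c inner (g c).
Proof. by case: g_metric => sg _ _ _ i j; exact: sg. Qed.

Lemma metric_trmx x : inner x -> dom c x -> (g c x)^T = g c x.
Proof. by case: g_metric => _ + _ _; apply. Qed.

Lemma metric_entry_sym x i j : inner x -> dom c x -> g c x i j = g c x j i.
Proof. by move=> ix cx; rewrite -[in LHS](metric_trmx ix cx) mxE. Qed.

Lemma metric_unit x : inner x -> dom c x -> g c x \in unitmx.
Proof. by case: g_metric => _ _ + _; apply. Qed.

Lemma metric_det_neq0 x : inner x -> dom c x -> \det (g c x) != 0.
Proof. by move=> ix cx; have := metric_unit ix cx; rewrite unitmxE unitfE. Qed.

Lemma pd_metric_sym a i j x : inner x -> dom c x ->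
  pd c a (fun y => g c y i j) x = pd c a (fun y => g c y j i) x.
Proof. by move=> ix cx; apply: (pd_eq oi) => // y iy cy; exact: metric_entry_sym. Qed.

Lemma lower_levi_civita x a b d : inner x -> dom c x ->
  \sum_k g c x d k * LC x a b k =
  2^-1 * (pd c a (fun y => g c y b d) x + pd c b (fun y => g c y a d) x
     - pd c d (fun y => g c y a b) x).
Proof.
move=> ix cx; rewrite /levi_civita.
set S := fun e => pd c a (fun y => g c y b e) x + pd c b (fun y => g c y a e) x
     - pd c e (fun y => g c y a b) x.
rewrite -/(S d).
transitivity (\sum_e \sum_k 2^-1 * (g c x d k * invmx (g c x) k e) * S e).
  rewrite exchange_big /=; apply: eq_bigr => k _.
  rewrite mulrA mulr_sumr; apply: eq_bigr => e _; rewrite /S; ring.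
transitivity (\sum_e (2^-1 * S e) * (d == e)%:R); last exact: sum_delta_sym.
apply: eq_bigr => e _; rewrite -mulr_suml -mulr_sumr.
have := congr1 (fun A : 'M[R]_n.+1 => A d e) (mulmxV (metric_unit ix cx)).
by rewrite !mxE => ->; ring.
Qed.

(** The vanishing of the covariant derivative of the metric, written with connection matrices. *)
Lemma pd_metric a x : inner x -> dom c x ->
  pd_mx c a (g c) x = (conn_mx LC a x)^T *m g c x + g c x *m conn_mx LC a x.
Proof.
move=> ix cx; apply/matrixP => b d; rewrite [LHS]mxE [RHS]mxE [X in _ = X + _]mxE [X in _ = _ + X]mxE.
rewrite (eq_bigr (fun k => g c x d k * LC x a b k)); last first.
  by move=> k _; rewrite !mxE mulrC metric_entry_sym.
rewrite lower_levi_civita//.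
rewrite (eq_bigr (fun k => g c x b k * LC x a d k)); last first.
  by move=> k _; rewrite !mxE.
rewrite lower_levi_civita// (pd_metric_sym a d b)//.
by field.
Qed.

Lemma levi_civita_sym x a b k : inner x -> dom c x -> LC x a b k = LC x b a k.
Proof.
move=> ix cx; rewrite /levi_civita; congr (_ * _); apply: eq_bigr => d _.
by rewrite (pd_metric_sym d a b)//; congr (_ * _); ring.
Qed.

Lemma levi_civita_smooth a b k : smooth_in c inner (fun x => LC x a b k).
Proof.
have sI := smooth_mx_inv oi metric_smooth (fun x ix cx => metric_unit ix cx).
apply: (smooth_inZ oi); apply: (smooth_in_sum oi) => d _.
apply: (smooth_inM oi); first exact: sI.
apply: (smooth_inB oi); last by apply: (smooth_in_pd oi); exact: metric_smooth.
by apply: (smooth_inD oi); apply: (smooth_in_pd oi); exact: metric_smooth.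
Qed.

Lemma trace_coefE (Gam : connection M) x a : trace_coef Gam x 0 a = \tr (conn_mx Gam a x).
Proof. by rewrite mxE; apply: eq_bigr => k _; rewrite mxE. Qed.

Lemma pd_det_metric a x : inner x -> dom c x ->
  pd c a (fun y => \det (g c y)) x = \det (g c x) * (2 * trace_coef LC x 0 a).
Proof.
move=> ix cx; have uG := metric_unit ix cx.
rewrite (pd_det_unit oi _ ix cx)//; last exact: metric_smooth.
rewrite pd_metric// mulmxDr mulKmx// mxtraceD mulmxA mxtrace_mulC mulmxA.
by rewrite mulmxV// mul1mx mxtrace_tr trace_coefE mulr2n mulrDl mul1r.
Qed.

Lemma pd_sqr_powR (V : set M) (b : R) (f : M -> R) a x : open V -> smooth_in c V f -> V x -> dom c x ->
  f x != 0 -> pd c a (fun y => (f y ^+ 2) `^ b) x = 2 * b * (f x ^+ 2) `^ b * (pd c a f x / f x).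
Proof.
move=> oV sf Vx cx f0; have f2 : 0 < f x ^+ 2 by rewrite exprn_even_gt0.
rewrite (pd_powR _ Vx cx)//; last exact: smooth_inX.
rewrite (@pd_eq _ _ _ c V oV a _ (fun y => f y * f y))//.
rewrite (pdM _ Vx cx)// powRB; last by rewrite (gt_eqF f2) implybT.
rewrite powRr1 ?(ltW f2)//.
by field.
Qed.

(** Powers of absolute values become powers of squares, which the power rule differentiates without
    a case on the sign of the determinant. *)
Lemma norm_powR_sqr (d b : R) : d != 0 -> `|d| `^ b = (d ^+ 2) `^ (2^-1 * b).
Proof.
move=> d0; rewrite powRrM powR12_sqrt ?sqr_ge0// sqrtr_sqr.
by [].
Qed.

Lemma natr2_neq0 : n.+2%:R != 0 :> R.
Proof. by rewrite pnatr_eq0. Qed.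

Definition wexp : R := - (n.+2%:R)^-1.

(** In [4^-1], one half comes from the square root in the volume density and the other from
    replacing the absolute value by a square. *)
Lemma sigma_inner x : inner x -> dom c x ->
  sigma g c x = (\det (g c x) ^+ 2) `^ (4^-1 * wexp).
Proof.
move=> ix cx; rewrite /sigma memNset// -powR12_sqrt// -powRrM norm_powR_sqr ?metric_det_neq0//.
congr (_ `^ _); rewrite /wexp; move: natr2_neq0; move: (n.+2%:R) => N N0.
by field.
Qed.

Lemma sigma_gt0 x : inner x -> dom c x -> 0 < sigma g c x.
Proof.
move=> ix cx; rewrite sigma_inner// powR_gt0// exprn_even_gt0//=.
exact: metric_det_neq0.
Qed.

Lemma det_smooth : smooth_in c inner (fun x => \det (g c x)).
Proof. exact: (smooth_in_det oi metric_smooth). Qed.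

Lemma sqr_det_powR_smooth b : smooth_in c inner (fun x => (\det (g c x) ^+ 2) `^ b).
Proof.
apply: (smooth_in_powR oi); last exact: (smooth_inX oi _ det_smooth).
by move=> x ix cx; rewrite exprn_even_gt0//= metric_det_neq0.
Qed.

Lemma sigma_smooth_inner : smooth_in c inner (sigma g c).
Proof.
apply: (smooth_in_eq oi _ (@sqr_det_powR_smooth (4^-1 * wexp))) => x ix cx.
by rewrite sigma_inner.
Qed.

(** The connection form on E(1) in the trivialization of the chart: the covariant derivative of [s]
    is [d s + weight * s]. *)
Definition weight (Gam : connection M) (x : M) : 'rV[R]_n.+1 :=
  (n.+2%:R)^-1 *: trace_coef Gam x.

(** In invariant terms, [sigma] is parallel for the Levi-Civita connection, as is the volume density
    of [g]. *)
Lemma pd_sigma a x : inner x -> dom c x ->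
  pd c a (sigma g c) x = - weight LC x 0 a * sigma g c x.
Proof.
move=> ix cx; have d0 := metric_det_neq0 ix cx.
rewrite (@pd_eq _ _ _ c inner oi a _ (fun x => (\det (g c x) ^+ 2) `^ (4^-1 * wexp)))//; last first.
  by move=> y iy cy; exact: sigma_inner.
rewrite (pd_sqr_powR _ _ oi det_smooth)// pd_det_metric// -sigma_inner//.
rewrite [weight _ _ _ _]mxE /wexp; move: natr2_neq0; move: (n.+2%:R) => N N0.
by field; rewrite N0 d0.
Qed.

Lemma differential_sigma x : inner x -> dom c x ->
  differential c (sigma g c) x = - sigma g c x *: weight LC x.
Proof. by move=> ix cx; apply/rowP => a; rewrite [LHS]mxE pd_sigma// [RHS]mxE; ring. Qed.

(** The identity [sigma ^ (2 (n + 2)) * |det g| = 1], squared to remove the absolute value. *)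
Lemma det_metric_sigma x : inner x -> dom c x ->
  sigma g c x ^+ (4 * n.+2) * \det (g c x) ^+ 2 = 1.
Proof.
move=> ix cx; have d2 : 0 < \det (g c x) ^+ 2.
  by rewrite exprn_even_gt0//= metric_det_neq0.
rewrite sigma_inner// -powR_mulrn ?powR_ge0// -powRrM.
rewrite (_ : 4^-1 * wexp * _ = - 1); last first.
  by rewrite /wexp natrM; move: natr2_neq0; move: (n.+2%:R) => N N0; field.
by rewrite powR_inv1 ?(ltW d2)// mulVf// gt_eqF.
Qed.

End Interior.

(** * The tractor connection as a matrix of one-forms *)

Section Tractors.
Context {R : realType} {n : nat} {M : manifold R n}.
Variables (c : chart M) (V : set M).
Hypothesis oV : open V.
Implicit Types (Gam : connection M) (a : 'I_n.+1) (x : M).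

Definition smooth_conn Gam : Prop := forall a b k, smooth_in c V (fun x => Gam x a b k).

Lemma smooth_trace_coef Gam : smooth_conn Gam -> smooth_mx c V (trace_coef Gam).
Proof.
move=> sG i a; apply: (@smooth_in_eq _ _ _ c V oV (fun x => \sum_k Gam x a k k)).
  by move=> x _ _; rewrite mxE.
by apply: smooth_in_sum => // k _; exact: sG.
Qed.

Lemma smooth_weight Gam : smooth_conn Gam -> smooth_mx c V (weight Gam).
Proof.
move=> sG; apply: smooth_mxZ => //; first exact: smooth_in_cst.
exact: smooth_trace_coef.
Qed.

Lemma smooth_conn_mx Gam a : smooth_conn Gam -> smooth_mx c V (conn_mx Gam a).
Proof. by move=> sG k b; apply: smooth_in_eq (sG a b k) => // x _ _; rewrite mxE. Qed.

Lemma smooth_ricci Gam b d : smooth_conn Gam -> smooth_in c V (fun x => ricci c Gam x b d).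
Proof.
move=> sG; rewrite /ricci; apply: smooth_inB => //; last first.
  by do 2 (apply: smooth_in_sum => // ? _); apply: smooth_inM.
apply: smooth_inD => //; last by do 2 (apply: smooth_in_sum => // ? _); apply: smooth_inM.
by apply: smooth_inB => //; apply: smooth_in_sum => // ? _; apply: smooth_in_pd => //.
Qed.

Lemma smooth_schouten Gam a b : smooth_conn Gam -> smooth_in c V (fun x => schouten c Gam x a b).
Proof. by move=> sG; apply: smooth_inZ => //; exact: smooth_ricci. Qed.

(** Acting on rows from the right it sends [(s, p)] to [(s, p + s w)]: the change of splitting by
    the one-form [w]. *)
Definition shear (w : 'rV[R]_n.+1) : 'M[R]_(1 + n.+1) := block_mx 1%:M w 0 1%:M.

Lemma splittingE Gam x : splitting Gam x = shear (weight Gam x).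
Proof. by []. Qed.

Lemma shearD (v w : 'rV[R]_n.+1) : shear v *m shear w = shear (v + w).
Proof.
by rewrite /shear mulmx_block !mul1mx !mulmx1 !mulmx0 !mul0mx !addr0 add0r addrC.
Qed.

Lemma shear0 : shear 0 = 1%:M.
Proof. by rewrite /shear -scalar_mx_block. Qed.

Lemma shearNK (w : 'rV[R]_n.+1) : shear (- w) *m shear w = 1%:M.
Proof. by rewrite shearD addNr shear0. Qed.

Lemma shear_unit (w : 'rV[R]_n.+1) : shear w \in unitmx.
Proof. by have /mulmx1_unit[] := shearNK w. Qed.

Lemma invmx_shear (w : 'rV[R]_n.+1) : invmx (shear w) = shear (- w).
Proof. by rewrite -[RHS](mulmxK (shear_unit w)) shearNK mul1mx. Qed.

Lemma det_shear (w : 'rV[R]_n.+1) : \det (shear w) = 1.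
Proof. by rewrite det_ublock !det1 mulr1. Qed.

Lemma smooth_shear (w : M -> 'rV[R]_n.+1) : smooth_mx c V w -> smooth_mx c V (fun x => shear (w x)).
Proof. by move=> sw; apply: smooth_mx_block => //; exact: smooth_mx_const. Qed.

Lemma pd_shear a (w : M -> 'rV[R]_n.+1) x : V x -> dom c x ->
  pd_mx c a (fun y => shear (w y)) x = block_mx 0 (pd_mx c a w x) 0 0.
Proof. by move=> Vx cx; rewrite (pd_mx_block oV a Vx cx) !pd_mx_const. Qed.

(** The matrix with which the tractor connection on row vectors is [d t + t * split_conn_mx] in the
    splitting of [Gam]. *)
Definition split_conn_mx Gam a x : 'M[R]_(1 + n.+1) :=
  block_mx (weight Gam x 0 a)%:M (\row_b schouten c Gam x a b)
           (- delta_mx a 0) ((weight Gam x 0 a)%:M - conn_mx Gam a x).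

(** The gauge transform of [split_conn_mx] to the jet trivialization of the chart. This
    trivialization does not involve [Gam], so different connections of a projective class can be
    compared in it. *)
Definition tractor_conn_mx Gam a x : 'M[R]_(1 + n.+1) :=
  (pd_mx c a (splitting Gam) x + splitting Gam x *m split_conn_mx Gam a x)
    *m invmx (splitting Gam x).

Lemma smooth_split_conn_mx Gam a : smooth_conn Gam -> smooth_mx c V (split_conn_mx Gam a).
Proof.
move=> sG; have sw : smooth_in c V (fun x => weight Gam x 0 a) by exact: smooth_weight.
apply: smooth_mx_block => //.
- exact: smooth_mx_scalar.
- move=> i b; apply: smooth_in_eq (smooth_schouten a b sG) => // x _ _.
  by rewrite mxE.
- exact: smooth_mx_const.
- apply: smooth_mxD => //; first exact: smooth_mx_scalar.
  by apply: smooth_mxN => //; exact: smooth_conn_mx.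
Qed.

Lemma smooth_splitting Gam : smooth_conn Gam -> smooth_mx c V (splitting Gam).
Proof. by move=> sG; apply: smooth_shear; exact: smooth_weight. Qed.

Lemma smooth_tractor_conn_mx Gam a : smooth_conn Gam -> smooth_mx c V (tractor_conn_mx Gam a).
Proof.
move=> sG; apply: smooth_mxM => //.
  apply: smooth_mxD => //.
    by apply: smooth_mx_pd => //; exact: smooth_splitting.
  by apply: smooth_mxM => //; [exact: smooth_splitting|exact: smooth_split_conn_mx].
apply: (@smooth_mx_eq _ _ _ c V oV _ _ (fun x => shear (- weight Gam x))).
  by move=> x _ _; rewrite splittingE invmx_shear.
by apply: smooth_shear; apply: smooth_mxN => //; exact: smooth_weight.
Qed.

Lemma split_cotractor_derE Gam a (t : M -> 'rV[R]_(1 + n.+1)) x :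
  smooth_mx c V t -> V x -> dom c x ->
  split_cotractor_der c Gam a t x = pd_mx c a t x + t x *m split_conn_mx Gam a x.
Proof.
move=> st Vx cx; rewrite -[t x in RHS]hsubmxK /split_conn_mx mul_row_block.
rewrite -[pd_mx c a t x]hsubmxK add_row_mx /split_cotractor_der; congr row_mx.
  apply/matrixP => i j; rewrite (ord1 i) (ord1 j) !mxE big_ord1 !mxE eqxx mulr1n.
  rewrite (@pd_eq _ _ _ c V oV a _ (fun y => t y 0 (lshift n.+1 0)))//; last first.
    by move=> y _ _; rewrite mxE.
  rewrite [X in _ + (_ + X)](_ : _ = - t x 0 (rshift 1 a)).
    by rewrite mulr1n addrA [t x _ _ * _]mulrC.
  rewrite (eq_bigr (fun j => - t x 0 (rshift 1 j) * (j == a)%:R)) ?sum_delta// => k _.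
  by rewrite !mxE eqxx andbT mulNr mulrN.
apply/rowP => b; rewrite !mxE.
rewrite (@pd_eq _ _ _ c V oV a _ (fun y => t y 0 (rshift 1 b)))//; last first.
  by move=> y _ _; rewrite mxE.
rewrite big_ord1 !mxE.
under eq_bigr do rewrite mxE.
rewrite [X in _ = _ + (_ + X)](_ : _ = n.+2%:R^-1 * (\sum_k Gam x a k k) * t x 0 (rshift 1 b)
  - \sum_k Gam x a b k * t x 0 (rshift 1 k)).
  by rewrite [schouten _ _ _ _ _ * _]mulrC -!addrA; congr (_ + _);
    rewrite [LHS]addrC [RHS]addrA; congr (_ - _); exact: addrC.
rewrite (eq_bigr (fun k => (n.+2%:R^-1 * (\sum_k Gam x a k k) * t x 0 (rshift 1 k)) * (k == b)%:R
  - Gam x a b k * t x 0 (rshift 1 k))) ?sumrB ?sum_delta// => k _.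
by rewrite !mxE -mulr_natr; ring.
Qed.

Lemma cotractor_derE Gam a (t : M -> 'rV[R]_(1 + n.+1)) x : smooth_conn Gam ->
  smooth_mx c V t -> V x -> dom c x ->
  cotractor_der c Gam a t x = pd_mx c a t x + t x *m tractor_conn_mx Gam a x.
Proof.
move=> sG st Vx cx; have sS := smooth_splitting sG.
have uS : splitting Gam x \in unitmx by exact: shear_unit.
rewrite /cotractor_der split_cotractor_derE//; last exact: smooth_mxM.
rewrite (pd_mxM oV a Vx cx)// !mulmxDl -!mulmxA mulmxV// mulmx1 /tractor_conn_mx.
by rewrite mulmxDl mulmxDr addrA !mulmxA.
Qed.

Lemma parallel_onP Gam (H : M -> 'M[R]_(1 + n.+1)) : V `<=` dom c -> smooth_conn Gam ->
  smooth_mx c V H ->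
  (forall a x, V x -> pd_mx c a H x =
     tractor_conn_mx Gam a x *m H x + H x *m (tractor_conn_mx Gam a x)^T) ->
  parallel_on c V Gam H.
Proof.
move=> Vc sG sH dH t t' st st' a x Vx; have cx := Vc x Vx.
have mt : smooth_mx c V t by move=> i j; rewrite (ord1 i); exact: st.
have mt' : smooth_mx c V t' by move=> i j; rewrite (ord1 i); exact: st'.
have mtT := smooth_mxT oV mt'; have mtH := smooth_mxM oV mt sH.
rewrite !(cotractor_derE a sG _ Vx cx)//.
transitivity (pd_mx c a (fun y => t y *m H y *m (t' y)^T) x 0 0); first by rewrite mxE.
rewrite (pd_mxM oV a Vx cx)// (pd_mxM oV a Vx cx)// (pd_mxT oV a Vx cx) dH// /form_eval.
move: (pd_mx c a t x) (pd_mx c a t' x) (tractor_conn_mx Gam a x) => dt dt' Om.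
rewrite (_ : _ + _ = (dt + t x *m Om) *m H x *m (t' x)^T
  + t x *m H x *m (dt' + t' x *m Om)^T); first by rewrite mxE.
rewrite [(dt' + _)^T]linearD /= trmx_mul !mulmxDr !mulmxDl !mulmxA -!addrA.
by congr (_ + (_ + _)); rewrite addrC.
Qed.

End Tractors.

(** * Projective invariance and the parallel form on the interior *)

Lemma invmx_mul {F : comUnitRingType} m (A B : 'M[F]_m) :
  A \in unitmx -> B \in unitmx -> invmx (A *m B) = invmx B *m invmx A.
Proof.
move=> uA uB; have uAB : A *m B \in unitmx by rewrite unitmx_mul uA.
by rewrite -[RHS](mulmxK uAB) !mulmxA mulmxKV// mulVmx// mul1mx.
Qed.

Section ProjectiveInvariance.
Context {R : realType} {n : nat} {M : manifold R n}.
Hypothesis n_gt0 : (0 < n)%N.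
Variables (c : chart M) (W : set M).
Hypothesis oW : open W.
Variables (Gam : connection M) (Ups : M -> 'rV[R]_n.+1).
Hypothesis sG : smooth_conn c W Gam.
Hypothesis symG : forall x a b k, W x -> dom c x -> Gam x a b k = Gam x b a k.
Hypothesis sU : smooth_mx c W Ups.
Hypothesis closedU : forall x a b, W x -> dom c x ->
  pd c a (fun y => Ups y 0 b) x = pd c b (fun y => Ups y 0 a) x.

Local Notation hat := (proj_change Gam Ups).

Lemma pdZr f r a x : smooth_in c W f -> W x -> dom c x ->
  pd c a (fun y => f y * r) x = pd c a f x * r.
Proof.
move=> sf Wx cx; rewrite mulrC -(pdZ a Wx cx r sf).
by apply: (pd_eq oW) => // y _ _; rewrite mulrC.
Qed.

Lemma pd_proj_change e a b k x : W x -> dom c x ->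
  pd c e (fun y => hat y a b k) x = pd c e (fun y => Gam y a b k) x
    + pd c e (fun y => Ups y 0 a) x * (k == b)%:R + pd c e (fun y => Ups y 0 b) x * (k == a)%:R.
Proof.
move=> Wx cx; have sUc i (r : R) : smooth_in c W (fun y => Ups y 0 i * r).
  by apply: (smooth_inM oW (sU 0 i)); exact: smooth_in_cst.
have s2 := sUc a (k == b)%:R; have s3 := sUc b (k == a)%:R.
have s12 := smooth_inD oW (sG a b k) s2.
by rewrite /proj_change (pdD _ Wx cx s12 s3) (pdD _ Wx cx (sG a b k) s2) !pdZr.
Qed.

(** The derivative terms sum to [pd d Ups_b - (n + 1) pd b Ups_d]; closedness of [Ups] turns this
    into [- n] times one derivative. *)
Lemma ricci_change x b d : W x -> dom c x ->
  ricci c hat x b d = ricci c Gam x b d - n%:R * (pd c b (fun y => Ups y 0 d) x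
    - \sum_k Ups x 0 k * Gam x b d k - Ups x 0 b * Ups x 0 d).
Proof.
move=> Wx cx; rewrite /ricci.
under eq_bigr do rewrite pd_proj_change//.
under [X in _ - X + _ - _]eq_bigr do rewrite pd_proj_change// eqxx mulr1.
rewrite -[LHS]addrA /proj_change.
have -> := @quadratic_change R n (Gam x) (fun a => Ups x 0 a)
  (fun a b k => symG a b k Wx cx) b d.
rewrite !big_split /= !sum_delta sumr_const card_ord.
rewrite (closedU d b Wx cx) -[_ *+ n.+1]mulr_natl -[n.+1%:R]natr1; ring.
Qed.

Lemma schouten_change x b d : W x -> dom c x ->
  schouten c hat x b d = schouten c Gam x b d - (pd c b (fun y => Ups y 0 d) x
    - \sum_k Ups x 0 k * Gam x b d k - Ups x 0 b * Ups x 0 d).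
Proof.
move=> Wx cx; rewrite /schouten ricci_change// mulrBr mulKf//.
by rewrite pnatr_eq0 -lt0n.
Qed.

Lemma trace_coef_change x : trace_coef hat x = trace_coef Gam x + n.+2%:R *: Ups x.
Proof.
apply/rowP => a; rewrite !mxE /proj_change !big_split /= sum_delta.
under [X in _ + X + _]eq_bigr do rewrite eqxx mulr1.
by rewrite sumr_const card_ord -[_ *+ n.+1]mulr_natl -[n.+2%:R]natr1; ring.
Qed.

Lemma weight_change x : weight hat x = weight Gam x + Ups x.
Proof. by rewrite /weight trace_coef_change scalerDr scalerA mulVf ?scale1r ?pnatr_eq0. Qed.

Lemma conn_mx_change a x : conn_mx hat a x =
  conn_mx Gam a x + (Ups x 0 a)%:M + delta_mx a 0 *m Ups x.
Proof.
apply/matrixP => k b; rewrite !mxE big_ord1 !mxE eqxx andbT /proj_change mulr_natr.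
by rewrite [(k == a)%:R * _]mulrC.
Qed.

(** The gauge identity for the shear by [Ups]: the derivative of [Ups] is absorbed by the change of
    the Schouten tensor in the upper right block. *)
Lemma split_conn_change a x : W x -> dom c x ->
  block_mx 0 (pd_mx c a Ups x) 0 0 + shear (Ups x) *m split_conn_mx c hat a x =
  split_conn_mx c Gam a x *m shear (Ups x).
Proof.
move=> Wx cx; rewrite /split_conn_mx /shear !mulmx_block !mul1mx !mulmx1 !mulmx0 !mul0mx.
rewrite !addr0 !add0r add_block_mx !add0r weight_change conn_mx_change.
set w := weight Gam x 0 a; have -> : (weight Gam x + Ups x) 0 a = w + Ups x 0 a by rewrite mxE.
congr block_mx.
- rewrite mulmxN -colE; apply/matrixP => i j; rewrite (ord1 i) (ord1 j) !mxE eqxx !mulr1n.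
  by rewrite addrK.
- rewrite mul_scalar_mx mulmxBr mul_mx_scalar !mulmxDr mul_mx_scalar mulmxA -colE.
  apply/rowP => b; rewrite !mxE big_ord1 !mxE schouten_change//.
  have -> : \sum_j Ups x 0 j * conn_mx Gam a x j b = \sum_k Ups x 0 k * Gam x a b k.
    by apply: eq_bigr => k _; rewrite mxE.
  have -> : Ups x ord0 b = Ups x 0 b by [].
  by ring.
- rewrite mulNmx raddfD /=.
  move: (w%:M) ((Ups x 0 a)%:M) (delta_mx a 0 *m Ups x) (conn_mx Gam a x) => A B C D.
  by apply/matrixP => i j; rewrite !mxE; ring.
Qed.

(** The splitting of the changed connection is that of [Gam] followed by the shear by [Ups], and
    [split_conn_change] makes the shear cancel. *)
Lemma tractor_conn_change a x : W x -> dom c x ->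
  tractor_conn_mx c hat a x = tractor_conn_mx c Gam a x.
Proof.
move=> Wx cx; have sw := smooth_weight oW sG.
have sS := smooth_splitting oW sG; have sY := smooth_shear oW sU.
have E y : splitting hat y = splitting Gam y *m shear (Ups y).
  by rewrite !splittingE weight_change shearD.
have uS : splitting Gam x \in unitmx by exact: shear_unit.
have uY := shear_unit (Ups x).
rewrite /tractor_conn_mx E (@pd_mx_eq _ _ _ c W oW _ _ a _ (fun y => splitting Gam y *m shear (Ups y)))//.
rewrite (pd_mxM oW a Wx cx)// (pd_shear oW _ _ Wx cx) -addrA -mulmxA -mulmxDr split_conn_change//.
by rewrite mulmxA -mulmxDl invmx_mul// !mulmxA mulmxK.
Qed.

End ProjectiveInvariance.

Section KernelLemma.
Context {F : fieldType}.

(** Adding a matrix of rank at most one raises the rank by at most one, so [A] has corank at most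
    one. *)
Lemma kernel_line m (A : 'M[F]_m.+1) (L v : 'rV[F]_m.+1) :
  L != 0 -> L *m A = 0 -> \det (A + v^T *m v) != 0 -> (kermx A == L)%MS.
Proof.
move=> L0 LA dA; have rL : \rank L = 1%N by rewrite rank_rV L0.
have sL : (L <= kermx A)%MS by apply/sub_kermxP.
have rA : (m <= \rank A)%N.
  have uA : A + v^T *m v \in unitmx by rewrite unitmxE unitfE.
  have := mxrank_unit uA; have := mxrank_add A (v^T *m v) => + E; rewrite E.
  have := leq_trans (mxrankM_maxr v^T v) (rank_leq_row v).
  by move=> h1 h2; have := leq_trans h2 (leq_add (leqnn _) h1); rewrite addn1 ltnS.
have [+ E] := mxrank_leqif_eq sL; rewrite rL mxrank_ker => le1.
have : (\rank L == \rank (kermx A))%N.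
  by rewrite rL mxrank_ker eqn_leq le1 leq_subLR addn1 ltnS.
by rewrite E => /andP[h1 h2]; apply/andP.
Qed.

End KernelLemma.

(** * The parallel form over the interior *)

Section InnerForm.
Context {R : realType} {n : nat} {M : manifold R n}.
Local Notation inner := (@inner R n M).
Hypothesis boundary_coord : forall c (x : M), boundary x -> dom c x -> coord c x ord0 ord0 = 0.
Variable g : chart M -> M -> 'M[R]_n.+1.
Hypothesis g_metric : pseudo_riemannian g.
Variable c : chart M.

Let oi : open inner := open_inner boundary_coord.
Local Notation LC := (levi_civita g c).

Lemma smooth_levi_civita : smooth_conn c inner LC.
Proof. by move=> a b k; exact: levi_civita_smooth. Qed.

Definition inner_form (x : M) : 'M[R]_(1 + n.+1) :=
  splitting LC x *m split_inner_form g c x *m (splitting LC x)^T.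

Definition inner_block (x : M) : 'M[R]_n.+1 := (sigma g c x) ^- 2 *: invmx (g c x).

Lemma sigma_neq0 x : inner x -> dom c x -> sigma g c x != 0.
Proof. by move=> ix cx; rewrite gt_eqF// (sigma_gt0 g_metric). Qed.

Lemma smooth_sigma2V : smooth_in c inner (fun x => (sigma g c x) ^- 2).
Proof.
apply: (smooth_inV oi); first by move=> x ix cx; rewrite expf_neq0 ?sigma_neq0.
by apply: (smooth_inX oi); exact: (sigma_smooth_inner boundary_coord g_metric).
Qed.

Lemma smooth_metric_inv : smooth_mx c inner (fun x => invmx (g c x)).
Proof.
apply: (smooth_mx_inv oi); first exact: metric_smooth.
by move=> x ix cx; exact: (metric_unit g_metric).
Qed.

Lemma smooth_inner_block : smooth_mx c inner inner_block.
Proof. by apply: (smooth_mxZ oi); [exact: smooth_sigma2V|exact: smooth_metric_inv]. Qed.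

Lemma smooth_split_inner_form : smooth_mx c inner (split_inner_form g c).
Proof.
apply: (smooth_mx_block oi); try exact: (smooth_mx_const c oi).
exact: smooth_inner_block.
Qed.

Lemma smooth_splitting_inner : smooth_mx c inner (splitting LC).
Proof. exact: (smooth_splitting oi smooth_levi_civita). Qed.

Lemma smooth_inner_form : smooth_mx c inner inner_form.
Proof.
apply: (smooth_mxM oi); last by apply: (smooth_mxT oi); exact: smooth_splitting_inner.
by apply: (smooth_mxM oi); [exact: smooth_splitting_inner|exact: smooth_split_inner_form].
Qed.

Lemma pd_sigma2V a x : inner x -> dom c x ->
  pd c a (fun y => (sigma g c y) ^- 2) x = 2 * weight LC x 0 a * (sigma g c x) ^- 2.
Proof.
move=> ix cx; have ss := sigma_smooth_inner boundary_coord g_metric c.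
have s0 := sigma_neq0 ix cx.
rewrite (pdV _ ix cx)//; last 2 first.
- exact: (smooth_inX oi).
- by rewrite expf_neq0.
rewrite (@pd_eq _ _ _ c inner oi a _ (fun y => sigma g c y * sigma g c y))//.
rewrite (pdM _ ix cx)// (pd_sigma boundary_coord g_metric)//.
by field.
Qed.

Lemma pd_inner_block a x : inner x -> dom c x ->
  pd_mx c a inner_block x =
    ((weight LC x 0 a)%:M - conn_mx LC a x) *m inner_block x
    + inner_block x *m ((weight LC x 0 a)%:M - conn_mx LC a x)^T.
Proof.
move=> ix cx; have uG := metric_unit g_metric ix cx.
rewrite (pd_mxZ oi a ix cx)//; [|exact: smooth_sigma2V|exact: smooth_metric_inv].
rewrite (pd_mx_inv oi a ix cx); [|exact: metric_smooth|by move=> y iy cy; exact: (metric_unit g_metric)].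
rewrite (pd_metric boundary_coord g_metric)// pd_sigma2V// /inner_block.
set w := weight LC x 0 a; set K := conn_mx LC a x; set s := (sigma g c x) ^- 2.
set Gi := invmx (g c x).
have E : Gi *m (K^T *m g c x + g c x *m K) *m Gi = Gi *m K^T + K *m Gi.
  by rewrite mulmxDr mulmxDl !mulmxA mulmxK// mulVmx// mul1mx.
rewrite E linearB /= tr_scalar_mx mulmxBl mulmxBr mul_scalar_mx mul_mx_scalar.
rewrite -!scalemxAr -!scalemxAl.
apply/matrixP => i j; rewrite !mxE; ring.
Qed.

Hypothesis g_flat : ricci_flat g.

(** In the Levi-Civita splitting Ricci-flatness removes the Schouten block, so differentiation
    creates nothing outside the lower block, where the weighted inverse metric is parallel. The
    splitting is then conjugated away. *)
Lemma pd_inner_form a x : inner x -> dom c x ->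
  pd_mx c a inner_form x = tractor_conn_mx c LC a x *m inner_form x
    + inner_form x *m (tractor_conn_mx c LC a x)^T.
Proof.
move=> ix cx; have sS := smooth_splitting_inner; have sH := smooth_split_inner_form.
have sST := smooth_mxT oi sS; have sSH := smooth_mxM oi sS sH.
have uS : splitting LC x \in unitmx by exact: shear_unit.
rewrite (pd_mxM oi a ix cx)// (pd_mxM oi a ix cx)// (pd_mxT oi a ix cx).
have -> : pd_mx c a (split_inner_form g c) x =
    split_conn_mx c LC a x *m split_inner_form g c x
    + split_inner_form g c x *m (split_conn_mx c LC a x)^T.
  rewrite (pd_mx_block oi a ix cx) !(pd_mx_const _ _ cx) pd_inner_block//.
  have P0 : \row_b schouten c LC x a b = 0.
    by apply/rowP => b; rewrite !mxE /schouten g_flat// mulr0.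
  rewrite /split_conn_mx /split_inner_form P0 tr_block_mx !mulmx_block.
  by rewrite !(mulmx0, mul0mx, trmx0, addr0, add0r) add_block_mx !addr0.
rewrite /inner_form /tractor_conn_mx.
move: (splitting LC x) uS (pd_mx c a _ x) (split_conn_mx c LC a x) (split_inner_form g c x).
move=> S uS dS T H0.
have -> : (dS + S *m T) *m invmx S *m (S *m H0 *m S^T) = (dS + S *m T) *m H0 *m S^T.
  by rewrite !mulmxA mulmxKV.
have -> : S *m H0 *m S^T *m ((dS + S *m T) *m invmx S)^T = S *m H0 *m (dS + S *m T)^T.
  by rewrite trmx_mul mulmxA -[S *m H0 *m S^T *m _]mulmxA -trmx_mul mulVmx// trmx1 mulmx1.
rewrite [(dS + _)^T]linearD /= trmx_mul !mulmxDl !mulmxDr !mulmxDl !mulmxA -!addrA.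
by congr (_ + (_ + _)); rewrite addrC.
Qed.

(** As [sigma] is parallel, the second slot of its jet in the Levi-Civita splitting is zero. *)
Lemma L_sigma_inner x : inner x -> dom c x ->
  L_sigma g c x = row_mx (sigma g c x)%:M 0 *m invmx (splitting LC x).
Proof.
move=> ix cx; rewrite splittingE invmx_shear /shear mul_row_block mulmx1 mul0mx !mul0mx !addr0.
by rewrite /L_sigma (differential_sigma boundary_coord g_metric)// mul_scalar_mx scaleNr scalerN.
Qed.

Lemma L_sigma_form x : inner x -> dom c x -> L_sigma g c x *m inner_form x = 0.
Proof.
move=> ix cx; have uS : splitting LC x \in unitmx by exact: shear_unit.
rewrite L_sigma_inner// /inner_form !mulmxA mulmxKV// /split_inner_form mul_row_block.
by rewrite !mulmx0 !mul0mx !addr0 row_mx0 mul0mx.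
Qed.

Lemma inner_form_sym x : inner x -> dom c x -> (inner_form x)^T = inner_form x.
Proof.
move=> ix cx; rewrite /inner_form !trmx_mul trmxK mulmxA; congr (_ *m _ *m _).
rewrite tr_block_mx !trmx0 linearZ /= trmx_inv.
by rewrite (metric_trmx g_metric ix cx).
Qed.

(** Splittings have determinant 1. In the Levi-Civita splitting, with [v] given by [(a, b)], the
    perturbed matrix factors into block triangular ones and has determinant [a ^ 2 * det B], where
    [(det B) ^ 2 = sigma ^ 4] by [det_metric_sigma]; and [sigma * a] is the pairing of [L] with
    [v]. *)
Lemma det_inner_form x (v : 'rV[R]_(1 + n.+1)) : inner x -> dom c x ->
  \det (inner_form x + v^T *m v) ^+ 2 = (L_sigma g c x *m v^T) 0 0 ^+ 4.
Proof.
move=> ix cx; have s0 := sigma_neq0 ix cx; have d0 := metric_det_neq0 g_metric ix cx.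
have := det_metric_sigma g_metric ix cx; rewrite L_sigma_inner//.
rewrite /inner_form splittingE; set S := shear _ => Es.
have uS : S \in unitmx by exact: shear_unit.
pose w := v *m (invmx S)^T; have vE : v = w *m S^T.
  by rewrite /w -mulmxA -trmx_mul mulmxV// trmx1 mulmx1.
have -> : S *m split_inner_form g c x *m S^T + v^T *m v =
    S *m (split_inner_form g c x + w^T *m w) *m S^T.
  by rewrite vE trmx_mul trmxK mulmxDr mulmxDl !mulmxA.
rewrite !det_mulmx det_tr det_shear mul1r mulr1.
rewrite -mulmxA -[invmx S]trmxK -trmx_mul -/w -[w]hsubmxK.
set a := lsubmx w; set b := rsubmx w.
rewrite tr_row_mx mul_row_col mul0mx addr0 mul_col_row /split_inner_form add_block_mx !add0r.
have aE : a = (a 0 0)%:M by exact: mx11_scalar.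
have -> : block_mx (a^T *m a) (a^T *m b) (b^T *m a) (inner_block x + b^T *m b) =
    block_mx a^T 0 b^T 1%:M *m block_mx a b 0 (inner_block x).
  by rewrite mulmx_block !mulmx0 !mul0mx !mul1mx !addr0 addrC.
rewrite det_mulmx det_lblock det_ublock det1 mulr1 det_tr aE det_scalar1 mul_scalar_mx.
rewrite tr_scalar_mx mxE !mxE eqxx mulr1n /inner_block detZ det_inv.
move: Es; set s := sigma g c x; set d := \det (g c x) => Es.
have sd : (s ^- 2) ^+ n.+1 / d = (s ^- 2) ^+ n.+1 / d by [].
have E2 : ((s ^- 2) ^+ n.+1 / d) ^+ 2 = s ^+ 4.
  rewrite exprMn -!exprVn -!exprM.
  have d2 : d ^- 2 = s ^+ (4 * n.+2) by apply: (mulIf (expf_neq0 2 d0)); rewrite mulVf ?expf_neq0.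
  rewrite !exprVn d2 (_ : (4 * n.+2 = 2 * n.+1 * 2 + 4)%N); last by lia.
  by rewrite exprD mulKf// expf_neq0.
set A := \sum_j _; rewrite mulrA [LHS]exprMn E2; ring.
Qed.

End InnerForm.

(** * The projective structure near the boundary *)

(* [boundary] only asks for some chart sending the point to the face.  In a chart
   where it is interior, a nonnegative defining function would have a minimum
   there, hence a vanishing differential. *)
Lemma compact_boundary_coord (R : realType) (n : nat) (M : manifold R n)
    (g : chart M -> M -> 'M[R]_n.+1) : projectively_compact g ->
  forall c (x : M), boundary x -> dom c x -> coord c x ord0 ord0 = 0.
Proof.
move=> [alpha _ /[swap] c gc] x bx cx.
have [U [rho [Ux [oU srho rho0 rhob drho] _]]] := gc x bx.
apply/eqP; apply: contraT => x0.
have ox : open_half (coord c x) by rewrite /open_half /= lt_def x0; exact: coord_half.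
have sr : smooth_in c U rho := srho c.
have /negP := drho c x Ux bx cx; case; apply/eqP/rowP => i; rewrite !mxE.
apply: (is_pd_min (f := rho \o param c) (i := i) ox).
  apply: (hopen_near (hopen_chart c oU) (chart_imageP Ux cx)) => v.
  move=> /param_chart_image[Uv _ _] /=; rewrite coordK//.
  by have [_ ->] := rhob x Ux; rewrite // rho0.
exact: (smooth_in_is_pd (i := i) sr Ux cx).
Qed.

Section Congruence.
Context {R : realType} {n : nat} {M : manifold R n}.
Variables (c : chart M) (W : set M).
Hypothesis oW : open W.
Variables Gam Gam' : connection M.
Hypothesis GG : forall x a b k, W x -> dom c x -> Gam x a b k = Gam' x a b k.

Lemma ricci_eq x b d : W x -> dom c x -> ricci c Gam x b d = ricci c Gam' x b d.
Proof.
move=> Wx cx; rewrite /ricci; congr (_ - _ + _ - _).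
- by apply: eq_bigr => a _; apply: (pd_eq oW) => // y Wy cy; exact: GG.
- by apply: eq_bigr => a _; apply: (pd_eq oW) => // y Wy cy; exact: GG.
- by apply: eq_bigr => a _; apply: eq_bigr => e _; rewrite !GG.
- by apply: eq_bigr => a _; apply: eq_bigr => e _; rewrite !GG.
Qed.

Lemma weight_eq x : W x -> dom c x -> weight Gam x = weight Gam' x.
Proof.
move=> Wx cx; congr (_ *: _); apply/rowP => a; rewrite !mxE.
by apply: eq_bigr => k _; rewrite GG.
Qed.

Lemma tractor_conn_mx_eq a x : W x -> dom c x ->
  tractor_conn_mx c Gam a x = tractor_conn_mx c Gam' a x.
Proof.
move=> Wx cx; have sE y : W y -> dom c y -> splitting Gam y = splitting Gam' y.
  by move=> Wy cy; rewrite !splittingE weight_eq.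
rewrite /tractor_conn_mx (pd_mx_eq oW a sE Wx cx) sE//; congr ((_ + _ *m _) *m _).
rewrite /split_conn_mx weight_eq//; congr block_mx.
  by apply/rowP => b; rewrite !mxE /schouten ricci_eq.
by congr (_ - _); apply/matrixP => k b; rewrite !mxE GG.
Qed.

End Congruence.

(** * The extended connection and the order of compactness *)

Section Compactness.
Context {R : realType} {n : nat} {M : manifold R n}.
Local Notation inner := (@inner R n M).
Hypothesis n_gt0 : (0 < n)%N.
Hypothesis boundary_coord : forall c (x : M), boundary x -> dom c x -> coord c x ord0 ord0 = 0.
Variable g : chart M -> M -> 'M[R]_n.+1.
Hypothesis g_metric : pseudo_riemannian g.
Hypothesis g_flat : ricci_flat g.

Let oi : open inner := open_inner boundary_coord.

Section LocalConnection.
Variables (alpha : R) (U : set M) (rho : M -> R) (c : chart M).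
Hypothesis alpha_gt0 : 0 < alpha.
Hypothesis rho_def : defining_function U rho.
Hypothesis hat_ext : forall a b k, extends_smoothly c U (fun y =>
  proj_change (levi_civita g c) (fun z => (alpha * rho z)^-1 *: differential c rho z) y a b k).

Local Notation LC := (levi_civita g c).

(** Inside, this is the differential of [ln rho / alpha], whence its closedness. *)
Definition log_form (z : M) : 'rV[R]_n.+1 := (alpha * rho z)^-1 *: differential c rho z.

Let V := U `&` dom c.
Let W := V `&` inner.

Lemma open_collar : open V.
Proof. by case: rho_def => oU _ _ _ _; apply: openI => //; exact: dom_open. Qed.
Let oV := open_collar.

Lemma open_collar_inner : open W.
Proof. exact: (open_innerI boundary_coord oV). Qed.
Let oW := open_collar_inner.

Lemma smooth_rho : smooth_in c V rho.
Proof.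
by case: rho_def => oU sr _ _ _; apply: smooth_in_sub (sr c) => // x [[]].
Qed.

Lemma smooth_to_inner f : smooth_in c V f -> smooth_in c W f.
Proof. by apply: smooth_in_sub => // x [[]]. Qed.

Lemma rho_gt0 x : W x -> 0 < rho x.
Proof.
move=> [[Ux _] ix]; case: rho_def => _ _ r0 rb _.
by rewrite lt_def r0// andbT; apply/eqP => /(rb x Ux).
Qed.

Lemma rho_boundary x : V x -> boundary x -> rho x = 0.
Proof. by move=> [Ux _] bx; case: rho_def => _ _ _ rb _; apply/(rb x Ux). Qed.

Lemma smooth_log_form : smooth_mx c W log_form.
Proof.
have sr := smooth_to_inner smooth_rho.
apply: (smooth_mxZ oW); last exact: smooth_differential.
apply: (smooth_inV oW); last exact: smooth_inZ.
by move=> x Wx _; rewrite mulf_neq0 ?gt_eqF ?rho_gt0.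
Qed.

Lemma pd_log_form a b x : W x ->
  pd c a (fun y => log_form y 0 b) x =
  (alpha * rho x)^-1 * pd c a (pd c b rho) x
  - alpha^-1 * (rho x) ^- 2 * (pd c a rho x * pd c b rho x).
Proof.
move=> Wx; have cx : dom c x by case: Wx => [[]].
have sr := smooth_to_inner smooth_rho; have sdr := smooth_in_pd oW b sr.
have a0 : alpha != 0 by rewrite gt_eqF.
have r0 : rho x != 0 by rewrite gt_eqF ?rho_gt0.
have sar : smooth_in c W (fun y => alpha * rho y) by exact: smooth_inZ.
have sarV : smooth_in c W (fun y => (alpha * rho y)^-1).
  apply: (smooth_inV oW) => // y Wy _.
  by rewrite mulf_neq0 ?gt_eqF ?rho_gt0.
rewrite (@pd_eq _ _ _ c W oW a _ (fun y => (alpha * rho y)^-1 * pd c b rho y))//; last first.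
  by move=> y _ _; rewrite !mxE.
rewrite (pdM _ Wx cx)// (pdV _ Wx cx)//; last by rewrite mulf_neq0.
rewrite (pdZ _ Wx cx)//.
by field; rewrite a0 r0.
Qed.

Lemma log_form_closed x a b : W x -> dom c x ->
  pd c a (fun y => log_form y 0 b) x = pd c b (fun y => log_form y 0 a) x.
Proof.
move=> Wx cx; rewrite (pd_log_form a b Wx) (pd_log_form b a Wx).
have sr : smooth_in c W rho by exact: (smooth_to_inner smooth_rho).
rewrite (pd_schwarz oW a Wx cx b sr).
by rewrite [pd c a rho x * _]mulrC.
Qed.

Definition ext_conn : connection M := fun y a b k => s2val (cid2 (hat_ext a b k)) y.
Local Notation hat := ext_conn.

Lemma smooth_ext_conn : smooth_conn c V hat.
Proof.
move=> a b k; have [oU _ _ _ _] := rho_def.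
have sF : smooth_in c U (fun x => hat x a b k) by rewrite /hat; case: cid2.
by apply: smooth_in_sub sF => // x [[]].
Qed.

Lemma ext_connE x a b k : W x -> hat x a b k = proj_change LC log_form x a b k.
Proof. by move=> [[Ux cx] ix]; rewrite /hat; case: cid2 => F /= _; exact. Qed.

Lemma ext_conn_sym x a b k : V x -> hat x a b k = hat x b a k.
Proof.
move=> Vx; have cx : dom c x by case: Vx.
apply: (smooth_in_lim boundary_coord oV (smooth_ext_conn a b k) (smooth_ext_conn b a k)) => // y Vy iy cy.
rewrite !ext_connE// /proj_change (levi_civita_sym boundary_coord g_metric)//.
by rewrite addrAC.
Qed.

Lemma smooth_LC : smooth_conn c W LC.
Proof.
move=> a b k; apply: (smooth_in_sub oi oW) (levi_civita_smooth boundary_coord g_metric c a b k).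
by move=> x [[_ ix] _].
Qed.

Lemma LC_symW x a b k : W x -> dom c x -> LC x a b k = LC x b a k.
Proof. by move=> [_ ix] cx; exact: (levi_civita_sym boundary_coord g_metric). Qed.

(** The left side is smooth up to the boundary, although the Levi-Civita coefficients on the right
    are singular there. *)
Lemma hat_tractor_conn a x : W x -> tractor_conn_mx c hat a x = tractor_conn_mx c LC a x.
Proof.
move=> Wx; have cx : dom c x by case: Wx => [[]].
rewrite (tractor_conn_mx_eq oW (Gam' := proj_change LC log_form))//; last first.
  by move=> y a' b k Wy _; exact: ext_connE.
exact: (tractor_conn_change n_gt0 oW smooth_LC LC_symW smooth_log_form log_form_closed).
Qed.

Lemma hat_weight x : W x -> weight hat x = weight LC x + log_form x.
Proof.
move=> Wx; have cx : dom c x by case: Wx => [[]].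
rewrite (weight_eq (W := W) (c := c) (Gam' := proj_change LC log_form))//; last first.
  by move=> y a' b k Wy _; exact: ext_connE.
exact: weight_change.
Qed.

(** The Schouten change from a flat right-hand side, multiplied by [rho ^ 2]. The Levi-Civita
    coefficients are re-expressed through the extended ones, so that every term makes sense on the
    boundary. *)
Lemma hat_schouten x b d : W x ->
  rho x ^+ 2 * schouten c hat x b d =
  (alpha^-1 - alpha^-2) * (pd c b rho x * pd c d rho x)
  + rho x * (alpha^-1 * (\sum_k pd c k rho x * hat x b d k - pd c b (pd c d rho) x)).
Proof.
move=> Wx; have cx : dom c x by case: Wx => [[]].
have ix : inner x by case: Wx.
have a0 : alpha != 0 by rewrite gt_eqF.
have r0 : rho x != 0 by rewrite gt_eqF ?rho_gt0.
have -> : schouten c hat x b d = schouten c (proj_change LC log_form) x b d.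
  rewrite /schouten; congr (_ * _); apply: (ricci_eq oW) => // y a' b' k Wy _.
  exact: ext_connE.
rewrite (schouten_change n_gt0 oW smooth_LC LC_symW smooth_log_form log_form_closed)//.
rewrite {1}/schouten g_flat// mulr0 pd_log_form//.
have -> : \sum_k pd c k rho x * hat x b d k =
    alpha * rho x * (\sum_k log_form x 0 k * LC x b d k + 2 * (log_form x 0 b * log_form x 0 d)).
  rewrite mulrDr mulr_sumr.
  rewrite (eq_bigr (fun k => alpha * rho x * (log_form x 0 k * LC x b d k)
    + (alpha * rho x * log_form x 0 k * log_form x 0 b) * (k == d)%:R
    + (alpha * rho x * log_form x 0 k * log_form x 0 d) * (k == b)%:R)).
    by rewrite !big_split /= !sum_delta; ring.
  move=> k _; rewrite ext_connE// /proj_change.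
  have -> : pd c k rho x = alpha * rho x * log_form x 0 k.
    by rewrite !mxE mulrA divff ?mul1r// mulf_neq0.
  ring.
have lE k : log_form x 0 k = (alpha * rho x)^-1 * pd c k rho x by rewrite !mxE.
set S := \sum_k log_form x 0 k * LC x b d k.
rewrite !lE; field.
by rewrite a0 r0.
Qed.

(* [rho ^+ 2 * P] vanishes on the boundary as [P] is smooth, while by
   Ricci-flatness it tends to [(1 / alpha - 1 / alpha ^ 2) rho_b rho_d]. *)
Lemma order_one x : V x -> boundary x -> alpha = 1.
Proof.
move=> Vx bx; have cx : dom c x by case: Vx.
have sr := smooth_rho; have rx := rho_boundary Vx bx.
have a0 : alpha != 0 by rewrite gt_eqF.
have key b d : (alpha^-1 - alpha^-2) * (pd c b rho x * pd c d rho x) = 0.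
  have sL : smooth_in c V (fun x => rho x ^+ 2 * schouten c hat x b d).
    apply: (smooth_inM oV); first exact: smooth_inX.
    exact: (smooth_schouten oV b d smooth_ext_conn).
  have sR : smooth_in c V (fun x => (alpha^-1 - alpha^-2) * (pd c b rho x * pd c d rho x)
    + rho x * (alpha^-1 * (\sum_k pd c k rho x * hat x b d k - pd c b (pd c d rho) x))).
    apply: (smooth_inD oV).
      by apply: (smooth_inZ oV); apply: (smooth_inM oV); exact: smooth_in_pd.
    apply: (smooth_inM oV) => //; apply: (smooth_inZ oV); apply: (smooth_inB oV).
      apply: (smooth_in_sum oV) => k _; apply: (smooth_inM oV); first exact: smooth_in_pd.
      exact: smooth_ext_conn.
    by apply: (smooth_in_pd oV); exact: smooth_in_pd.
  have := smooth_in_lim boundary_coord oV sL sR _ Vx cx.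
  rewrite rx expr0n !mul0r addr0 => <-// y Vy iy cy.
  by rewrite hat_schouten.
have : differential c rho x != 0.
  by case: rho_def => _ _ _ _; apply => //; case: Vx.
move=> /rV0Pn[b]; rewrite mxE => rb0.
have /eqP := key b b; rewrite mulf_eq0 mulf_eq0 orbb (negbTE rb0) orbF subr_eq0 => /eqP aa.
have : alpha ^+ 2 * alpha^-1 = alpha ^+ 2 * alpha ^- 2 by rewrite aa.
by rewrite mulfV ?expf_neq0// expr2 mulfK.
Qed.

End LocalConnection.

Hypothesis g_compact : projectively_compact g.

Lemma smooth_in_ge0_lim c V f x : open V -> smooth_in c V f -> V x -> dom c x ->
  (forall y, V y -> inner y -> dom c y -> 0 <= f y) -> 0 <= f x.
Proof.
move=> oV sf Vx cx f0; have cf := smooth_in_cont oV sf Vx cx.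
have -> : f x = `|f x|; last exact: normr_ge0.
apply: (@inner_lim _ _ _ boundary_coord f (fun y => `|f y|)) => //.
  exact: (cvg_norm cf).
have N1 : nbhs x V by exact: open_nbhs_nbhs.
have N2 : nbhs x (dom c) by apply: open_nbhs_nbhs; split=> //; exact: dom_open.
by apply: filterS2 N1 N2 => y Vy cy iy; rewrite ger0_norm// f0.
Qed.

(** What later arguments retain of compactness near a boundary point, with no reference to [alpha].
    By [collar_pd_u], [collar_u] is the component of a section of E(1) parallel for
    [collar_conn]. *)
Record collar (c : chart M) (V : set M) := Collar {
  collar_conn : connection M;
  collar_rho : M -> R;
  collar_u : M -> R;
  collar_form : M -> 'rV[R]_n.+1;
  collar_open : open V;
  collar_dom : V `<=` dom c;
  collar_conn_smooth : smooth_conn c V collar_conn;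
  collar_conn_sym : forall x a b k, V x -> collar_conn x a b k = collar_conn x b a k;
  collar_form_smooth : smooth_mx c (V `&` inner) collar_form;
  collar_connE : forall x a b k, V x -> inner x ->
    collar_conn x a b k = proj_change (levi_civita g c) collar_form x a b k;
  collar_tractor : forall a x, V x -> inner x ->
    tractor_conn_mx c collar_conn a x = tractor_conn_mx c (levi_civita g c) a x;
  collar_rho_smooth : smooth_in c V collar_rho;
  collar_rho_boundary : forall x, V x -> boundary x -> collar_rho x = 0;
  collar_rho_diff : forall x, V x -> boundary x -> differential c collar_rho x != 0;
  collar_u_smooth : smooth_in c V collar_u;
  collar_u_gt0 : forall x, V x -> 0 < collar_u x;
  collar_sigma : forall x, V x -> sigma g c x = collar_u x * collar_rho x;
  collar_pd_u : forall a x, V x ->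
    pd c a collar_u x = - weight collar_conn x 0 a * collar_u x }.

Lemma collar_exists c x : boundary x -> dom c x -> exists V, V x /\ inhabited (collar c V).
Proof.
move=> bx cx; have [alpha a0 /(_ x bx)[U [rho [Ux rd]]]] := g_compact.
move=> /(_ c) hext; pose V := U `&` dom c; have Vx : V x by split.
have a1 : alpha = 1 := order_one a0 rd hext Vx bx.
have oV := open_collar c rd; have oW := open_collar_inner c rd.
have sr := smooth_rho c rd; have srW := smooth_to_inner rd sr.
have sh := smooth_ext_conn rd hext.
have ssW : smooth_in c (V `&` inner) (sigma g c).
  apply: (smooth_in_sub oi oW) (sigma_smooth_inner boundary_coord g_metric c).
  by move=> y [[_ iy] _].
have r0 y : (V `&` inner) y -> rho y != 0 by move=> Wy; rewrite gt_eqF// (rho_gt0 rd Wy).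
have srV : smooth_in c (V `&` inner) (fun y => (rho y)^-1).
  by apply: (smooth_inV oW) => // y Wy _; exact: r0.
(* The reciprocal is extended along with [sigma / rho]: the product of the two extensions is 1 on
   the boundary by continuity, so the extension of [sigma / rho] has no zero there. *)
pose h (j : bool) (y : M) := if j then sigma g c y * (rho y)^-1 else rho y * (sigma g c y)^-1.
have s0 y : (V `&` inner) y -> sigma g c y != 0.
  by move=> [[_ cy] iy]; rewrite gt_eqF// (sigma_gt0 g_metric).
have ssV : smooth_in c (V `&` inner) (fun y => (sigma g c y)^-1).
  by apply: (smooth_inV oW) => // y Wy _; exact: s0.
have sh' j : smooth_in c (V `&` inner) (h j).
  by case: j; apply: (smooth_inM oW).
(* Because [alpha = 1], the singular term [d rho / rho] in the logarithmic derivative of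
   [sigma / rho] combines with the Levi-Civita weight into the weight of the extended connection. *)
have hatw a y : (V `&` inner) y ->
    weight (ext_conn hext) y 0 a = weight (levi_civita g c) y 0 a + (rho y)^-1 * pd c a rho y.
  by move=> Wy; rewrite (hat_weight hext Wy) mxE !mxE a1 mul1r.
pose A (a : 'I_n.+1) (j k : bool) (y : M) : R :=
  (if j then - weight (ext_conn hext) y 0 a else weight (ext_conn hext) y 0 a) * (j == k)%:R.
have [||a j y Vy iy cy|F [sF Fh dF]] := @smooth_in_linear_extension _ _ _ boundary_coord _ c V A h oV.
- move=> a j k; apply: (smooth_inM oV); last exact: smooth_in_cst.
  have sw : smooth_in c V (fun y => weight (ext_conn hext) y 0 a).
    exact: (smooth_weight oV sh).
  by case: j => //; exact: smooth_inN.
- exact: sh'.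
- have Wy : (V `&` inner) y by split.
  rewrite (eq_bigr (fun k => (if j then - weight (ext_conn hext) y 0 a
     else weight (ext_conn hext) y 0 a) * h k y * (j == k)%:R)); last first.
    by move=> k _; rewrite /A mulrAC.
  rewrite sum_delta_sym hatw//; have ry := r0 y Wy; have sy := s0 y Wy.
  case: j; rewrite /h (pdM _ Wy cy)//.
    rewrite (pdV _ Wy cy)// (pd_sigma boundary_coord g_metric)//.
    by field.
  rewrite (pdV _ Wy cy)// (pd_sigma boundary_coord g_metric)//.
  by field; rewrite sy ry.
have uv y : V y -> F true y * F false y = 1.
  move=> Vy; have cy : dom c y by case: Vy.
  apply: (smooth_in_lim boundary_coord oV (smooth_inM oV (sF true) (sF false))
    (smooth_in_cst c oV 1)) => // z Vz iz cz.
  rewrite !Fh// /h; have rz := r0 z (conj Vz iz); have sz := s0 z (conj Vz iz).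
  by field; rewrite rz sz.
exists V; split=> //; constructor.
apply: (@Collar c V (ext_conn hext) rho (F true) (log_form alpha rho c)) => //.
- by move=> y [].
- by move=> y a b k Vy; exact: (ext_conn_sym rd hext).
- exact: (smooth_log_form c a0 rd).
- by move=> y a b k Vy iy; apply: (ext_connE hext).
- by move=> a y Vy iy; apply: (hat_tractor_conn a0 rd hext).
- by move=> y Vy by'; exact: (rho_boundary rd Vy by').
- by move=> y [Uy cy] by'; case: rd => _ _ _ _; apply.
- move=> y Vy; have cy : dom c y by case: Vy.
  rewrite lt_def; apply/andP; split.
    by apply/eqP => F0; have := uv y Vy; rewrite F0 mul0r => /eqP; rewrite eq_sym oner_eq0.
  apply: (smooth_in_ge0_lim oV (sF true) Vy cy) => z Vz iz cz.
  rewrite Fh//= /h divr_ge0//; first by rewrite ltW// (sigma_gt0 g_metric).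
  by rewrite ltW// (rho_gt0 rd (conj Vz iz)).
- move=> y Vy; have cy : dom c y by case: Vy.
  have [iy|/contrapT by'] := pselect (inner y).
    by rewrite Fh//= /h divfK// r0.
  by rewrite (rho_boundary rd Vy by') mulr0 /sigma mem_set.
- move=> a y Vy; have cy : dom c y by case: Vy.
  rewrite dF// (eq_bigr (fun k => - weight (ext_conn hext) y 0 a * F k y * (true == k)%:R)); last first.
    by move=> k _; rewrite /A mulrAC.
  by rewrite sum_delta_sym.
Qed.

End Compactness.

(** * The tractor metric *)

Section TractorMetric.
Context {R : realType} {n : nat} {M : manifold R n}.
Local Notation inner := (@inner R n M).
Hypothesis n_gt0 : (0 < n)%N.
Hypothesis boundary_coord : forall c (x : M), boundary x -> dom c x -> coord c x ord0 ord0 = 0.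
Variable g : chart M -> M -> 'M[R]_n.+1.
Hypothesis g_metric : pseudo_riemannian g.
Hypothesis g_flat : ricci_flat g.
Hypothesis g_compact : projectively_compact g.

Let oi : open inner := open_inner boundary_coord.
Let oT : open [set: M] := openT.

Let collar_ex c x (bx : boundary x) (cx : dom c x) :
  exists V, V x /\ inhabited (collar g c V) :=
  collar_exists n_gt0 boundary_coord g_metric g_flat g_compact bx cx.

Lemma smooth_sigma c : smooth_in c setT (sigma g c).
Proof.
apply: smooth_in_local => // x _ cx.
have [ix|/contrapT bx] := pselect (inner x).
  by exists inner; split=> //; exact: sigma_smooth_inner.
have [V [Vx [K]]] := collar_ex bx cx; have oV := collar_open K.
exists V; split=> //; apply: (smooth_in_eq oV) (smooth_inM oV (collar_u_smooth K) (collar_rho_smooth K)).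
by move=> y Vy cy; rewrite (collar_sigma K).
Qed.

Lemma sigma_boundary c x : boundary x -> sigma g c x = 0.
Proof. by move=> bx; rewrite /sigma mem_set. Qed.

Lemma differential_sigma_boundary c x : boundary x -> dom c x ->
  differential c (sigma g c) x != 0.
Proof.
move=> bx cx; have [V [Vx [K]]] := collar_ex bx cx; have oV := collar_open K.
apply: contra (collar_rho_diff K Vx bx) => /eqP d0; apply/eqP/rowP => a.
have /rowP/(_ a) := d0; rewrite !mxE.
rewrite (@pd_eq _ _ _ c V oV a _ (fun y => collar_u K y * collar_rho K y))//; last first.
  by move=> y Vy _; exact: (collar_sigma K).
rewrite (pdM _ Vx cx) ?(collar_rho_boundary K Vx bx) ?mulr0 ?add0r//;
  [|exact: collar_u_smooth|exact: collar_rho_smooth].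
move/eqP; rewrite mulf_eq0 gt_eqF//=; first by move/eqP.
exact: (collar_u_gt0 K Vx).
Qed.

Lemma smooth_L_sigma c : smooth_mx c setT (L_sigma g c).
Proof.
move=> i j; case: (split_ordP j) => k ->.
  apply: (smooth_in_eq oT) (smooth_sigma c) => x _ _.
  by rewrite row_mxEl mxE (ord1 i) (ord1 k).
apply: (smooth_in_eq oT) (smooth_in_pd oT k (smooth_sigma c)) => x _ _.
by rewrite row_mxEr mxE.
Qed.

Lemma collar_inner_form c V (K : collar g c V) : exists2 F : M -> 'M[R]_(1 + n.+1),
  smooth_mx c V F & forall x, V x -> inner x -> F x = inner_form g c x.
Proof.
have oV := collar_open K; have oW := open_innerI boundary_coord oV.
pose Om a x := tractor_conn_mx c (collar_conn K) a x.
have sOm a : smooth_mx c V (Om a) by exact: (smooth_tractor_conn_mx oV a (collar_conn_smooth K)).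
pose I := 'I_(1 + n.+1).
(* The map sending [H] to [Om H + H Om^T], as a linear map on matrix entries indexed by pairs. *)
pose A (a : 'I_n.+1) (p q : I * I) (x : M) : R :=
  Om a x p.1 q.1 * (p.2 == q.2)%:R + (p.1 == q.1)%:R * Om a x p.2 q.2.
pose h (p : I * I) (x : M) := inner_form g c x p.1 p.2.
have [|p|a p x Vx ix cx|F [sF Fh _]] := @smooth_in_linear_extension _ _ _ boundary_coord _ c V A h oV.
- move=> a p q; apply: (smooth_inD oV); apply: (smooth_inM oV);
    first [exact: sOm|exact: smooth_in_cst].
- apply: (smooth_in_sub oi oW) (smooth_inner_form boundary_coord g_metric c p.1 p.2).
  by move=> x [[_ ix] _].
- transitivity (pd_mx c a (inner_form g c) x p.1 p.2); first by rewrite mxE.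
  rewrite (pd_inner_form boundary_coord g_metric g_flat)// -(collar_tractor K a Vx ix) -/(Om a x).
  rewrite -(pair_bigA _ (fun k l => A a p (k, l) x * h (k, l) x)) /=.
  rewrite (eq_bigr (fun k => Om a x p.1 k * inner_form g c x k p.2
    + (\sum_l inner_form g c x k l * Om a x p.2 l) * (p.1 == k)%:R)); last first.
    move=> k _; rewrite /A /h /=.
    rewrite (eq_bigr (fun l => (Om a x p.1 k * inner_form g c x k l) * (p.2 == l)%:R
      + inner_form g c x k l * Om a x p.2 l * (p.1 == k)%:R)); last first.
      by move=> l _; ring.
    by rewrite big_split /= sum_delta_sym -mulr_suml.
  rewrite big_split /= sum_delta_sym !mxE; congr (_ + _).
  by apply: eq_bigr => l _; rewrite [(Om a x)^T _ _]mxE.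
exists (fun x => \matrix_(i, j) F (i, j) x).
  by move=> i j; apply: (smooth_in_eq oV) (sF (i, j)) => x _ _; rewrite mxE.
move=> x Vx ix; have cx := collar_dom K Vx.
by apply/matrixP => i j; rewrite mxE Fh.
Qed.

Lemma inner_form_extension c : exists2 F : M -> 'M[R]_(1 + n.+1),
  smooth_mx c setT F & forall x, inner x -> dom c x -> F x = inner_form g c x.
Proof.
have H i j : exists2 f : M -> R, smooth_in c setT f &
    forall x, setT x -> inner x -> dom c x -> f x = inner_form g c x i j.
  apply: (smooth_in_glue boundary_coord oT); last first.
    by rewrite setTI; exact: (smooth_inner_form boundary_coord g_metric c i j).
  move=> x _ bx cx; have [V [Vx [K]]] := collar_ex bx cx.
  have [F sF FE] := collar_inner_form K.
  exists V, (fun y => F y i j); split=> //; first exact: collar_open K.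
  by move=> y Vy _ iy cy; rewrite FE.
exists (fun x => \matrix_(i, j) s2val (cid2 (H i j)) x).
  move=> i j; apply: (smooth_in_eq oT _ (s2valP (cid2 (H i j)))) => x _ _.
  by rewrite mxE.
move=> x ix cx; apply/matrixP => i j; rewrite mxE.
by case: cid2 => f /= _; apply.
Qed.

Definition tractor_form_of (c : chart M) : M -> 'M[R]_(1 + n.+1) :=
  s2val (cid2 (inner_form_extension c)).
Local Notation H := tractor_form_of.

Lemma smooth_tractor_form c : smooth_mx c setT (H c).
Proof. by rewrite /H; case: cid2. Qed.

Lemma tractor_formE c x : inner x -> dom c x -> H c x = inner_form g c x.
Proof. by move=> ix cx; rewrite /H; case: cid2 => F /= _; apply. Qed.

Lemma tractor_form_sym c x : dom c x -> (H c x)^T = H c x.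
Proof.
move=> cx; apply/matrixP => i j; rewrite mxE.
apply: (smooth_in_lim boundary_coord oT (smooth_tractor_form c j i) (smooth_tractor_form c i j)) => //.
move=> y _ iy cy; rewrite tractor_formE//.
by rewrite -[in RHS](inner_form_sym g_metric iy cy) [RHS]mxE.
Qed.

Lemma L_sigma_tractor_form c x : dom c x -> L_sigma g c x *m H c x = 0.
Proof.
move=> cx; apply/matrixP => i j; rewrite [RHS]mxE.
have sLH := smooth_mxM oT (smooth_L_sigma c) (smooth_tractor_form c).
apply: (smooth_in_lim boundary_coord oT (sLH i j) (smooth_in_cst c oT 0)) => //.
by move=> y _ iy cy; rewrite tractor_formE// (L_sigma_form boundary_coord g_metric)// mxE.
Qed.

Lemma L_sigma_boundary c x : boundary x ->
  L_sigma g c x = row_mx 0 (differential c (sigma g c) x).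
Proof. by move=> bx; rewrite /L_sigma sigma_boundary// raddf0. Qed.

Lemma L_sigma_neq0 c x : dom c x -> L_sigma g c x != 0.
Proof.
move=> cx; have [ix|/contrapT bx] := pselect (inner x).
  have := sigma_neq0 g_metric ix cx; apply: contra => /eqP L0.
  have /eqP := L0; rewrite /L_sigma row_mx_eq0 => /andP[/eqP /matrixP/(_ 0 0) + _].
  by rewrite !mxE eqxx mulr1n => ->.
rewrite L_sigma_boundary// row_mx_eq0 eqxx /=.
exact: differential_sigma_boundary.
Qed.

Lemma tractor_form_kernel c x : dom c x -> (kermx (H c x) == L_sigma g c x)%MS.
Proof.
move=> cx; have L0 := L_sigma_neq0 cx; have /rV0Pn[j Lj] := L0.
(* [v] is the basis covector of a nonzero component of [L], so that [L v^T] is nonzero. *)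
apply: (kernel_line L0 (L_sigma_tractor_form cx) (v := delta_mx 0 j)).
set v : 'rV[R]_(1 + n.+1) := delta_mx 0 j.
have sd : smooth_in c setT (fun y => \det (H c y + v^T *m v) ^+ 2).
  apply: (smooth_inX oT); apply: (smooth_in_det oT).
  by apply: (smooth_mxD oT); [exact: smooth_tractor_form|exact: smooth_mx_const].
have sL : smooth_in c setT (fun y => (L_sigma g c y *m v^T) 0 0 ^+ 4).
  apply: (smooth_inX oT); apply: (smooth_mxM oT); first exact: smooth_L_sigma.
  exact: smooth_mx_const.
have E : \det (H c x + v^T *m v) ^+ 2 = (L_sigma g c x *m v^T) 0 0 ^+ 4.
  apply: (smooth_in_lim boundary_coord oT sd sL) => // y _ iy cy.
  by rewrite tractor_formE// (det_inner_form boundary_coord g_metric).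
rewrite -sqrf_eq0 E expf_neq0// /v trmx_delta -colE mxE.
exact: Lj.
Qed.

Lemma sigma_transition (c c' : chart M) (x : M) : inner x -> dom c x -> dom c' x ->
  sigma g c x = density_transition c c' x * sigma g c' x.
Proof.
move=> ix cx c'x; rewrite /sigma memNset// /density_transition -powRM ?sqrtr_ge0//.
congr (_ `^ _); case: g_metric => _ _ _ /(_ c c' x ix cx c'x) ->.
rewrite !det_mulmx det_tr [_ * \det (g c' x)]mulrC -mulrA -expr2 normrM normrX sqrtrM//.
by rewrite sqrtr_sqr normr_id mulrC.
Qed.

Lemma smooth_density_transition (c c' : chart M) : smooth_in c (dom c') (density_transition c c').
Proof.
have oc := @dom_open R n M c'.
have sJ : smooth_mx c (dom c') (jacobian c c') by move=> i j; exact: smooth_in_jacobian.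
have d0 x : dom c' x -> dom c x -> \det (jacobian c c' x) != 0.
  by move=> c'x cx; have := jacobian_unit cx c'x; rewrite unitmxE unitfE.
apply: (@smooth_in_eq _ _ _ c _ oc
  (fun x => (\det (jacobian c c' x) ^+ 2) `^ (2^-1 * - (n.+2%:R)^-1))).
  by move=> x c'x cx; rewrite /density_transition norm_powR_sqr// d0.
apply: (smooth_in_powR oc); last by apply: (smooth_inX oc); exact: (smooth_in_det oc).
by move=> x c'x cx; rewrite exprn_even_gt0//= d0.
Qed.

Lemma density_transition_gt0 (c c' : chart M) (x : M) : dom c x -> dom c' x -> 0 < density_transition c c' x.
Proof.
move=> cx c'x; rewrite powR_gt0// normr_gt0.
by have := jacobian_unit cx c'x; rewrite unitmxE unitfE.
Qed.

Lemma smooth_jet_transition (c c' : chart M) : smooth_mx c (dom c') (jet_transition c c').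
Proof.
have oc := @dom_open R n M c'; have sD := @smooth_density_transition c c'.
apply: (smooth_mx_block oc).
- exact: smooth_mx_scalar.
- exact: smooth_differential.
- exact: smooth_mx_const.
- by apply: (smooth_mxZ oc) => // i j; exact: smooth_in_jacobian.
Qed.

Lemma differential_sigma_transition (c c' : chart M) (x : M) : inner x -> dom c x -> dom c' x ->
  differential c (sigma g c) x = sigma g c' x *: differential c (density_transition c c') x
    + density_transition c c' x *: (differential c' (sigma g c') x *m jacobian c c' x).
Proof.
move=> ix cx c'x; have oW := openI oi (@dom_open R n M c').
have Wx : (inner `&` dom c') x by [].
have sD : smooth_in c (inner `&` dom c') (density_transition c c').
  apply: (smooth_in_sub (@dom_open R n M c') oW) (@smooth_density_transition c c').
  by move=> y [[]].
have ss : smooth_in c (inner `&` dom c') (sigma g c).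
  by apply: (smooth_in_sub oT oW) (smooth_sigma c).
have ss' : smooth_in c (inner `&` dom c') (sigma g c').
  apply: (@smooth_in_eq _ _ _ c _ oW (fun y => sigma g c y * (density_transition c c' y)^-1)).
    move=> y [iy c'y] cy; rewrite (sigma_transition iy cy c'y) mulrAC divff ?mul1r//.
    by rewrite gt_eqF ?density_transition_gt0.
  apply: (smooth_inM oW) => //; apply: (smooth_inV oW) => // y [iy c'y] cy.
  by rewrite gt_eqF ?density_transition_gt0.
rewrite -(differential_chain oT (smooth_sigma c') _ cx c'x)//.
apply/rowP => a; rewrite !mxE.
rewrite (@pd_eq _ _ _ c _ oW a _ (fun y => density_transition c c' y * sigma g c' y) x
  (fun y Wy cy => sigma_transition Wy.1 cy Wy.2) Wx cx).
by rewrite (pdM _ Wx cx)//; ring.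
Qed.

(** The Levi-Civita weight is [- d sigma / sigma], so [sigma] alone determines the splitting. Since
    [sigma] transforms as a section of E(1), the jet transition becomes block diagonal between the
    two splittings, and there the scaling of [sigma ^- 2] matches that of the inverse metric. *)
Lemma inner_form_transition (c c' : chart M) (x : M) : inner x -> dom c x -> dom c' x ->
  inner_form g c' x = jet_transition c c' x *m inner_form g c x *m (jet_transition c c' x)^T.
Proof.
move=> ix cx c'x; have s0 := sigma_neq0 g_metric ix cx; have s0' := sigma_neq0 g_metric ix c'x.
set D := density_transition c c' x; set J := jacobian c c' x.
have D0 : D != 0 by rewrite gt_eqF ?density_transition_gt0.
have sE : sigma g c x = D * sigma g c' x by exact: sigma_transition.
have wE (d : chart M) : dom d x -> weight (levi_civita g d) x =
    - (sigma g d x)^-1 *: differential d (sigma g d) x.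
  move=> dx; rewrite (differential_sigma boundary_coord g_metric ix dx) scalerA.
  have sd0 : sigma g d x != 0 by exact: sigma_neq0.
  by rewrite mulrNN mulVf// scale1r.
have TS : jet_transition c c' x *m splitting (levi_civita g c) x =
    splitting (levi_civita g c') x *m block_mx D%:M 0 0 (D *: J).
  rewrite !splittingE !wE// (differential_sigma_transition ix cx c'x) -/D -/J sE.
  rewrite /jet_transition /shear -/D -/J !mulmx_block.
  rewrite !(mulmx0, mul0mx, mul1mx, mulmx1, addr0, add0r); congr block_mx.
  rewrite mul_scalar_mx -scalemxAr -scalemxAl.
  apply/rowP => a; rewrite !mxE.
  set S := \sum_j _; have -> : S = (differential c' (sigma g c') x *m J) 0 a by rewrite mxE.
  by field; rewrite D0 s0'.
have JG : J *m invmx (g c x) *m J^T = invmx (g c' x).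
  case: (g_metric) => _ _ gu gt; rewrite (gt c c' x ix cx c'x) -/J.
  have uJ : J \in unitmx by exact: jacobian_unit.
  have uJT : J^T \in unitmx by rewrite unitmx_tr.
  have uG := gu c' x ix c'x.
  rewrite invmx_mul ?unitmx_mul ?uJT// invmx_mul// !mulmxA mulmxV// mul1mx.
  by rewrite mulmxKV.
have XH : block_mx D%:M 0 0 (D *: J) *m split_inner_form g c x *m (block_mx D%:M 0 0 (D *: J))^T
    = split_inner_form g c' x.
  rewrite /split_inner_form tr_block_mx !trmx0 !mulmx_block.
  rewrite !(mulmx0, mul0mx, addr0, add0r); congr block_mx.
  rewrite [(D *: J)^T]linearZ /= -!scalemxAl -!scalemxAr -!scalemxAl JG !scalerA.
  congr (_ *: _).
  rewrite sE; field.
  by rewrite D0 s0'.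
rewrite /inner_form !mulmxA TS -XH !mulmxA -[RHS]mulmxA -trmx_mul TS trmx_mul !mulmxA.
by [].
Qed.

Lemma tractor_form_transition (c c' : chart M) (x : M) : dom c x -> dom c' x ->
  H c' x = jet_transition c c' x *m H c x *m (jet_transition c c' x)^T.
Proof.
move=> cx c'x; have oc := @dom_open R n M c'.
have sH : smooth_mx c (dom c') (H c).
  by move=> i j; apply: (smooth_in_sub oT oc) (smooth_tractor_form c i j).
have sT := @smooth_jet_transition c c'.
have sR := smooth_mxM oc (smooth_mxM oc sT sH) (smooth_mxT oc sT).
apply/matrixP => i j.
apply: (@inner_lim _ _ _ boundary_coord (fun y => H c' y i j)
  (fun y => (jet_transition c c' y *m H c y *m (jet_transition c c' y)^T) i j)).
- exact: (smooth_in_cont oT (smooth_tractor_form c' i j) _ c'x).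
- exact: (smooth_in_cont oc (sR i j) c'x cx).
have N1 : nbhs x (dom c') by exact: open_nbhs_nbhs.
have N2 : nbhs x (dom c) by apply: open_nbhs_nbhs; split=> //; exact: dom_open.
apply: filterS2 N1 N2 => y c'y cy iy.
by rewrite !tractor_formE// (inner_form_transition iy cy c'y).
Qed.

Lemma special_levi_civita c : special_connection g c (inner `&` dom c) (levi_civita g c)
  /\ parallel_on c (inner `&` dom c) (levi_civita g c) (H c).
Proof.
have oW := openI oi (@dom_open R n M c).
have sLC : smooth_conn c (inner `&` dom c) (levi_civita g c).
  move=> a b k; apply: (smooth_in_sub oi oW) (levi_civita_smooth boundary_coord g_metric c a b k).
  by move=> x [[]].
split; last first.
  apply: (parallel_onP oW) => //.
    by move=> i j; apply: (smooth_in_sub oT oW) (smooth_tractor_form c i j).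
  move=> a x [ix cx]; rewrite tractor_formE//.
  rewrite (pd_mx_eq oW a (G := inner_form g c))//; last by move=> y [iy cy] _; exact: tractor_formE.
  exact: (pd_inner_form boundary_coord g_metric g_flat).
split=> //.
- by move=> x a b k [ix cx]; exact: (levi_civita_sym boundary_coord g_metric).
- exists (fun=> 0).
    move=> a; apply: smooth_mx_const.
    by apply: openI => //; exact: oi.
  by move=> x a b k _ _; rewrite /proj_change !mxE !mul0r !addr0.
(* The volume density [|det g| ^ (1/2)] of [g], as a power of a square. *)
exists (fun x => (\det (g c x) ^+ 2) `^ (4^-1)); split.
- apply: (smooth_in_sub oi oW) (sqr_det_powR_smooth boundary_coord g_metric c (4^-1)).
  by move=> x [[]].
- move=> x [ix cx]; rewrite powR_gt0// exprn_even_gt0//=.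
  exact: (metric_det_neq0 g_metric).
move=> x [ix cx]; apply/rowP => a; rewrite [LHS]mxE.
have d0 := metric_det_neq0 g_metric ix cx.
rewrite (pd_sqr_powR _ _ oi (det_smooth boundary_coord g_metric c))//.
rewrite (pd_det_metric boundary_coord g_metric)// [RHS]mxE.
by field.
Qed.

Lemma special_collar c V (K : collar g c V) :
  special_connection g c V (collar_conn K) /\ parallel_on c V (collar_conn K) (H c).
Proof.
have oV := collar_open K; have sG := collar_conn_smooth K; have Vc := collar_dom K.
have sH : smooth_mx c V (H c).
  by move=> i j; apply: (smooth_in_sub oT oV) (smooth_tractor_form c i j).
split; last first.
  apply: (parallel_onP oV) => // a x Vx; have cx := Vc x Vx.
  have sOm := smooth_tractor_conn_mx oV a sG.
  have sR := smooth_mxD oV (smooth_mxM oV sOm sH) (smooth_mxM oV sH (smooth_mxT oV sOm)).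
  apply/matrixP => i j.
  apply: (smooth_in_lim boundary_coord oV (smooth_mx_pd oV a sH i j) (sR i j)) => //.
  move=> y Vy iy cy; rewrite (collar_tractor K a Vy iy) tractor_formE//.
  rewrite (pd_mx_eq oi a (G := inner_form g c))//; last by move=> z iz cz; exact: tractor_formE.
  by rewrite (pd_inner_form boundary_coord g_metric g_flat).
split=> //.
- by move=> x a b k Vx; exact: (collar_conn_sym K).
- exists (collar_form K); first by move=> a; exact: (collar_form_smooth K).
  by move=> x a b k Vx ix; exact: (collar_connE K).
(* E(1) is the power [- 1 / (n + 2)] of the volume densities, so the parallel density is the power
   [- (n + 2)] of [u]. *)
exists (fun x => (collar_u K x)^-1 ^+ n.+2).
have u0 x : V x -> collar_u K x != 0 by move=> Vx; rewrite gt_eqF// (collar_u_gt0 K).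
have su : smooth_in c V (fun x => (collar_u K x)^-1).
  by apply: (smooth_inV oV); [move=> x Vx _; exact: u0|exact: collar_u_smooth].
split; first exact: smooth_inX.
  by move=> x Vx; rewrite exprn_gt0// invr_gt0 (collar_u_gt0 K).
move=> x Vx; have cx := Vc x Vx; apply/rowP => a; rewrite [LHS]mxE.
have pdX k : pd c a (fun x => (collar_u K x)^-1 ^+ k) x =
    k%:R * weight (collar_conn K) x 0 a * (collar_u K x)^-1 ^+ k.
  elim: k => [|k IH].
    rewrite (@pd_eq _ _ _ c V oV a _ (fun=> 1)) ?pd_cst ?mul0r//.
  rewrite (@pd_eq _ _ _ c V oV a _ (fun y => (collar_u K y)^-1 * (collar_u K y)^-1 ^+ k))//; last first.
    by move=> y _ _; rewrite exprS.
  rewrite (pdM _ Vx cx)//; last exact: smooth_inX.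
  rewrite IH (pdV _ Vx cx) ?u0//; last exact: collar_u_smooth.
  rewrite (collar_pd_u K)// [_ ^+ k.+1]exprS -natr1; move: (u0 x Vx) => ux.
  by move: ((collar_u K x)^-1 ^+ k) => vk; field.
rewrite pdX [RHS]mxE [weight _ _ _ _]mxE.
by rewrite mulVKf ?pnatr_eq0// mulrC.
Qed.

Lemma tractor_metric_form : tractor_metric g H.
Proof.
split.
- split=> [c i j|c x|c c' x]; first exact: smooth_tractor_form.
    exact: tractor_form_sym.
  exact: tractor_form_transition.
- move=> c x t t' ix cx; rewrite /form_eval tractor_formE// /inner_form.
  by rewrite trmx_mul !mulmxA.
- move=> c x cx; have [ix|/contrapT bx] := pselect (inner x).
    exists (inner `&` dom c), (levi_civita g c); have [sp pa] := special_levi_civita c.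
    by split; [exact: (openI oi (@dom_open R n M c))|by []|by move=> y []|exact: sp|exact: pa].
  have [V [Vx [K]]] := collar_ex bx cx; exists V, (collar_conn K).
  have [sp pa] := special_collar K.
  by split; [exact: collar_open K|by []|exact: collar_dom K|exact: sp|exact: pa].
- by move=> c x; exact: tractor_form_kernel.
Qed.

End TractorMetric.

(** * Ranks on the boundary *)

Lemma rank_col_mx_le {F : fieldType} m1 m2 p (A : 'M[F]_(m1, p)) (B : 'M[F]_(m2, p)) :
  (\rank (col_mx A B) <= \rank A + \rank B)%N.
Proof. by rewrite -addsmxE; have [] := mxrank_adds_leqif A B. Qed.

Lemma rank_row_mx_le {F : fieldType} m p1 p2 (A : 'M[F]_(m, p1)) (B : 'M[F]_(m, p2)) :
  (\rank (row_mx A B) <= \rank A + \rank B)%N.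
Proof. by rewrite -mxrank_tr tr_row_mx -(mxrank_tr A) -(mxrank_tr B) rank_col_mx_le. Qed.

Section RankLemma.
Context {R : realType} {n : nat}.
Variables (H : 'M[R]_(1 + n.+1)) (l : 'rV[R]_n.+1).
Hypothesis symH : H^T = H.
Hypothesis l_neq0 : l != 0.
Hypothesis kerH : (kermx H == row_mx 0 l)%MS.

Let h := dlsubmx H.
Let B := drsubmx H.

Definition canonical_vector : 'cV[R]_(1 + n.+1) := col_mx 1%:M 0.

Let LH : row_mx 0 l *m H = 0.
Proof. by apply/sub_kermxP; case/andP: kerH. Qed.

Let ursub_H : ursubmx H = h^T.
Proof. by rewrite /h -[in LHS]symH -trmx_dlsub. Qed.

Let rank_H : \rank H = n.+1.
Proof.
have := mxrank_ker H; case/andP: kerH => k1 k2.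
have -> : \rank (kermx H) = 1%N.
  by rewrite (eqmxP kerH) rank_rV row_mx_eq0 eqxx l_neq0.
by have := rank_leq_row H; move: (\rank H) => r; lia.
Qed.

Lemma kernel_lower : l *m h = 0 /\ l *m B = 0.
Proof.
have := LH; rewrite -{1}[H]submxK mul_row_block !mul0mx !add0r -[0]row_mx0.
by move/eq_row_mx.
Qed.

(** [H] being symmetric, its row space is the annihilator of its kernel. It contains the canonical
    vector because the kernel has zero first slot on the boundary. *)
Lemma canonical_preimage : exists p : 'rV[R]_(1 + n.+1),
  p *m H = canonical_vector^T /\
  tilde_metric H canonical_vector canonical_vector = p 0 0.
Proof.
have HL : (H == kermx (row_mx 0 l)^T)%MS.
  have sHL : (H <= kermx (row_mx 0 l)^T)%MS.
    by apply/sub_kermxP; rewrite -symH -trmx_mul LH trmx0.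
  have [_ E] := mxrank_leqif_eq sHL; rewrite -E rank_H mxrank_ker mxrank_tr.
  by rewrite rank_rV row_mx_eq0 eqxx l_neq0 /= add1n subn1.
exists (canonical_vector^T *m pinvmx H); split.
  apply: mulmxKpV; rewrite (eqmxP HL); apply/sub_kermxP.
  by rewrite -trmx_mul /canonical_vector mul_row_col mul0mx mulmx0 addr0 trmx0.
rewrite /tilde_metric /canonical_vector -[X in X *m col_mx _ _]hsubmxK mul_row_col mulmx0 addr0.
by rewrite mulmx1 mxE; congr (fun_of_matrix _ 0 _); exact: val_inj.
Qed.

Let kerB_l : (l <= kermx B)%MS.
Proof. by apply/sub_kermxP; have [] := kernel_lower. Qed.

(** Here the preimage is [(0, p')] with [p' h = 1] and [p' B = 0], whereas [l] kills both [h] and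
    [B]: the kernel of [B] has dimension at least 2. Conversely, deleting one row and one column
    from [H] lowers its rank by at most 2. *)
Lemma rank_block_isotropic : tilde_metric H canonical_vector canonical_vector = 0 ->
  \rank B = n.-1.
Proof.
have [p [pH ->]] := canonical_preimage => p0.
have [lh lB] := kernel_lower.
have pE : p = row_mx 0 (rsubmx p).
  rewrite -{1}[p]hsubmxK; congr row_mx; apply/matrixP => i j.
  rewrite (ord1 i) (ord1 j) !mxE -p0; congr (p _ _); exact: val_inj.
set p' := rsubmx p in pE.
have [ph pB] : p' *m h = 1%:M /\ p' *m B = 0.
  move: pH; rewrite pE -{1}[H]submxK mul_row_block !mul0mx !add0r.
  by rewrite /canonical_vector tr_col_mx trmx1 trmx0 => /eq_row_mx.
have rK : (1 < \rank (kermx B))%N.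
  have sK : (kermx (row_mx h B) < kermx B)%MS.
    rewrite /ltmx; apply/andP; split.
      apply/sub_kermxP; have := mulmx_ker (row_mx h B).
      by rewrite mul_mx_row -[0]row_mx0 => /eq_row_mx[].
    apply/negP => s; have : (p' <= kermx (row_mx h B))%MS.
      by apply: submx_trans s; apply/sub_kermxP.
    move/sub_kermxP; rewrite mul_mx_row -[0]row_mx0 => /eq_row_mx[+ _].
    rewrite ph => /matrixP/(_ 0 0); rewrite !mxE => /eqP.
    by rewrite oner_eq0.
  apply: leq_ltn_trans (rank_ltmx sK).
  have : (\rank l <= \rank (kermx (row_mx h B)))%N.
    by apply: mxrankS; apply/sub_kermxP; rewrite mul_mx_row lh lB row_mx0.
  by rewrite rank_rV l_neq0.
have le1 : (\rank H <= 1 + (1 + \rank B))%N.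
  rewrite -[H]submxK block_mxEv; apply: leq_trans (rank_col_mx_le _ _) _.
  apply: leq_add; first exact: rank_leq_row.
  by apply: leq_trans (rank_row_mx_le _ _) _; rewrite leq_add2r rank_leq_col.
rewrite rank_H in le1; rewrite mxrank_ker in rK; move: le1 rK.
by move: (\rank B) => r; lia.
Qed.

(** The first slot of the preimage is invertible, so [h] lies in the column space of [B]. Whatever
    kills [B] then kills [h], hence gives an element of the kernel of [H], which is spanned by
    [(0, l)]. *)
Lemma rank_block_nonisotropic : tilde_metric H canonical_vector canonical_vector != 0 ->
  \rank B = n.
Proof.
have [p [pH ->]] := canonical_preimage => p0.
have [lh lB] := kernel_lower.
set a := p 0 0 in p0; set p' := rsubmx p.
have pE : p = row_mx a%:M p'.
  rewrite -{1}[p]hsubmxK; congr row_mx; apply/matrixP => i j.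
  rewrite (ord1 i) (ord1 j) !mxE eqxx mulr1n /a; congr (p _ _); exact: val_inj.
have pB : a *: h^T + p' *m B = 0.
  move: pH; rewrite pE -{1}[H]submxK mul_row_block ursub_H.
  by rewrite /canonical_vector tr_col_mx trmx1 trmx0 => /eq_row_mx[_]; rewrite mul_scalar_mx.
have symB : B^T = B by rewrite /B trmx_drsub symH.
have hE : h = - a^-1 *: (B *m p'^T).
  have := congr1 trmx pB; rewrite linearD linearZ /= trmxK trmx_mul symB trmx0.
  move/eqP; rewrite addr_eq0 => /eqP ah.
  by rewrite scaleNr -scalerN -ah scalerA mulVf// scale1r.
have sK : (kermx B <= l)%MS.
  have kh : kermx B *m h = 0 by rewrite hE -scalemxAr mulmxA mulmx_ker mul0mx scaler0.
  have : (row_mx (0 : 'cV[R]_n.+1) (kermx B) <= row_mx (0 : 'M[R]_1) l)%MS.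
    have /andP[k1 _] := kerH; apply: (submx_trans _ k1).
    apply/sub_kermxP; rewrite -[H]submxK mul_row_block !mul0mx !add0r.
    by rewrite kh mulmx_ker row_mx0.
  move=> /submxP[D]; rewrite mul_mx_row => /eq_row_mx[_ ->].
  exact: submxMl.
have := mxrankS sK; have := mxrankS kerB_l; rewrite rank_rV l_neq0 mxrank_ker.
have := rank_leq_row B; move: (\rank B) => r; lia.
Qed.

Lemma canonical_lineP (v : 'cV[R]_(1 + n.+1)) : canonical_line v <->
  v = v 0 0 *: canonical_vector.
Proof.
split=> [cv|->].
  have d0 : dsubmx v = 0.
    apply/colP => i; have := cv (delta_mx 0 i).
    rewrite -{1}[v]vsubmxK mul_row_col mul0mx add0r -rowE => /matrixP/(_ 0 0).
    by rewrite !mxE.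
  rewrite -[LHS]vsubmxK d0 /canonical_vector scale_col_mx scaler0; congr col_mx.
  apply/matrixP => i j; rewrite (ord1 i) (ord1 j) !mxE eqxx mulr1; congr (v _ _); exact: val_inj.
by move=> mu; rewrite -scalemxAr mul_row_col mul0mx mulmx0 addr0 scaler0.
Qed.

Lemma canonical_vector_line : canonical_line canonical_vector.
Proof. by move=> mu; rewrite mul_row_col mul0mx mulmx0 addr0. Qed.

Lemma canonical_vector_neq0 : canonical_vector != 0.
Proof.
rewrite col_mx_eq0 eqxx andbT; apply/eqP => /matrixP/(_ 0 0).
by rewrite !mxE => /eqP; rewrite oner_eq0.
Qed.

Lemma tilde_metricZ (a : R) (v : 'cV[R]_(1 + n.+1)) :
  tilde_metric H (a *: v) (a *: v) = a ^+ 2 * tilde_metric H v v.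
Proof.
rewrite /tilde_metric [(a *: v)^T]linearZ /= -!scalemxAl -scalemxAr scalerA mxE.
by rewrite expr2.
Qed.

End RankLemma.

(** * Curved orbits and asymptotics of the inverse metric *)

Lemma form_eval_delta {R : realType} {n : nat} (A : 'M[R]_(1 + n.+1)) k l :
  form_eval A (delta_mx 0 k) (delta_mx 0 l) = A k l.
Proof. by rewrite /form_eval -rowE trmx_delta -colE !mxE. Qed.

Section Orbits.
Context {R : realType} {n : nat} {M : manifold R n}.
Local Notation inner := (@inner R n M).
Hypothesis n_gt0 : (0 < n)%N.
Variable g : chart M -> M -> 'M[R]_n.+1.
Hypothesis g_metric : pseudo_riemannian g.
Hypothesis g_flat : ricci_flat g.
Hypothesis g_compact : projectively_compact g.

Let bc := compact_boundary_coord g_compact.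
Let oi : open inner := open_inner bc.
Let oT : open [set: M] := openT.
Local Notation H := (tractor_form_of n_gt0 bc g_metric g_flat g_compact).
Local Notation L := (L_sigma g).

(** [orbit] quantifies existentially over tractor metrics; this replaces any witness by the form
    constructed above. *)
Lemma tractor_metric_unique H' c x : tractor_metric g H' -> dom c x -> H' c x = H c x.
Proof.
move=> [[sH' _ _] H'E _ _] cx; apply/matrixP => i j.
apply: (smooth_in_lim bc oT (sH' c i j) (smooth_tractor_form n_gt0 bc g_metric g_flat g_compact c i j)) => //.
move=> y _ iy cy; rewrite tractor_formE//.
rewrite -(form_eval_delta (H' c y)) -(form_eval_delta (inner_form g c y)) H'E//.
by rewrite /form_eval /inner_form trmx_mul !mulmxA.
Qed.

Lemma lower_block_transition (c c' : chart M) (x : M) : dom c x -> dom c' x ->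
  drsubmx (H c' x) = density_transition c c' x ^+ 2 *:
    (jacobian c c' x *m drsubmx (H c x) *m (jacobian c c' x)^T).
Proof.
move=> cx c'x; rewrite (tractor_form_transition n_gt0 bc g_metric g_flat g_compact cx c'x).
rewrite -{1}[H c x]submxK /jet_transition tr_block_mx !mulmx_block block_mxKdr.
rewrite !mul0mx !add0r trmx0 mulmx0 add0r [(_ *: _)^T]linearZ /=.
by rewrite -!scalemxAl -scalemxAr scalerA expr2.
Qed.

(** Needed because the sign condition in [orbit] may be stated in a chart other than the one in
    which the rank is taken. *)
Lemma rank_lower_block (c c' : chart M) (x : M) : dom c x -> dom c' x ->
  \rank (drsubmx (H c' x)) = \rank (drsubmx (H c x)).
Proof.
move=> cx c'x; rewrite (lower_block_transition cx c'x).
have uJ := jacobian_unit cx c'x.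
have D0 : density_transition c c' x ^+ 2 != 0.
  by rewrite expf_neq0 ?gt_eqF ?density_transition_gt0.
rewrite (eqmx_scale _ D0) mxrankMfree; last by rewrite row_free_unit unitmx_tr.
by rewrite eqmxMfull// row_full_unit.
Qed.

Let form_props c x : boundary x -> dom c x ->
  [/\ (H c x)^T = H c x, differential c (sigma g c) x != 0
    & (kermx (H c x) == row_mx 0 (differential c (sigma g c) x))%MS].
Proof.
move=> bx cx; split; first exact: tractor_form_sym.
  exact: (differential_sigma_boundary n_gt0 bc g_metric g_flat g_compact bx cx).
by have := tractor_form_kernel n_gt0 bc g_metric g_flat g_compact cx; rewrite L_sigma_boundary.
Qed.

Local Notation q c x := (tilde_metric (H c x) canonical_vector canonical_vector).

Lemma rank_isotropic c x : boundary x -> dom c x -> q c x = 0 ->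
  \rank (drsubmx (H c x)) = n.-1.
Proof. by move=> bx cx; have [sH l0 kH] := form_props bx cx; exact: rank_block_isotropic kH. Qed.

Lemma rank_nonisotropic c x : boundary x -> dom c x -> q c x != 0 ->
  \rank (drsubmx (H c x)) = n.
Proof. by move=> bx cx; have [sH l0 kH] := form_props bx cx; exact: rank_block_nonisotropic kH. Qed.

Lemma orbit_zero_rank c x : orbit_zero g x -> dom c x -> \rank (drsubmx (H c x)) = n.-1.
Proof.
move=> [bx [H' [tH' [c' c'x q0]]]] cx; rewrite (rank_lower_block c'x cx).
apply: rank_isotropic => //; rewrite -(tractor_metric_unique tH' c'x).
by apply: q0; exact: canonical_vector_line.
Qed.

Lemma orbit_definite_rank c x : (orbit_plus g `|` orbit_minus g) x -> dom c x ->
  \rank (drsubmx (H c x)) = n.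
Proof.
move=> op cx; have [bx [c' c'x q0]] : boundary x /\ exists2 c', dom c' x & q c' x != 0.
  case: op => -[bx [H' [tH' [c' c'x q0]]]]; split=> //; exists c' => //;
  rewrite -(tractor_metric_unique tH' c'x).
    by rewrite gt_eqF//; apply: q0; [exact: canonical_vector_line|exact: canonical_vector_neq0].
  by rewrite lt_eqF//; apply: q0; [exact: canonical_vector_line|exact: canonical_vector_neq0].
by rewrite (rank_lower_block c'x cx); exact: rank_nonisotropic.
Qed.

(** The canonical line is spanned by one vector, so the sign of the form on that vector decides. *)
Lemma orbit_cases x : boundary x ->
  orbit_zero g x \/ (orbit_plus g `|` orbit_minus g) x.
Proof.
move=> bx; have [c cx] := dom_cover x.
have tH := tractor_metric_form n_gt0 bc g_metric g_flat g_compact.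
have qE v : canonical_line v -> tilde_metric (H c x) v v = v 0 0 ^+ 2 * q c x.
  by move=> /canonical_lineP vE; rewrite {1 2}vE tilde_metricZ.
have v0 (v : 'cV[R]_(1 + n.+1)) : canonical_line v -> v != 0 -> 0 < v 0 0 ^+ 2.
  move=> /canonical_lineP vE; rewrite exprn_even_gt0//=; apply: contra => /eqP v00.
  by rewrite vE v00 scale0r.
have [q0|q0|q0] := ltgtP (q c x) 0.
- right; right; split=> //; exists H; split=> //; exists c => // v cv vn.
  by rewrite qE// pmulr_rlt0// v0.
- right; left; split=> //; exists H; split=> //; exists c => // v cv vn.
  by rewrite qE// pmulr_rgt0// v0.
- left; split=> //; exists H; split=> //; exists c => // v cv.
  by rewrite qE// q0 mulr0.
Qed.

(** * Boundary values of the rescaled inverse metric *)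

Variables (U : set M) (rho : M -> R).
Hypothesis rho_def : defining_function U rho.

Let oU : open U. Proof. by case: rho_def. Qed.

Let rho_smooth c : smooth_in c U rho. Proof. by case: rho_def => _ + _ _ _; apply. Qed.

Let rho_bdry x : U x -> boundary x -> rho x = 0.
Proof. by case: rho_def => _ _ _ + _ => H0 Ux bx; apply/(H0 x Ux). Qed.

Let rho_neq0 x : U x -> inner x -> rho x != 0.
Proof. by case: rho_def => _ _ _ + _ => H0 Ux ix; apply/eqP => /(H0 x Ux). Qed.

(** Here [rho] is an arbitrary defining function, unrelated to that of a collar, so the quotient
    comes from division along the face and not from the linear system. *)
Lemma sigma_quotient c : exists2 u, smooth_in c U u &
  forall x, U x -> dom c x -> sigma g c x = u x * rho x.
Proof.
apply: (smooth_in_quotient bc oU) => //.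
- apply: (smooth_in_sub oT oU) (smooth_sigma n_gt0 bc g_metric g_flat g_compact c) => //.
- by move=> x _ bx _; exact: sigma_boundary.
- by move=> x Ux bx _; exact: rho_bdry.
- by move=> x Ux ix _; exact: rho_neq0.
- by case: rho_def => _ _ _ _ dr x Ux bx; exact: dr.
Qed.

Definition sigma_ratio c : M -> R := s2val (cid2 (sigma_quotient c)).
Local Notation u := sigma_ratio.

Lemma smooth_sigma_ratio c : smooth_in c U (u c).
Proof. by rewrite /u; case: cid2. Qed.

Lemma sigma_ratioE c x : U x -> dom c x -> sigma g c x = u c x * rho x.
Proof. by rewrite /u; case: cid2 => f /= _; apply. Qed.

Lemma differential_sigma_ratio c x : U x -> dom c x ->
  differential c (sigma g c) x = u c x *: differential c rho x + rho x *: differential c (u c) x.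
Proof.
move=> Ux cx; apply/rowP => a; rewrite !mxE.
rewrite (@pd_eq _ _ _ c U oU a _ (fun y => u c y * rho y))//; last first.
  by move=> y Uy cy; exact: sigma_ratioE.
rewrite (pdM _ Ux cx)//; last exact: smooth_sigma_ratio.
by rewrite addrC mulrC.
Qed.

Lemma differential_sigma_ratio_boundary c x : U x -> boundary x -> dom c x ->
  differential c (sigma g c) x = u c x *: differential c rho x.
Proof. by move=> Ux bx cx; rewrite differential_sigma_ratio// rho_bdry// scale0r addr0. Qed.

Lemma sigma_ratio_neq0 c x : U x -> dom c x -> u c x != 0.
Proof.
move=> Ux cx; have [ix|/contrapT bx] := pselect (inner x).
  apply: contraNneq (sigma_neq0 g_metric ix cx) => u0.
  by rewrite sigma_ratioE// u0 mul0r.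
have := differential_sigma_boundary n_gt0 bc g_metric g_flat g_compact bx cx.
by rewrite differential_sigma_ratio_boundary//; apply: contraNneq => ->; rewrite scale0r.
Qed.

Lemma sigma_ratio_transition (c c' : chart M) x : U x -> dom c x -> dom c' x ->
  u c x = density_transition c c' x * u c' x.
Proof.
move=> Ux cx c'x; have oc := @dom_open R n M c'.
have cD : density_transition c c' @ nbhs x --> density_transition c c' x.
  exact: (smooth_in_cont oc (@smooth_density_transition _ _ _ c c') c'x cx).
have cu d : dom d x -> u d @ nbhs x --> u d x.
  by move=> dx; exact: (smooth_in_cont oU (@smooth_sigma_ratio d) Ux dx).
apply: (@inner_lim _ _ _ bc (u c) (fun y => density_transition c c' y * u c' y)) => //.
- exact: cu.
- by apply: cvgM => //; exact: cu.
have N1 : nbhs x (U `&` dom c').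
  by apply: open_nbhs_nbhs; split=> //; exact: openI.
have N2 : nbhs x (dom c) by apply: open_nbhs_nbhs; split=> //; exact: dom_open.
apply: filterS2 N1 N2 => y [Uy c'y] cy iy.
apply: (mulIf (rho_neq0 Uy iy)); rewrite -mulrA -!sigma_ratioE//.
exact: (sigma_transition g_metric).
Qed.

(** Inside, the lower block is [sigma ^- 2 *: g^-1], and [u ^ 2 * sigma ^- 2 = rho ^- 2]. *)
Definition bdry_tau (c : chart M) (x : M) : 'M[R]_n.+1 := u c x ^+ 2 *: drsubmx (H c x).

(* Obtained by eliminating [d rho] from [d sigma = u d rho + rho d u] in the
   interior expressions [inner_formE] of the blocks of [H]. *)
Definition bdry_lambda (c : chart M) (x : M) : 'cV[R]_n.+1 :=
  - (u c x ^+ 2 *: dlsubmx (H c x))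
  - (u c x)^-1 *: (bdry_tau c x *m (differential c (u c) x)^T).

(** Inside, [u ^ 2] times the corner entry of [H] is the wanted function plus a cross term and a
    square term in [d u]; these two are expressed through [bdry_lambda] and [bdry_tau] and
    subtracted. *)
Definition bdry_norm (c : chart M) (x : M) : R :=
  u c x ^+ 2 * H c x 0 0
  - 2 * (u c x)^-1 * (differential c (u c) x *m bdry_lambda c x) 0 0
  - (u c x) ^- 2 * (differential c (u c) x *m bdry_tau c x *m (differential c (u c) x)^T) 0 0.

Let smooth_H c : smooth_mx c U (H c).
Proof.
move=> i j; apply: (smooth_in_sub oT oU) => //.
exact: (smooth_tractor_form n_gt0 bc g_metric g_flat g_compact c i j).
Qed.

Let smooth_uV c : smooth_in c U (fun x => (u c x)^-1).
Proof.
apply: (smooth_inV oU); last exact: smooth_sigma_ratio.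
by move=> x Ux cx; exact: sigma_ratio_neq0.
Qed.

Lemma smooth_bdry_tau c : smooth_mx c U (bdry_tau c).
Proof.
apply: (smooth_mxZ oU); first by apply: (smooth_inX oU); exact: smooth_sigma_ratio.
move=> i j; apply: (smooth_in_eq oU) (@smooth_H c (rshift 1 i) (rshift 1 j)) => x _ _.
by rewrite !mxE.
Qed.

Lemma smooth_bdry_lambda c : smooth_mx c U (bdry_lambda c).
Proof.
apply: (smooth_mxD oU); apply: (smooth_mxN oU).
  apply: (smooth_mxZ oU); first by apply: (smooth_inX oU); exact: smooth_sigma_ratio.
  move=> i j; apply: (smooth_in_eq oU) (@smooth_H c (rshift 1 i) (lshift n.+1 j)) => x _ _.
  by rewrite !mxE.
apply: (smooth_mxZ oU) => //; apply: (smooth_mxM oU); first exact: smooth_bdry_tau.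
by apply: (smooth_mxT oU); apply: (smooth_differential oU); exact: smooth_sigma_ratio.
Qed.

Lemma smooth_bdry_norm c : smooth_in c U (bdry_norm c).
Proof.
have sdu : smooth_mx c U (differential c (u c)).
  by apply: (smooth_differential oU); exact: smooth_sigma_ratio.
have st := @smooth_bdry_tau c; have sl := @smooth_bdry_lambda c.
apply: (smooth_inB oU); first apply: (smooth_inB oU).
- apply: (smooth_inM oU); last exact: smooth_H.
  by apply: (smooth_inX oU); exact: smooth_sigma_ratio.
- apply: (smooth_inM oU); first exact: smooth_inZ.
  exact: (smooth_mxM oU sdu sl 0 0).
- apply: (smooth_inM oU); last first.
    exact: (smooth_mxM oU (smooth_mxM oU sdu st) (smooth_mxT oU sdu) 0 0).
  apply: (smooth_in_eq oU) (smooth_inX oU 2 (@smooth_uV c)) => x _ _.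
  by rewrite exprVn.
Qed.

Lemma inner_formE c x : inner x -> dom c x ->
  let B := inner_block g c x in let w := - (sigma g c x)^-1 *: differential c (sigma g c) x in
  inner_form g c x = block_mx (w *m B *m w^T) (w *m B) (B *m w^T) B.
Proof.
move=> ix cx B w.
have wE : weight (levi_civita g c) x = w.
  rewrite /w (differential_sigma bc g_metric ix cx) scalerA mulrNN mulVf ?scale1r//.
  exact: (sigma_neq0 g_metric).
rewrite /inner_form splittingE wE /split_inner_form -/(inner_block g c x) -/B /shear.
rewrite tr_block_mx !trmx1 !trmx0 !mulmx_block.
by rewrite !(mulmx0, mul0mx, mulmx1, mul1mx, addr0, add0r).
Qed.

Lemma bdry_tau_inner c x : U x -> inner x -> dom c x ->
  bdry_tau c x = rho x ^- 2 *: invmx (g c x).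
Proof.
move=> Ux ix cx; rewrite /bdry_tau tractor_formE// inner_formE// block_mxKdr.
rewrite /inner_block scalerA sigma_ratioE//; congr (_ *: _).
have u0 := sigma_ratio_neq0 Ux cx; have r0 := rho_neq0 Ux ix.
by field; rewrite u0 r0.
Qed.

Lemma bdry_lambda_inner c x : U x -> inner x -> dom c x ->
  bdry_lambda c x = rho x ^- 3 *: (invmx (g c x) *m (differential c rho x)^T).
Proof.
move=> Ux ix cx; rewrite /bdry_lambda bdry_tau_inner// tractor_formE// inner_formE// block_mxKdl.
rewrite /inner_block differential_sigma_ratio// sigma_ratioE//.
have u0 := sigma_ratio_neq0 Ux cx; have r0 := rho_neq0 Ux ix.
set G := invmx _; set P := differential c rho x; set Q := differential c (u c) x.
rewrite [(- _ *: _)^T]linearZ /= [(_ + _)^T]linearD /= ![(_ *: _)^T]linearZ /=.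
rewrite -!scalemxAl -!scalemxAr mulmxDr -!scalemxAr.
move: (G *m P^T) (G *m Q^T) => A B; apply/colP => i; rewrite !mxE.
by field; rewrite u0 r0.
Qed.

Lemma bdry_norm_inner c x : U x -> inner x -> dom c x ->
  bdry_norm c x = rho x ^- 4 *
    (differential c rho x *m invmx (g c x) *m (differential c rho x)^T) 0 0.
Proof.
move=> Ux ix cx; rewrite /bdry_norm bdry_tau_inner// bdry_lambda_inner// tractor_formE// inner_formE//.
have -> : (0 : 'I_(1 + n.+1)) = lshift n.+1 0 by exact: val_inj.
rewrite block_mxEul /inner_block differential_sigma_ratio// sigma_ratioE//.
have u0 := sigma_ratio_neq0 Ux cx; have r0 := rho_neq0 Ux ix.
set G := invmx _; set P := differential c rho x; set Q := differential c (u c) x.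
have GT : G^T = G by rewrite trmx_inv (metric_trmx g_metric ix cx).
have PQ : P *m G *m Q^T = Q *m G *m P^T.
  have tr1 (A : 'M[R]_1) : A = A^T by rewrite [A]mx11_scalar tr_scalar_mx.
  by rewrite [LHS]tr1 !trmx_mul trmxK GT mulmxA.
rewrite [(- _ *: _)^T]linearZ /= [(_ + _)^T]linearD /= ![(_ *: _)^T]linearZ /=.
rewrite -!(scalemxAl, scalemxAr) !(mulmxDl, mulmxDr) -!(scalemxAl, scalemxAr) !mulmxA PQ.
move: (P *m G *m P^T) (Q *m G *m P^T) (Q *m G *m Q^T) => A B C; rewrite !mxE.
by field; rewrite u0 r0.
Qed.

Lemma bdry_tau_sym c x : dom c x -> (bdry_tau c x)^T = bdry_tau c x.
Proof.
move=> cx; rewrite /bdry_tau linearZ /= trmx_drsub.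
by rewrite (tractor_form_sym n_gt0 bc g_metric g_flat g_compact cx).
Qed.

Lemma bdry_tau_transition (c c' : chart M) x : U x -> dom c x -> dom c' x ->
  bdry_tau c' x = jacobian c c' x *m bdry_tau c x *m (jacobian c c' x)^T.
Proof.
move=> Ux cx c'x; rewrite /bdry_tau (lower_block_transition cx c'x).
rewrite (sigma_ratio_transition Ux cx c'x) -scalemxAr -scalemxAl !scalerA.
by congr (_ *: _); ring.
Qed.

Lemma metric_inv_transition (c c' : chart M) x : inner x -> dom c x -> dom c' x ->
  invmx (g c' x) = jacobian c c' x *m invmx (g c x) *m (jacobian c c' x)^T.
Proof.
move=> ix cx c'x; case: (g_metric) => _ _ gu gt; rewrite (gt c c' x ix cx c'x).
have uJ : jacobian c c' x \in unitmx by exact: jacobian_unit.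
have uJT : (jacobian c c' x)^T \in unitmx by rewrite unitmx_tr.
have uG := gu c' x ix c'x.
by rewrite invmx_mul ?unitmx_mul ?uJT// invmx_mul// !mulmxA mulmxV// mul1mx mulmxKV.
Qed.

(** Neither [dlsubmx H] nor [d u] is tensorial by itself, so the law is read off inside, where the
    field is [rho ^- 3] times the gradient of [rho], and passes to the boundary by density. *)
Lemma bdry_lambda_transition (c c' : chart M) x : U x -> dom c x -> dom c' x ->
  bdry_lambda c' x = jacobian c c' x *m bdry_lambda c x.
Proof.
move=> Ux cx c'x; have oc := @dom_open R n M c'; have oUc : open (U `&` dom c') by exact: openI.
have sJ : smooth_mx c (U `&` dom c') (jacobian c c').
  move=> i j; apply: (smooth_in_sub oc oUc) (@smooth_in_jacobian _ _ _ c c' j i).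
  by move=> y [[]].
have sl : smooth_mx c (U `&` dom c') (bdry_lambda c).
  by move=> i j; apply: (smooth_in_sub oU oUc) (@smooth_bdry_lambda c i j) => y [[]].
have sR := smooth_mxM oUc sJ sl.
apply/matrixP => i j.
apply: (@inner_lim _ _ _ bc (fun y => bdry_lambda c' y i j)
  (fun y => (jacobian c c' y *m bdry_lambda c y) i j)).
- exact: (smooth_in_cont oU (@smooth_bdry_lambda c' i j) Ux c'x).
- exact: (smooth_in_cont oUc (sR i j) (conj Ux c'x) cx).
have N1 : nbhs x (U `&` dom c') by apply: open_nbhs_nbhs; split.
have N2 : nbhs x (dom c) by apply: open_nbhs_nbhs; split=> //; exact: dom_open.
apply: filterS2 N1 N2 => y [Uy c'y] cy iy.
rewrite !bdry_lambda_inner// (metric_inv_transition iy cy c'y).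
rewrite (differential_chain oU (@rho_smooth c') Uy cy c'y) trmx_mul -scalemxAr.
by rewrite !mulmxA.
Qed.

Lemma bdry_norm_transition (c c' : chart M) x : U x -> dom c x -> dom c' x ->
  bdry_norm c' x = bdry_norm c x.
Proof.
move=> Ux cx c'x.
apply: (@inner_lim _ _ _ bc (bdry_norm c') (bdry_norm c)).
- exact: (smooth_in_cont oU (@smooth_bdry_norm c') Ux c'x).
- exact: (smooth_in_cont oU (@smooth_bdry_norm c) Ux cx).
have oc := @dom_open R n M c'.
have N1 : nbhs x (U `&` dom c') by apply: open_nbhs_nbhs; split=> //; exact: openI.
have N2 : nbhs x (dom c) by apply: open_nbhs_nbhs; split=> //; exact: dom_open.
apply: filterS2 N1 N2 => y [Uy c'y] cy iy.
rewrite (bdry_norm_inner Uy iy cy) (bdry_norm_inner Uy iy c'y) (metric_inv_transition iy cy c'y).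
by rewrite (differential_chain oU (@rho_smooth c') Uy cy c'y) trmx_mul !mulmxA.
Qed.

Lemma rank_bdry_tau c x : U x -> dom c x -> \rank (bdry_tau c x) = \rank (drsubmx (H c x)).
Proof.
move=> Ux cx; have u2 : u c x ^+ 2 != 0 by rewrite expf_neq0// sigma_ratio_neq0.
by rewrite /bdry_tau (eqmx_scale _ u2).
Qed.

Lemma differential_bdry c x : U x -> boundary x -> dom c x ->
  differential c rho x *m bdry_tau c x = 0 /\ differential c rho x *m bdry_lambda c x = 0.
Proof.
move=> Ux bx cx; have u0 := sigma_ratio_neq0 Ux cx.
have [sH l0 kH] := form_props bx cx; have [lh lB] := kernel_lower kH.
have dE : differential c rho x = (u c x)^-1 *: differential c (sigma g c) x.
  by rewrite differential_sigma_ratio_boundary// scalerA mulVf// scale1r.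
have dt : differential c rho x *m bdry_tau c x = 0.
  by rewrite dE /bdry_tau -scalemxAl -scalemxAr lB !scaler0.
split=> //; rewrite /bdry_lambda mulmxBr mulmxN -!scalemxAr mulmxA dt mul0mx scaler0 subr0.
by rewrite dE -scalemxAl lh !scaler0 oppr0.
Qed.

End Orbits.

Theorem theorem3p12 (R : realType) (n : nat) (M : manifold R n)
    (g : chart M -> M -> 'M[R]_n.+1) (U : set M) (rho : M -> R)
    (n_gt0 : (0 < n)%N)
    (g_metric : pseudo_riemannian g)
    (g_compact : projectively_compact g)
    (g_flat : ricci_flat g)
    (rho_def : defining_function U rho) :
  @boundary R n M = orbit_plus g `|` orbit_zero g `|` orbit_minus g /\
  [/\ exists tau : chart M -> M -> 'M[R]_n.+1,
        [/\ sym_bivector_field U tau,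
            forall c x, U x -> inner x -> dom c x ->
              tau c x = rho x ^- 2 *: invmx (g c x)
          & forall c x, U x -> boundary x -> dom c x ->
              [/\ tau c x *m (differential c rho x)^T = 0,
                  (orbit_plus g `|` orbit_minus g) x <->
                    \rank (tau c x) = n
                & orbit_zero g x -> \rank (tau c x) = n.-1]],
      exists lambda : chart M -> M -> 'cV[R]_n.+1,
        [/\ vector_field U lambda,
            forall c x, U x -> inner x -> dom c x ->
              lambda c x =
                rho x ^- 3 *: (invmx (g c x) *m (differential c rho x)^T)
          & forall c x, U x -> boundary x -> dom c x ->
              differential c rho x *m lambda c x = 0]
    & exists2 f : M -> R, smooth_on U f &
        forall c x, U x -> inner x -> dom c x ->
          f x = rho x ^- 4 *
            (differential c rho x *m invmx (g c x)
               *m (differential c rho x)^T) 0 0].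
Proof.
have oU : open U by case: rho_def.
pose tau := bdry_tau n_gt0 g_metric g_flat g_compact rho_def.
pose lam := bdry_lambda n_gt0 g_metric g_flat g_compact rho_def.
pose nrm := bdry_norm n_gt0 g_metric g_flat g_compact rho_def.
have cases := orbit_cases n_gt0 g_metric g_flat g_compact.
split.
  apply/seteqP; split=> [x bx|x [[[]|[]]|[]]//].
  by have [z|[p|m]] := cases x bx; [left; right|left; left|right].
split.
- exists tau; split=> [|c x Ux ix cx|c x Ux bx cx].
  + split=> [c a b|c x Ux cx|c c' x Ux cx c'x].
    * exact: (smooth_bdry_tau n_gt0 g_metric g_flat g_compact rho_def).
    * exact: bdry_tau_sym.
    * exact: bdry_tau_transition.
  + exact: bdry_tau_inner.
  have rz : orbit_zero g x -> \rank (tau c x) = n.-1.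
    by move=> z; rewrite /tau rank_bdry_tau//; exact: orbit_zero_rank.
  split=> //.
    have [dt _] := differential_bdry n_gt0 g_metric g_flat g_compact rho_def Ux bx cx.
    apply: trmx_inj; rewrite trmx_mul trmxK trmx0 -[RHS]dt.
    by rewrite bdry_tau_sym.
  split=> [pm|rn]; first by rewrite /tau rank_bdry_tau//; exact: orbit_definite_rank.
  (* A point of rank [n] in the isotropic orbit would give [n = n.-1], contrary to [n_gt0]. *)
  have [z|//] := cases x bx; exfalso.
  by have := rz z; rewrite rn => nn; have := ltnn n; rewrite {1}nn ltn_predL n_gt0.
- exists lam; split=> [|c x Ux ix cx|c x Ux bx cx].
  + split=> [c a|c c' x Ux cx c'x]; last exact: bdry_lambda_transition.
    exact: (smooth_bdry_lambda n_gt0 g_metric g_flat g_compact rho_def).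
  + exact: bdry_lambda_inner.
  + by have [_] := differential_bdry n_gt0 g_metric g_flat g_compact rho_def Ux bx cx.
(* A single function on the manifold is required, while [nrm] is given chart by chart: a chart is
   chosen at each point, and [bdry_norm_transition] makes the choice immaterial. *)
pose cc (x : M) := sval (cid (dom_cover x)).
have ccx x : dom (cc x) x by rewrite /cc; case: cid.
exists (fun x => nrm (cc x) x) => [c|c x Ux ix cx].
  apply: (smooth_in_eq oU) (smooth_bdry_norm n_gt0 g_metric g_flat g_compact rho_def c).
  by move=> x Ux cx; exact: (bdry_norm_transition n_gt0 g_metric g_flat g_compact rho_def Ux (ccx x) cx).
transitivity (nrm c x); first by rewrite /nrm; apply: bdry_norm_transition.
exact: bdry_norm_inner.
Qed.
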